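(* Let $k$ be an infinite field of characteristic not $2$, let $l/k$ be a normal and separable extension field, and let $i\colon \mathrm{Gal}(l/k) \hookrightarrow U_{36} \subset G \cong \mathrm{Sp}_6(\mathbb{F}_2) \subset S_{28}$ be an injective group homomorphism. Then there exists a nonsingular plane quartic curve $C$ over $k$ such that $l$ is the field of definition of the 28 bitangents of $C$ and each $\sigma \in \mathrm{Gal}(l/k)$ permutes the bitangents as described by $i(\sigma) \in G \subset S_{28}$.
   Context: A nonsingular plane quartic $C\subset \mathbb{P}^2$ over a field $k$ of characteristic $\neq 2$ is a quartic that is smooth over the algebraic closure. It has exactly 28 bitangents over the separable closure $k^{\mathrm{sep}}$, and $\mathrm{Gal}(k^{\mathrm{sep}}/k)$ permutes them. The field of definition of the bitangents is the smallest extension of $k$ inside $k^{\mathrm{sep}}$ over which all 28 are defined. The groups $G$ and $U_{36}$: the subgroup $G \subset S_{28}$ of all admissible permutations of the 28 bitangents is independent of the choice of $C$ and isomorphic to $\mathrm{Sp}_6(\mathbb{F}_2)$. Concretely, each bitangent $L$ has a contact divisor $D_L$ of degree 2 with $2D_L = L\cap C$, and the admissible permutations are those preserving the set of the 315 four-element sets $\{L_1,\dots,L_4\}$ of bitangents with $D_{L_1}+\dots+D_{L_4}\sim 2K_C$ (syzygetic tetrads). An explicit model is the following. Let $P$ be the set of the 28 two-element subsets of $\{1,\dots,8\}$, and let $T$ be the collection of the 315 four-element subsets of $P$ which, viewed as edge sets of graphs on $\{1,\dots,8\}$, are either 4-cycles (210 of them) or perfect matchings (105 of them). Then $G$ is the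 group of all permutations of $P$ that preserve $T$. The subgroup $U_{36}\subset G$ is the subgroup of index 36, unique up to conjugation. In this model, it is the image of the natural injection $S_8\to \mathrm{Sym}(P)\cong S_{28}$, so that $U_{36}\cong S_8$. That each $\sigma$ permutes the bitangents as described by $i(\sigma)$ means: there is a bijection $\beta$ from $P$ to the set of 28 bitangents of $C$, carrying $T$ onto the set of syzygetic tetrads (i.e. identifying $G$ with the group of admissible permutations), such that $\sigma(\beta(p)) = \beta(i(\sigma)(p))$ for all $p\in P$ and all $\sigma\in\mathrm{Gal}(l/k)$. *)

(* Defs.v *)
From HB Require Import structures.
From mathcomp Require Import all_boot all_order all_fingroup all_algebra.
From mathcomp Require Import all_solvable all_field.
From mathcomp.multinomials Require Export mpoly.

Set Implicit Arguments.
Unset Strict Implicit.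
Unset Printing Implicit Defensive.

Import GRing.Theory.
Local Open Scope ring_scope.

(* {1, ..., 8} is encoded as 'I_8. *)
Definition pair8 := {A : {set 'I_8} | #|A| == 2%N}.

Definition four_cycle (E : {set {set 'I_8}}) : bool :=
  [exists a, exists b, exists c, exists d,
    uniq [:: a; b; c; d] &&
    (E == [set [set a; b]; [set b; c]; [set c; d]; [set d; a]])].

(* For a set E of edges, partition E [set: 'I_8] says that E is a perfect
   matching. *)
Definition tetrads8 : {set {set pair8}} :=
  [set t : {set pair8} |
    let E := [set val p | p in t] in four_cycle E || partition E [set: 'I_8]].

(* The stabiliser of tetrads8 under the action of {perm pair8} on subsets. *)
Definition admissible_group := 'N(tetrads8 | 'P^* )%g.

Lemma pair_img_proof (s : 'S_8) (p : pair8) : #|s @: val p| == 2%N.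
Proof. by rewrite card_imset ?(valP p) //; apply: perm_inj. Qed.

Definition pair_img (s : 'S_8) (p : pair8) : pair8 :=
  exist _ (s @: val p) (pair_img_proof s p).

Lemma pair_img_inj (s : 'S_8) : injective (pair_img s).
Proof.
move=> p q /(congr1 val) /= e; apply/val_inj => /=.
by apply: (imset_inj (@perm_inj _ s)).
Qed.

Definition pair_perm (s : 'S_8) : {perm pair8} := perm (@pair_img_inj s).

Definition U36 : {set {perm pair8}} := [set pair_perm s | s in [set: 'S_8]].

Lemma val_pair_perm (s : 'S_8) (t : {set pair8}) :
  [set val p | p in pair_perm s @: t] =
  [set s @: A | A : {set 'I_8} in [set val p | p in t]].
Proof.
rewrite -!imset_comp; apply: eq_imset => p /=.
by rewrite permE.
Qed.

Lemma pair_perm_tetrads8 (s : 'S_8) (t : {set pair8}) :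
  t \in tetrads8 -> pair_perm s @: t \in tetrads8.
Proof.
rewrite /tetrads8 !in_set /= val_pair_perm; set E := [set val p | p in t].
case/orP => [cycE | /and3P[/eqP covE trE E0]]; apply/orP; [left | right].
  case/existsP: cycE => a /existsP[b /existsP[c /existsP[d /andP[abcd /eqP ->]]]].
  apply/existsP; exists (s a); apply/existsP; exists (s b).
  apply/existsP; exists (s c); apply/existsP; exists (s d).
  rewrite -[[:: _; _; _; _]]/(map s [:: a; b; c; d]).
  rewrite (map_inj_uniq (@perm_inj _ s)) abcd /=.
  by rewrite !imsetU !imset_set1 !imsetU !imset_set1.
apply/and3P; split.
- apply/eqP/setP => x; rewrite inE; apply/bigcupP.
  have: (s^-1)%g x \in cover E by rewrite covE inE.
  case/bigcupP => A AE xA; exists (s @: A); first exact: imset_f.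
  by apply/imsetP; exists ((s^-1)%g x); rewrite ?permKV.
- apply/trivIsetP => _ _ /imsetP[A AE ->] /imsetP[B BE ->] nAB.
  have {}nAB : A != B by apply: contraNneq nAB => ->.
  by rewrite imset_disjoint ?(trivIsetP trE) //; apply: perm_inj.
- apply: contra E0 => /imsetP[A AE /esym/eqP].
  by rewrite imset_eq0 => /eqP <-.
Qed.

Lemma U36_sub_admissible : U36 \subset admissible_group.
Proof.
apply/subsetP => _ /imsetP[s _ ->]; rewrite !inE /=.
apply/subsetP => t tT; rewrite inE /= /setact.
have -> : [set aperm x (pair_perm s) | x in t] = pair_perm s @: t by [].
exact: pair_perm_tetrads8.
Qed.

Definition infinite_type (T : eqType) : Prop :=
  forall s : seq T, exists x, x \notin s.

(* Points and lines of P^2(K) are nonzero row vectors up to scaling; two of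
   them are equal when (u == v)%MS.  A plane curve is given by a form F. *)
Section PlaneCurve.
Variable K : closedFieldType.
Implicit Types (F G : {mpoly K[3]}) (P L M : 'rV[K]_3).

Definition ev F P : K := F.@[fun j => P 0 j].

Definition grad F P : 'rV[K]_3 := \row_j ev F^`M(j) P.

Definition linform L : {mpoly K[3]} := \sum_(j < 3) L 0 j *: 'X_j.

Definition on_curve F P : Prop := P != 0 /\ ev F P = 0.

Definition smooth_curve F : Prop :=
  forall P, on_curve F P -> grad F P != 0.

(* The form G vanishes to order exactly n at the smooth point P of F = 0: in the
   local ring of the curve at P, a discrete valuation ring, (a local equation
   of) G is a unit times the n-th power of a uniformizer.  As uniformizer we
   take (a local equation of) a line M through P other than the tangent line,
   whose coordinates are grad F P. *)
Definition ord_at F P G (n : nat) : Prop :=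
  exists M,
    [/\ ev (linform M) P = 0, ~~ (M <= grad F P)%MS &
      exists (d1 d2 : nat) (U V A : {mpoly K[3]}),
        [/\ U \is d1.-homog, V \is d2.-homog, ev U P != 0, ev V P != 0 &
            U * G - V * linform M ^+ n = A * F]].

(* Only the values of a divisor at the points of the curve matter. *)
Definition divisor := 'rV[K]_3 -> int.

(* D is the divisor cut out on the curve by G, which in particular does not
   vanish identically on it. *)
Definition div_of F G (D : divisor) : Prop :=
  forall P, on_curve F P -> exists2 n : nat, ord_at F P G n & D P = n%:Z.

(* D - D' is the divisor of a rational function G / H. *)
Definition lin_equiv F (D D' : divisor) : Prop :=
  exists (d : nat) (G H : {mpoly K[3]}) (DG DH : divisor),
    [/\ G \is d.-homog, H \is d.-homog, div_of F G DG, div_of F H DH &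
        forall P, on_curve F P -> D P - D' P = DG P - DH P].

(* By adjunction, the canonical class of a smooth plane quartic is the class of
   its line sections. *)
Definition canonical_divisor F (D : divisor) : Prop :=
  exists2 M, M != 0 & div_of F (linform M) D.

Definition contact_divisor F L (D : divisor) : Prop :=
  div_of F (linform L) (fun P => D P *+ 2).

(* Hyperflex lines, whose contact divisor is twice a point, are included. *)
Definition bitangent F L : Prop :=
  L != 0 /\ exists D, contact_divisor F L D.

(* s lists four distinct bitangents with D_1 + D_2 + D_3 + D_4 ~ 2 K_C. *)
Definition syzygetic F (s : seq 'rV[K]_3) : Prop :=
  [/\ size s = 4%N,
      pairwise (fun L M => ~~ (L == M)%MS) s,
      forall L, L \in s -> bitangent F L &
      exists (D : 'rV[K]_3 -> divisor) (KC : divisor),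
        [/\ forall L, L \in s -> contact_divisor F L (D L),
            canonical_divisor F KC &
            lin_equiv F (fun P => \sum_(L <- s) D L P) (fun P => KC P *+ 2)]].

Definition line_defined_over (E : K -> Prop) L : Prop :=
  exists2 M : 'rV[K]_3, (M == L)%MS & forall j, E (M 0 j).

End PlaneCurve.

(* Below, K is an algebraic closure of k, via f; the separable closure of k is
   the set of all z : K with separable_elt f z. *)
Section OverBaseField.
Variables (k : fieldType) (K : closedFieldType) (f : {rmorphism k -> K}).

Definition nonsingular_quartic (F : {mpoly k[3]}) : Prop :=
  F \is 4.-homog /\ smooth_curve (map_mpoly f F).

Definition separable_elt (z : K) : Prop :=
  exists2 p : {poly k}, separable_poly p & root (map_poly f p) z.

Definition sep_bitangent (F : {mpoly k[3]}) (L : 'rV[K]_3) : Prop :=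
  bitangent (map_mpoly f F) L /\ line_defined_over separable_elt L.

Definition separable_subextension (E : K -> Prop) : Prop :=
  [/\ forall x : k, E (f x),
      forall y z, E y -> E z -> E (y - z),
      forall y z, E y -> E z -> E (y * z),
      forall y, E y -> E y^-1 &
      forall y, E y -> separable_elt y].

Definition bitangents_defined_over (F : {mpoly k[3]}) (E : K -> Prop) : Prop :=
  forall L, sep_bitangent F L -> line_defined_over E L.

Definition field_of_def_bitangents (F : {mpoly k[3]}) (E : K -> Prop) : Prop :=
  [/\ separable_subextension E,
      bitangents_defined_over F E &
      forall E' : K -> Prop, separable_subextension E' ->
        bitangents_defined_over F E' -> forall z, E z -> E' z].

End OverBaseField.

(* beta induces a bijection from pair8 onto the set of bitangents (over the
   separable closure) of F, which carries tetrads8 onto the set of syzygetic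
   tetrads.  The bitangents are given by coordinates in l. *)
Definition bitangent_marking (k l : fieldType) (K : closedFieldType)
    (f : {rmorphism k -> K}) (e : {rmorphism l -> K})
    (F : {mpoly k[3]}) (beta : pair8 -> 'rV[l]_3) : Prop :=
  [/\ forall p, sep_bitangent f F (map_mx e (beta p)),
      forall p q, (beta p == beta q)%MS -> p = q,
      forall L, sep_bitangent f F L ->
        exists p, (map_mx e (beta p) == L)%MS &
      forall t : {set pair8},
        t \in tetrads8 <->
        syzygetic (map_mpoly f F) [seq map_mx e (beta p) | p <- enum t]].

(* Main.v *)
Require Import Defs.
From HB Require Import structures.
From mathcomp Require Import all_boot all_order all_fingroup all_algebra.
From mathcomp Require Import all_solvable all_field.
From mathcomp Require Import ring.
From Stdlib Require Import ClassicalEpsilon.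

Set Implicit Arguments.
Unset Strict Implicit.
Unset Printing Implicit Defensive.

Import GRing.Theory.
Local Open Scope ring_scope.

(** Eight points on a rational quartic curve in P^3 define a net of quadrics,
    whose discriminant is a plane quartic with 28 explicit bitangents. Let t_1,
    ..., t_8 be distinct elements with sum 0 such that no four of them add up
    to 0, and let f = X^8 + a_6 X^6 + ... + a_0 be the octic with these roots.
    The points p_j = (1 : t_j : t_j^2 : t_j^4) of P^3 are the base points of a
    net of quadrics: two of them cut out the curve (1 : t : t^2 : t^4), and the
    third one restricts to f on it. The discriminant of the net, a symmetric 4
    x 4 determinant, is a plane quartic F whose coefficients are polynomials in
    the a_i. If the points t_j are permuted by a Galois group through its
    action on {1, ..., 8}, then f, and so F, is defined over the base field,
    while the line [pair_row i j] attached to p_i and p_j (the quadrics of the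
    net that contain the line through p_i and p_j) is moved exactly as the pair
    {i, j}.

    Smoothness ([quarticm_smooth]). At a singular point of F the kernel of the
    quadric is a base point of the net ([kernel_derivative], [base_point]), but
    the quadrics of the net are smooth at the base points ([net_transversal]).
    The corank is 1 because a quadric of rank 2 would split f into two quartic
    polynomials without cubic term ([net_rank]), that is, four of the t_j would
    have sum 0.

    Bitangents. For a splitting of the octic into two quartic polynomials there
    is a pencil A m^2 + B m + C of conics, of discriminant a square times F, in
    which the products of two of the lines, for complementary pairs in one of
    the quadruples, are the values at explicit m ([steiner_pencil]). Two of
    these values give an identity c F = Q^2 - 4 l_1 l_2 l_3 l_4 for four edges
    that form a 4-cycle or a perfect matching ([cycle_conic],
    [matching_conic]). So the 28 lines are bitangents, they are distinct, and
    the tetrads are syzygetic. Conversely, on a bitangent the pencil of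
    quadrics has a square characteristic polynomial, hence a common isotropic
    line; the third quadric meets this line in two base points, and the
    bitangent is that of this pair ([bitangent_pair_row]).

    Syzygetic implies tetrad. The half-divisors of the 28 lines modulo linear
    equivalence and line sections obey the relations of the tetrads, and the
    half-divisors of two distinct lines do not add up to the divisor of G / H
    with deg G = deg H + 1: by Max Noether's theorem ([noether]) G / H would be
    a linear form, and its square the product of the two lines
    ([contact_inequiv]). Every set of four edges other than a 4-cycle or a
    perfect matching is reduced by tetrads to a pair of distinct edges
    ([tetrad_of_C]).

    Choice of the points. By independence of characters, symmetrizing functions
    on the Galois group gives equivariant t_j that avoid any given finite set
    of hyperplanes, since the base field is infinite
    ([exists_equivariant_points]). An automorphism that fixes all 28 lines
    fixes all pairs, so it is trivial: the field of definition is the whole of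
    l. *)

(** * The quartic and its bitangents as explicit forms *)

Section QuarticForm.
Variable R : comNzRingType.

(** The determinant of the matrix [net] below, expanded ([det_net]); x and y
    are the coordinates on the pencil of quadrics through the rational
    curve. *)
Definition quartic (a : nat -> R) (x y z : R) : R :=
  (4 * a 0%N * a 3%N * a 5%N * a 6%N - 4 * a 0%N * a 3%N ^+ 2 - 4 * a 0%N * a 4%N * a 5%N ^+ 2
   + 4 * a 1%N * a 2%N * a 3%N - 2 * a 1%N * a 2%N * a 5%N * a 6%N - 4 * a 1%N ^+ 2 * a 4%N
   + a 1%N ^+ 2 * a 6%N ^+ 2 + a 2%N ^+ 2 * a 5%N ^+ 2) * z ^+ 4
  + (4 * a 0%N * a 6%N ^+ 2 - 16 * a 0%N * a 4%N + 4 * a 1%N * a 3%N - 2 * a 1%N * a 5%N * a 6%N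
     + 2 * a 2%N * a 5%N ^+ 2 + 4 * a 2%N ^+ 2) * x * z ^+ 3
  + (2 * a 1%N * a 3%N * a 6%N - 4 * a 0%N * a 5%N ^+ 2 - 4 * a 1%N * a 4%N * a 5%N
     - 4 * a 1%N ^+ 2 + 2 * a 2%N * a 3%N * a 5%N) * y * z ^+ 3
  + (8 * a 2%N + a 5%N ^+ 2) * x ^+ 2 * z ^+ 2
  + (4 * a 2%N * a 6%N + 2 * a 3%N * a 5%N - 16 * a 0%N) * x * y * z ^+ 2
  + (a 3%N ^+ 2 - 4 * a 1%N * a 5%N) * y ^+ 2 * z ^+ 2
  + 4 * x ^+ 3 * z + 4 * a 6%N * x ^+ 2 * y * z + 4 * a 4%N * x * y ^+ 2 * z
  + 4 * x * y ^+ 3.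

(** The condition that a quadric of the net contain the line through two base
    points with parameters of sum u and product n: up to the square of their
    difference, it is the polar form of the two points ([netP_ell]). *)
Definition bitan (a : nat -> R) (u n x y z : R) : R :=
  let w := u ^+ 2 - 2 * n in
  x - u ^+ 2 * y
  - (u ^+ 2 * w ^+ 2 + a 6%N * u ^+ 2 * w + a 5%N * u * w + a 4%N * u ^+ 2 + a 3%N * u)
    * z.

Section Steiner.
Variables v c2 c1 c0 d2 d1 d0 : R.

(** The coefficients of (X^4 - v X^3 + c2 X^2 - c1 X + c0) (X^4 + v X^3 + d2
    X^2 + d1 X + d0). *)
Definition prod_coef (i : nat) : R :=
  [:: c0 * d0; c0 * d1 - c1 * d0; c0 * d2 - c1 * d1 + c2 * d0;
      c0 * v - c1 * d2 + c2 * d1 - v * d0; c0 - c1 * v + c2 * d2 - v * d1 + d0;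
      c2 * v - c1 - v * d2 + d1; c2 - v ^+ 2 + d2]`_i.

(** The coefficients A, B, C of the pencil of conics A m^2 + B m + C that
    belongs to a splitting of the octic into two quartic factors; a pairing of
    the four roots of a factor, with sums u and u', has the parameter m = u
    u'. *)
Definition steinerA (y z x : R) : R :=
  y ^+ 2 - v ^+ 2 * x * z + (2 * c0 - c1 * v + 2 * d0 - d1 * v) * y * z
  + (c0 * c2 * v ^+ 2 - c0 * c1 * v + 2 * c0 * d0 - c0 * d1 * v
     - c0 * d2 * v ^+ 2 + c0 ^+ 2 - c1 * d0 * v + c1 * d1 * v ^+ 2
     - c2 * d0 * v ^+ 2 - d0 * d1 * v + d0 * d2 * v ^+ 2 + d0 ^+ 2) * z ^+ 2.

Definition steinerB (y z x : R) : R :=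
  2 * x * y
  + (2 * c0 - c1 * v + c2 * v ^+ 2 + 2 * d0 - d1 * v + d2 * v ^+ 2) * x * z
  + (c1 * d2 * v - c0 * v ^+ 2 - 2 * c1 * d1 + c2 * d1 * v - d0 * v ^+ 2)
    * y * z
  + (c0 * c1 * d2 * v - 2 * c0 * c1 * d1 + c0 * c2 * d1 * v
     - c0 * c2 * d2 * v ^+ 2 - 4 * c0 * d0 * v ^+ 2 + c0 * d1 * v ^+ 3
     + c0 * d2 ^+ 2 * v ^+ 2 - c1 * c2 * d1 * v ^+ 2 - 2 * c1 * d0 * d1
     + c1 * d0 * d2 * v + c1 * d0 * v ^+ 3 - c1 * d1 * d2 * v ^+ 2
     + c1 * d1 ^+ 2 * v + c1 ^+ 2 * d1 * v + c2 * d0 * d1 * v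
     - c2 * d0 * d2 * v ^+ 2 + c2 ^+ 2 * d0 * v ^+ 2) * z ^+ 2.

Definition steinerC (y z x : R) : R :=
  x ^+ 2 - v ^+ 2 * x * y
  + (c1 * d2 * v - 2 * c1 * d1 + c2 * d1 * v - c2 * d2 * v ^+ 2) * x * z
  + (c0 * d0 * v ^+ 4 - c0 * d1 * d2 * v ^+ 3 + c0 * d1 ^+ 2 * v ^+ 2
     - c1 * c2 * d0 * v ^+ 3 + c1 * c2 * d1 * d2 * v ^+ 2
     - c1 * c2 * d1 ^+ 2 * v + c1 ^+ 2 * d0 * v ^+ 2 - c1 ^+ 2 * d1 * d2 * v
     + c1 ^+ 2 * d1 ^+ 2) * z ^+ 2.

(** The discriminant of the pencil is the quartic itself, so that any two of
    its members touch the quartic at the points of a conic. *)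
Lemma steiner_disc x y z :
  steinerB y z x ^+ 2 - 4 * steinerA y z x * steinerC y z x
  = v ^+ 2 * quartic prod_coef x y z.
Proof. rewrite /steinerA /steinerB /steinerC /quartic /prod_coef /=. by ring. Qed.

End Steiner.

Lemma bitan_pair_steiner (u n u' n' d2 d1 d0 x y z : R)
    (v := u + u') (c2 := n + n' + u * u') (c1 := u * n' + u' * n)
    (c0 := n * n') (m := u * u') (a := prod_coef v c2 c1 c0 d2 d1 d0) :
  bitan a u n x y z * bitan a u' n' x y z
  = steinerA v c2 c1 c0 d2 d1 d0 y z x * m ^+ 2
    + steinerB v c2 c1 c0 d2 d1 d0 y z x * m
    + steinerC v c2 c1 c0 d2 d1 d0 y z x.
Proof.
rewrite /bitan /steinerA /steinerB /steinerC /a /prod_coef /= /c0 /c1 /c2 /m /v.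
by ring.
Qed.
End QuarticForm.

(** * Congruences between forms *)

Section Congruence.
Variables (n : nat) (R : comNzRingType).
Implicit Types (G X Y : {mpoly R[n]}).

(** Congruence modulo (H, H') is compatible with products, so it is enough to
    compare a substitution with the identity on the variables. *)
Lemma eq_rmorph_modulo (H H' : {mpoly R[n]})
    (rho : {rmorphism {mpoly R[n]} -> {mpoly R[n]}}) :
    (forall c, rho c%:MP = c%:MP) ->
    (forall i, exists A B, 'X_i - rho 'X_i = A * H + B * H') ->
  forall G, exists A B, G - rho G = A * H + B * H'.
Proof.
move=> rhoC rhoX.
have stepM X Y : (exists A B, X - rho X = A * H + B * H') ->
    (exists A B, Y - rho Y = A * H + B * H') ->
    exists A B, X * Y - rho (X * Y) = A * H + B * H'.
  move=> [A [B e1]] [A' [B' e2]]; exists (A * Y + rho X * A'), (B * Y + rho X * B').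
  rewrite rmorphM /=.
  have -> : X * Y - rho X * rho Y = (X - rho X) * Y + rho X * (Y - rho Y) by ring.
  by rewrite e1 e2; ring.
have mon (m : 'X_{1..n}) : exists A B, 'X_[m] - rho 'X_[m] = A * H + B * H'.
  rewrite mpolyXE_id.
  apply: (big_ind (fun X => exists A B, X - rho X = A * H + B * H')) => //.
    by exists 0, 0; rewrite rmorph1 subrr !mul0r addr0.
  move=> i _; elim: (m i) => [|j IHj].
    by exists 0, 0; rewrite expr0 rmorph1 subrr !mul0r addr0.
  by rewrite exprS; apply: stepM.
elim/mpolyind => [|c m p _ _ [A [B e]]].
  by exists 0, 0; rewrite rmorph0 subrr !mul0r addr0.
have [A' [B' e']] := mon m.
exists (c%:MP * A' + A), (c%:MP * B' + B).
rewrite rmorphD -mul_mpolyC rmorphM rhoC.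
have -> : c%:MP * 'X_[m] + p - (c%:MP * rho 'X_[m] + rho p)
  = c%:MP * ('X_[m] - rho 'X_[m]) + (p - rho p) by ring.
by rewrite e e'; ring.
Qed.

Lemma pihomog_mulr d e (A G : {mpoly R[n]}) : G \is e.-homog ->
  pihomog mdeg d (A * G) =
    if (e <= d)%N then pihomog mdeg (d - e) A * G else 0.
Proof.
move=> hG; rewrite {1}[A](pihomog_partitionE (mf := mdeg) (leqnn _)).
rewrite mulr_suml linear_sum /=.
set k := mmeasure _ A.
have hi (i : 'I_k) : pihomog mdeg i A * G \is (i + e).-homog.
  by apply: dhomogM => //; apply: pihomogP.
have term (i : 'I_k) : pihomog mdeg d (pihomog mdeg i A * G)
    = if (i + e == d)%N then pihomog mdeg i A * G else 0.
  case: eqP => [<-|/eqP ne]; first by rewrite pihomog_dE.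
  by rewrite (pihomog_ne0 _ (hi i)).
under eq_bigr do rewrite term.
rewrite -big_mkcond /=; case: leqP => [led|ltd]; last first.
  rewrite big1 // => i /eqP ie; exfalso.
  by move: ltd; rewrite -ie ltnNge leq_addl.
have [ltk|lek] := ltnP (d - e) k.
  rewrite (big_pred1 (Ordinal ltk)) //= => i.
  by apply/eqP/eqP => [ie|->]; [apply/val_inj; rewrite /= -ie addnK | rewrite subnK].
rewrite big1 => [|i /eqP ie].
  rewrite pihomogE big1_seq ?mul0r // => m /andP [/eqP mde mA].
  by have := mmeasure_mnm_lt mdeg mA; rewrite -/k mde ltnNge lek.
by have := ltn_ord i; rewrite ltnNge (leq_trans lek) // -ie addnK.
Qed.

(** The part of degree d of a relation is again a relation. *)
Lemma homog_cofactor2 d e1 e2 (X H H' A B : {mpoly R[n]}) :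
    X \is d.-homog -> H \is e1.-homog -> H' \is e2.-homog ->
    X = A * H + B * H' ->
  exists A' B', [/\ A' \is (d - e1).-homog, B' \is (d - e2).-homog
    & X = A' * H + B' * H'].
Proof.
move=> hX hH hH' eX.
exists (if (e1 <= d)%N then pihomog mdeg (d - e1) A else 0).
exists (if (e2 <= d)%N then pihomog mdeg (d - e2) B else 0).
split; first by case: ifP => _; rewrite ?pihomogP ?dhomog0.
  by case: ifP => _; rewrite ?pihomogP ?dhomog0.
rewrite -[LHS](pihomog_dE hX) {1}eX pihomogD (pihomog_mulr _ _ hH).
by rewrite (pihomog_mulr _ _ hH'); congr (_ + _); case: ifP => _; rewrite ?mul0r.
Qed.

Lemma homog_cofactor d e1 (X H A : {mpoly R[n]}) :
    X \is d.-homog -> H \is e1.-homog -> X = A * H ->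
  exists2 A', A' \is (d - e1).-homog & X = A' * H.
Proof.
move=> hX hH eX.
have [|A' [B' [hA' _ e]]] := @homog_cofactor2 d e1 e1 X H 0 A 0 hX hH (dhomog0 _ _ _).
  by rewrite mulr0 addr0.
by exists A' => //; rewrite e mulr0 addr0.
Qed.

End Congruence.

(** * Linear forms and points *)

Section LinearForms.
Variable K : closedFieldType.
Implicit Types (F G X Y : {mpoly K[3]}) (P L M N T E O : 'rV[K]_3).

Lemma ev_linform L P : ev (linform L) P = \sum_j L 0 j * P 0 j.
Proof.
rewrite /ev /linform raddf_sum /=; apply: eq_bigr => j _.
by rewrite mevalZ mevalXU.
Qed.

Lemma ev_linform_mx L P : ev (linform L) P = (L *m P^T) 0 0.
Proof. by rewrite ev_linform mxE; apply: eq_bigr => j _; rewrite mxE. Qed.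

Lemma evM F G P : ev (F * G) P = ev F P * ev G P. Proof. exact: mevalM. Qed.
Lemma evD F G P : ev (F + G) P = ev F P + ev G P. Proof. exact: mevalD. Qed.
Lemma evB F G P : ev (F - G) P = ev F P - ev G P. Proof. exact: mevalB. Qed.
Lemma evN F P : ev (- F) P = - ev F P. Proof. exact: mevalN. Qed.
Lemma evX F n P : ev (F ^+ n) P = ev F P ^+ n. Proof. exact: rmorphXn. Qed.
Lemma evC c P : ev c%:MP P = c. Proof. exact: mevalC. Qed.
Lemma evZ c F P : ev (c *: F) P = c * ev F P. Proof. exact: mevalZ. Qed.
Lemma ev0 P : ev 0 P = 0. Proof. exact: meval0. Qed.
Lemma ev1 P : ev 1 P = 1. Proof. exact: meval1. Qed.
Definition evE := (evD, evB, evN, evM, evX, evC, evZ, ev0, ev1).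

Lemma linform_homog L : linform L \is 1.-homog.
Proof.
by apply: rpred_sum => j _; apply: dhomogZ; rewrite dhomogX /= mdeg1.
Qed.

Lemma linformD L M : linform (L + M) = linform L + linform M.
Proof.
by rewrite /linform -big_split; apply: eq_bigr => j _; rewrite mxE scalerDl.
Qed.

Lemma linformZ c L : linform (c *: L) = c *: linform L.
Proof.
by rewrite /linform scaler_sumr; apply: eq_bigr => j _; rewrite mxE scalerA.
Qed.

Lemma linform0 : linform (0 : 'rV[K]_3) = 0.
Proof. by rewrite -(scale0r 0) linformZ scale0r. Qed.

Lemma mcoeff_linform L j : (linform L)@_U_(j) = L 0 j.
Proof.
rewrite /linform raddf_sum /= (bigD1 j) //= mcoeffZ mcoeffXU eqxx mulr1.
rewrite big1 ?addr0 // => i ij; rewrite mcoeffZ mcoeffXU.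
by rewrite (negPf ij) mulr0.
Qed.

Lemma linform_inj : injective (@linform K).
Proof.
move=> L M e; apply/rowP => j.
by rewrite -!mcoeff_linform e.
Qed.

Lemma linform_eq0 L : (linform L == 0) = (L == 0).
Proof.
apply/eqP/eqP => [e|->]; last exact: linform0.
by apply: linform_inj; rewrite e linform0.
Qed.

Lemma homog1_linform G : G \is 1.-homog -> exists L, G = linform L.
Proof.
move=> hG; exists (\row_j G@_U_(j)); apply/mpolyP => m.
have [/eqP|ne] := boolP (mdeg m == 1%N); last first.
  rewrite (dhomog_nemf_coeff hG ne).
  by rewrite (dhomog_nemf_coeff (linform_homog _) ne).
by move/eqP/mdeg1P => [j /eqP ->]; rewrite mcoeff_linform mxE.
Qed.

Lemma homog0_const G : G \is 0.-homog -> exists c, G = c%:MP.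
Proof.
move=> hG; exists G@_0%MM; apply/mpolyP => m; rewrite mcoeffC.
have [->|ne] := eqVneq m 0%MM; first by rewrite mulr1.
by rewrite mulr0 (dhomog_nemf_coeff hG) //= mdeg_eq0.
Qed.

Definition dvdm F X : Prop := exists A, X = A * F.

Lemma dvdm_mull F A X : dvdm F X -> dvdm F (A * X).
Proof. by case=> B ->; exists (A * B); rewrite mulrA. Qed.
Lemma dvdm_mulr F A X : dvdm F X -> dvdm F (X * A).
Proof. by rewrite mulrC; apply: dvdm_mull. Qed.
Lemma dvdmD F X Y : dvdm F X -> dvdm F Y -> dvdm F (X + Y).
Proof. by move=> [A ->] [B ->]; exists (A + B); rewrite mulrDl. Qed.
Lemma dvdm0 F : dvdm F 0. Proof. by exists 0; rewrite mul0r. Qed.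
(** Solving M = 0 for one of the variables. *)
Lemma linform_retract M : M != 0 ->
  exists rho : {rmorphism {mpoly K[3]} -> {mpoly K[3]}},
    rho (linform M) = 0 /\ forall G, dvdm (linform M) (G - rho G).
Proof.
move=> /rV0Pn [j Mj].
pose e i : K := if i == j then (M 0 j)^-1 else 0.
pose rho : {rmorphism {mpoly K[3]} -> {mpoly K[3]}} :=
  mmap (@mpolyC 3 K) (fun i => 'X_i - e i *: linform M).
have rhoX i : rho 'X_i = 'X_i - e i *: linform M by rewrite /rho /= mmapX mmap1U.
have rhoC c : rho c%:MP = c%:MP by rewrite /rho /= mmapC.
exists rho; split.
  rewrite [X in rho X]/linform raddf_sum /=.
  under eq_bigr do rewrite -mul_mpolyC rmorphM rhoX rhoC mul_mpolyC scalerBr scalerA.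
  rewrite sumrB -/(linform M) -scaler_suml (bigD1 j) //= /e eqxx mulfV //.
  by rewrite big1 ?addr0 ?scale1r ?subrr // => i /negPf ->; rewrite mulr0.
move=> G; have [] := @eq_rmorph_modulo 3 K (linform M) 0 rho rhoC _ G.
  move=> i; exists (e i)%:MP, 0; rewrite rhoX mulr0 addr0 mul_mpolyC.
  by rewrite opprB addrC subrK.
by move=> A [B ->]; exists A; rewrite mulr0 addr0.
Qed.

(** The retraction is a morphism to a domain, and its kernel is generated by
    M. *)
Lemma linform_prime M X Y : M != 0 -> dvdm (linform M) (X * Y) ->
  dvdm (linform M) X \/ dvdm (linform M) Y.
Proof.
move=> /linform_retract [rho [rho0 modM]] [A eXY].
have /eqP : rho X * rho Y = 0 by rewrite -rmorphM eXY rmorphM rho0 mulr0.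
rewrite mulf_eq0; case/orP => /eqP e; [left|right].
  by move: (modM X); rewrite e subr0.
by move: (modM Y); rewrite e subr0.
Qed.

(** The lines through a point form a vector space of dimension two. *)
Lemma span_of_orth P M T N : P != 0 ->
    ev (linform M) P = 0 -> ev (linform T) P = 0 -> T != 0 ->
    ~~ (M <= T)%MS -> ev (linform N) P = 0 ->
  exists a b, N = a *: M + b *: T.
Proof.
rewrite !ev_linform_mx => P0 MP TP T0 MT NP.
have orth (V : 'rV[K]_3) : (V *m P^T) 0 0 = 0 -> (V <= kermx P^T)%MS.
  move=> e; apply/sub_kermxP/matrixP => i j.
  by rewrite !ord1 e mxE.
have sub : (M + T <= kermx P^T)%MS by rewrite addsmx_sub !orth.
have rk : \rank (kermx P^T) = 2%N.
  by rewrite mxrank_ker mxrank_tr rank_rV P0.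
have rk2 : (2 <= \rank (M + T)%MS)%N.
  have rT : \rank T = 1%N by rewrite rank_rV T0.
  rewrite -[X in (X <= _)%N]/(1%N.+1) -{1}rT; apply: rank_ltmx.
  rewrite ltmxE addsmxSr /=.
  by apply: contra MT => h; apply: submx_trans h; apply: addsmxSl.
have : (kermx P^T <= M + T)%MS.
  by rewrite -(geq_leqif (mxrank_leqif_sup sub)) rk.
move/(submx_trans (orth _ NP)) => /sub_addsmxP [[u1 u2] /= ->].
exists (u1 0 0), (u2 0 0).
by congr (_ + _); rewrite {1}[X in X *m _]mx11_scalar mul_scalar_mx.
Qed.

(** Replacing X_i by P_i X_j / P_j does not change a polynomial modulo the
    linear forms through P, and it annihilates the forms that vanish at P. *)
Lemma ideal_of_point P M T d G : P != 0 ->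
    ev (linform M) P = 0 -> ev (linform T) P = 0 -> T != 0 ->
    ~~ (M <= T)%MS -> G \is d.+1.-homog -> ev G P = 0 ->
  exists A B, [/\ A \is d.-homog, B \is d.-homog
    & G = A * linform M + B * linform T].
Proof.
move=> P0 MP TP T0 MT hG GP.
have /rV0Pn [j Pj] := P0.
pose r : {mpoly K[3]} := (P 0 j)^-1 *: 'X_j.
pose rho : {rmorphism {mpoly K[3]} -> {mpoly K[3]}} :=
  mmap (@mpolyC 3 K) (fun i => P 0 i *: r).
have rhoX i : rho 'X_i = P 0 i *: r by rewrite /rho /= mmapX mmap1U.
have rhoC c : rho c%:MP = c%:MP by rewrite /rho /= mmapC.
(* The substitution maps G to G(P) times a power of X_j / P_j. *)
have rhoG : rho G = 0.
  transitivity ((ev G P)%:MP * r ^+ d.+1); last by rewrite GP mul0r.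
  rewrite /rho /= /mmap /ev mevalE raddf_sum /= mulr_suml.
  apply: eq_big_seq => m mG; rewrite mpolyCM -mulrA; congr (_ * _).
  have <- : mdeg m = d.+1 by exact: (dhomog_mf hG mG).
  rewrite mdegE -prodrXr rmorph_prod -big_split /=.
  by apply: eq_bigr => i _; rewrite -mul_mpolyC exprMn rmorphXn.
have [|A [B e]] := @eq_rmorph_modulo 3 K (linform M) (linform T) rho rhoC _ G.
  move=> i; rewrite rhoX.
  pose N : 'rV[K]_3 := delta_mx 0 i - (P 0 i / P 0 j) *: delta_mx 0 j.
  have ld k : linform (delta_mx 0 k) = 'X_k :> {mpoly K[3]}.
    rewrite /linform (bigD1 k) //= mxE !eqxx scale1r big1 ?addr0 // => h hk.
    by rewrite mxE (negPf hk) scale0r.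
  have eN : linform N = 'X_i - P 0 i *: r.
    by rewrite /N -scaleNr linformD linformZ !ld scaleNr scalerA.
  have [|a [b e]] := @span_of_orth P M T N P0 MP TP T0 MT.
    by rewrite eN evB evZ evZ /ev !mevalXU mulVf // mulr1 subrr.
  by exists a%:MP, b%:MP; rewrite -eN e linformD !linformZ !mul_mpolyC.
move: e; rewrite rhoG subr0 => e.
have [A' [B' [hA hB e']]] := homog_cofactor2 hG (linform_homog M) (linform_homog T) e.
by rewrite subn1 in hA hB; exists A', B'.
Qed.

End LinearForms.

(** * Restriction of forms to a line *)

Lemma rmorph_mpoly_ext (n : nat) (R S : comNzRingType)
    (f g : {rmorphism {mpoly R[n]} -> S}) :
  (forall c, f c%:MP = g c%:MP) -> (forall i, f 'X_i = g 'X_i) -> f =1 g.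
Proof.
move=> fgC fgX; elim/mpolyind => [|c m p _ _ IHp]; first by rewrite !rmorph0.
rewrite !rmorphD IHp -mul_mpolyC !rmorphM fgC mpolyXE_id !rmorph_prod.
by under eq_bigr do rewrite rmorphXn fgX -rmorphXn.
Qed.

(** The local multipliers show that p / gcd(p, q) has no root. *)
Lemma dvdp_local (K : closedFieldType) (p q : {poly K}) : p != 0 ->
    (forall a, root p a -> exists2 w, w.[a] != 0 & p %| w * q) ->
  p %| q.
Proof.
move=> p0 loc.
have [g0|g0] := eqVneq (gcdp p q) 0.
  by move/eqP: g0; rewrite gcdp_eq0 (negPf p0).
have [w0 [q0 [g [ep eq {}g0 cop]]]] : exists w0 q0 g,
    [/\ p = w0 * g, q = q0 * g, g != 0 & coprimep w0 q0].
  exists (p %/ gcdp p q), (q %/ gcdp p q), (gcdp p q).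
  by rewrite !divpK ?dvdp_gcdl ?dvdp_gcdr // coprimep_div_gcd // p0.
rewrite ep eq in loc p0 *.
have [/closed_rootP [a ra]|] := boolP (size w0 != 1).
  have [|w wa] := loc a; first by rewrite rootM ra.
  rewrite mulrA dvdp_mul2r // Gauss_dvdpl // => w0w.
  have : root w a by rewrite -dvdp_XsubCl (dvdp_trans _ w0w) // dvdp_XsubCl.
  by rewrite /root (negPf wa).
rewrite negbK dvdp_mul2r // size_poly_eq1 => /eqp_dvdl ->.
by rewrite dvd1p.
Qed.

Section LineRestriction.
Variable K : closedFieldType.
Implicit Types (F G X Y : {mpoly K[3]}) (P L M N T E O : 'rV[K]_3).

(** The restriction to the line through E and O, in the affine coordinate t of
    the point E + t O; the point O is at infinity. *)
Definition restr E O : {mpoly K[3]} -> {poly K} :=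
  mmap (@polyC K) (fun i => (E 0 i)%:P + O 0 i *: 'X).
HB.instance Definition _ E O := GRing.RMorphism.copy (restr E O)
  (mmap (@polyC K) (fun i => (E 0 i)%:P + O 0 i *: 'X)).

Lemma restrX E O i : restr E O 'X_i = (E 0 i)%:P + O 0 i *: 'X.
Proof. by rewrite /restr mmapX mmap1U. Qed.

Lemma restrC E O c : restr E O c%:MP = c%:P.
Proof. by rewrite /restr mmapC. Qed.

Lemma restrZ E O c G : restr E O (c *: G) = c *: restr E O G.
Proof. by rewrite -mul_mpolyC rmorphM /= restrC mul_polyC. Qed.

Lemma horner_restr E O G t : (restr E O G).[t] = ev G (E + t *: O).
Proof.
pose h : {rmorphism {mpoly K[3]} -> K} := horner_eval t \o restr E O.
pose g : {rmorphism {mpoly K[3]} -> K} := meval (fun j => (E + t *: O) 0 j).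
apply: (@rmorph_mpoly_ext 3 K K h g) => [c|i].
  by rewrite /h /g /= restrC /horner_eval hornerC mevalC.
rewrite /h /g /= restrX /horner_eval !hornerE mevalXU !mxE.
by rewrite mulrC.
Qed.

Lemma restr_linform E O L :
  restr E O (linform L) = (ev (linform L) E)%:P + ev (linform L) O *: 'X.
Proof.
rewrite !ev_linform {1}/linform.
rewrite [LHS]raddf_sum [(\sum_j _)%:P]raddf_sum scaler_suml -big_split /=.
apply: eq_bigr => j _; rewrite -mul_mpolyC rmorphM /= restrC restrX.
by rewrite mulrDr -!mul_polyC !polyCM !mulrA.
Qed.

Section Homogenize.
Variables mu nu : {mpoly K[3]}.

(** The homogenization of p in degree d, with mu and nu as coordinates of the
    line. *)
Definition hlift d (p : {poly K}) : {mpoly K[3]} :=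
  \sum_(j < d.+1) p`_j *: (mu ^+ (d - j) * nu ^+ j).

Lemma hliftS d a b (p : {poly K}) : (size p <= d.+1)%N ->
  hlift d.+1 ((a%:P + b *: 'X) * p) = (a *: mu + b *: nu) * hlift d p.
Proof.
move=> sp; rewrite mulrDl mulrDl /hlift.
have -> : \sum_(j < d.+2) (a%:P * p + (b *: 'X) * p)`_j
            *: (mu ^+ (d.+1 - j) * nu ^+ j)
        = \sum_(j < d.+2) (a * p`_j) *: (mu ^+ (d.+1 - j) * nu ^+ j)
        + \sum_(j < d.+2) (b * (p * 'X)`_j) *: (mu ^+ (d.+1 - j) * nu ^+ j).
  rewrite -big_split /=; apply: eq_bigr => j _.
  rewrite -scalerDl coefD coefCM; congr ((_ + _) *: _).
  by rewrite -scalerAl coefZ ['X * p]mulrC.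
congr (_ + _).
  rewrite big_ord_recr /= nth_default // mulr0 scale0r addr0 mulr_sumr.
  apply: eq_bigr => j _; rewrite -scalerAl -scalerAr scalerA.
  by rewrite subSn ?exprS ?mulrA // -ltnS.
rewrite big_ord_recl coefMX mulr0 scale0r add0r mulr_sumr.
apply: eq_bigr => j _; rewrite coefMX /= -scalerAl -scalerAr scalerA.
by rewrite subSS exprS; congr (_ *: _); rewrite mulrCA.
Qed.

Lemma hlift0 d : hlift d 0 = 0.
Proof. by apply: big1 => j _; rewrite coef0 scale0r. Qed.

Lemma hlift_homog d p : mu \is 1.-homog -> nu \is 1.-homog ->
  hlift d p \is d.-homog.
Proof.
move=> hm hn; apply: rpred_sum => j _; apply: dhomogZ.
rewrite -[X in X.-homog](@subnK j d) -1?ltnS //.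
apply: dhomogM.
  by rewrite -[X in X.-homog]mul1n; apply: dhomogMn.
by rewrite -[X in X.-homog]mul1n; apply: dhomogMn.
Qed.

Lemma restr_hlift E O d (p : {poly K}) : restr E O mu = 1 -> restr E O nu = 'X ->
  (size p <= d.+1)%N -> restr E O (hlift d p) = p.
Proof.
move=> em en sp; rewrite raddf_sum -[RHS](coefK p) poly_def.
rewrite (big_ord_widen _ (fun i => p`_i *: 'X^i) sp) [RHS]big_mkcond /=.
apply: eq_bigr => j _; rewrite -mul_mpolyC !rmorphM !rmorphXn /= restrC.
rewrite em en expr1n mul1r mul_polyC.
by case: ltnP => // h; rewrite nth_default // scale0r.
Qed.
End Homogenize.

Lemma line_coords E O : E != 0 -> ~~ (O <= E)%MS ->
  exists M N, [/\ ev (linform M) E = 1, ev (linform M) O = 0,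
     ev (linform N) E = 0 & ev (linform N) O = 1].
Proof.
move=> E0 OE.
have : row_free (col_mx E O).
  rewrite -row_leq_rank -addsmxE -[(1 + 1)%N]/2%N.
  have rT : \rank E = 1%N by rewrite rank_rV E0.
  rewrite -[X in (X <= _)%N]/(1%N.+1) -{1}rT; apply: rank_ltmx.
  rewrite ltmxE addsmxSl /=.
  by apply: contra OE => h; apply: submx_trans h; apply: addsmxSr.
case/row_freeP => B; rewrite mul_col_mx => e.
have ee : E *m B = usubmx (1%:M : 'M[K]_(1 + 1)) by rewrite -e col_mxKu.
have eo : O *m B = dsubmx (1%:M : 'M[K]_(1 + 1)) by rewrite -e col_mxKd.
pose C j := (col j B)^T.
have key (V : 'rV[K]_3) j : ev (linform (C j)) V = (V *m B) 0 j.
  by rewrite ev_linform_mx /C -trmx_mul mxE colE mulmxA -colE mxE.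
exists (C (lshift 1 0)), (C (rshift 1 0)).
rewrite !key ee eo !mxE; split=> //.
Qed.

(** The second part computes the projection X_i -> E_i mu + O_i nu onto the
    line, and the first part says that its degree in nu is at most d; both hold
    for monomials by induction on the degree. *)
Lemma restr_top_gen E O (mu nu : 'rV[K]_3) d G :
    ev (linform mu) E = 1 -> ev (linform mu) O = 0 ->
    ev (linform nu) E = 0 -> ev (linform nu) O = 1 ->
    G \is d.-homog ->
  (size (restr E O G) <= d.+1)%N /\
  mmap (@mpolyC 3 K)
    (fun i => E 0 i *: linform mu + O 0 i *: linform nu) G
  = hlift (linform mu) (linform nu) d (restr E O G).
Proof.
move=> mE mO nE nO hG.
pose rho : {rmorphism {mpoly K[3]} -> {mpoly K[3]}} := mmap (@mpolyC 3 K)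
    (fun i => E 0 i *: linform mu + O 0 i *: linform nu).
have mon (m : 'X_{1..3}) : (size (restr E O 'X_[m]) <= (mdeg m).+1)%N /\
   rho 'X_[m] = hlift (linform mu) (linform nu) (mdeg m) (restr E O 'X_[m]).
  move: {2}(mdeg m) (erefl (mdeg m)) => k ek; elim: k m ek => [|k IHk] m.
    move/eqP; rewrite mdeg_eq0 => /eqP ->; rewrite mdeg0 mpolyX0 !rmorph1.
    split; first by rewrite size_poly1.
    by rewrite /hlift big_ord1 subnn !expr0 mulr1 coef1 eqxx scale1r.
  move=> dm; have [i mi] : exists i, m i != 0%N.
    apply/existsP; rewrite -[[exists _, _]]negbK negb_exists; apply/negP.
    move=> /forallP h; have : m = 0%MM.
      by apply/mnmP => i; rewrite mnm0E; apply/eqP; move: (h i); rewrite negbK.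
    by move=> em; rewrite em mdeg0 in dm.
  have em : m = (U_(i) + (m - U_(i)))%MM.
    by rewrite addmC submK // lep1mP.
  set m' := (m - U_(i))%MM in em.
  have dm' : mdeg m' = k.
    by apply/eqP; rewrite -eqSS -dm em mdegD mdeg1 add1n.
  have [s e] := IHk _ dm'.
  rewrite dm em mpolyXD !rmorphM /= restrX; rewrite dm' in s e; split.
    rewrite (leq_trans (size_polyMleq _ _)) //.
    have : (size ((E 0 i)%:P + O 0 i *: 'X)%R <= 2)%N.
      rewrite (leq_trans (size_polyD _ _)) // geq_max.
      rewrite (leq_trans (size_polyC_leq1 _)) //=.
      by rewrite (leq_trans (size_scale_leq _ _)) // size_polyX.
    move: s; move: (size _) (size _) => s1 s2 h2 h1.
    by rewrite -subn1 leq_subLR; apply: leq_trans (leq_add h1 h2) _.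
  rewrite hliftS // -e; congr (_ * _).
  by rewrite /rho /= mmapX mmap1U.
split.
  rewrite [G]mpolyE raddf_sum (leq_trans (size_sum _ _ _)) //.
  apply/bigmax_leqP_seq => m mG _; rewrite /= restrZ.
  rewrite (leq_trans (size_scale_leq _ _)) //.
  by have [s _] := mon m; rewrite (dhomog_mf hG mG) in s.
rewrite -[LHS]/(rho G) [in LHS](mpolyE G) raddf_sum /=.
have -> : hlift (linform mu) (linform nu) d (restr E O G) =
  \sum_(m <- msupp G) G@_m *: hlift (linform mu) (linform nu) d (restr E O 'X_[m]).
  rewrite [in LHS](mpolyE G) raddf_sum /= /hlift.
  under [RHS]eq_bigr do rewrite scaler_sumr.
  rewrite exchange_big /=; apply: eq_bigr => j _.
  rewrite coef_sum scaler_suml; apply: eq_bigr => m _.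
  by rewrite restrZ coefZ scalerA.
apply: eq_big_seq => m mG; have [_ e] := mon m.
rewrite -mul_mpolyC rmorphM /= mmapC mul_mpolyC; congr (_ *: _).
by rewrite -[LHS]/(rho _) e (dhomog_mf hG mG).
Qed.

Section OnLine.
Variables E O L : 'rV[K]_3.
Hypothesis E0 : E != 0.
Hypothesis OE : ~~ (O <= E)%MS.
Hypothesis LE : ev (linform L) E = 0.
Hypothesis LO : ev (linform L) O = 0.
Hypothesis L0 : L != 0.

Lemma restr_dvd0 A : restr E O (A * linform L) = 0.
Proof. by rewrite rmorphM /= restr_linform LE LO scale0r addr0 mulr0. Qed.

Lemma restr_size d G : G \is d.-homog -> (size (restr E O G) <= d.+1)%N.
Proof.
move=> hG; have [M [N [mE mO nE nO]]] := line_coords E0 OE.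
by have [] := @restr_top_gen E O M N d G mE mO nE nO hG.
Qed.

(** The projection onto the line fixes every variable modulo L. *)
Lemma line_modulo d G M N : G \is d.-homog ->
    ev (linform M) E = 1 -> ev (linform M) O = 0 ->
    ev (linform N) E = 0 -> ev (linform N) O = 1 ->
  dvdm (linform L) (G - hlift (linform M) (linform N) d (restr E O G)).
Proof.
move=> hG mE mO nE nO.
have [_ <-] := @restr_top_gen E O M N d G mE mO nE nO hG.
pose rho : {rmorphism {mpoly K[3]} -> {mpoly K[3]}} := mmap (@mpolyC 3 K)
    (fun i => E 0 i *: linform M + O 0 i *: linform N).
have rhoC c : rho c%:MP = c%:MP by rewrite /rho /= mmapC.
have [|A [B e]] := @eq_rmorph_modulo 3 K (linform L) 0 rho rhoC _ G; last first.
  by exists A; rewrite -[mmap _ _ _]/(rho G) e mulr0 addr0.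
move=> i.
pose V : 'rV[K]_3 := delta_mx 0 i - E 0 i *: M - O 0 i *: N.
have ld k : linform (delta_mx 0 k) = 'X_k :> {mpoly K[3]}.
  rewrite /linform (bigD1 k) //= mxE !eqxx scale1r big1 ?addr0 // => h hk.
  by rewrite mxE (negPf hk) scale0r.
have eV : linform V = 'X_i - rho 'X_i.
  rewrite /V -!scaleNr !linformD !linformZ ld /rho /= mmapX mmap1U.
  by rewrite !scaleNr opprD addrA.
have VE : ev (linform V) E = 0.
  by rewrite eV /rho /= mmapX mmap1U !evE mE nE mulr1 mulr0 addr0 /ev mevalXU subrr.
have VO : ev (linform V) O = 0.
  by rewrite eV /rho /= mmapX mmap1U !evE mO nO mulr1 mulr0 add0r /ev mevalXU subrr.
have NL : ~~ (N <= L)%MS.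
  apply/negP => /sub_rVP [c e]; move: nO; rewrite e linformZ evZ LO mulr0.
  by move/esym/eqP; rewrite oner_eq0.
have [a [b eab]] := span_of_orth E0 nE LE L0 NL VE.
have a0 : a = 0.
  by move: VO; rewrite eab linformD !linformZ !evE nO LO mulr1 mulr0 addr0.
by exists b%:MP, 0; rewrite -eV eab a0 scale0r add0r linformZ mulr0 addr0 mul_mpolyC.
Qed.

Lemma restr_eq0 d G : G \is d.-homog -> restr E O G = 0 -> dvdm (linform L) G.
Proof.
move=> hG e; have [M [N [mE mO nE nO]]] := line_coords E0 OE.
by have := line_modulo hG mE mO nE nO; rewrite e hlift0 subr0.
Qed.

Lemma restr_top d G : G \is d.-homog -> (restr E O G)`_d = ev G O.
Proof.
move=> hG; have [M [N [mE mO nE nO]]] := line_coords E0 OE.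
have [A /eqP] := line_modulo hG mE mO nE nO.
rewrite subr_eq => /eqP /(congr1 (fun H => ev H O)) ->.
rewrite !evE LO mulr0 add0r /hlift /ev raddf_sum /= -/(ev _ _) big_ord_recr /=.
rewrite big1 => [|j _].
  by rewrite add0r -!/(ev _ _) !evE subnn nO expr1n expr0 !mulr1.
by rewrite -!/(ev _ _) !evE mO expr0n subn_eq0 leqNgt ltn_ord mul0r mulr0.
Qed.

End OnLine.
End LineRestriction.

(** * Division by lines through a point off the curve *)

Section ExistsOrth.
Variable K : closedFieldType.
Implicit Types (P L M N T E O : 'rV[K]_3).

Lemma ev_linform_sym L P : ev (linform L) P = ev (linform P) L.
Proof. by rewrite !ev_linform; apply: eq_bigr => j _; rewrite mulrC. Qed.

Lemma ev_scale d (G : {mpoly K[3]}) c P : G \is d.-homog ->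
  ev G (c *: P) = c ^+ d * ev G P.
Proof.
move=> hG; rewrite /ev !mevalE mulr_sumr; apply: eq_big_seq => m mG.
have <- : mdeg m = d by exact: (dhomog_mf hG mG).
rewrite mulrCA mdegE -prodrXr -big_split; congr (_ * _).
by apply: eq_bigr => i _; rewrite mxE exprMn.
Qed.

Lemma exists_orth_notin P T : exists M, ev (linform M) P = 0 /\ ~~ (M <= T)%MS.
Proof.
have : ~~ (kermx P^T <= T)%MS.
  apply/negP => /mxrankS; rewrite mxrank_ker mxrank_tr !rank_rV.
  by case: (P != 0); case: (T != 0).
case/row_subPn => i ni; exists (row i (kermx P^T)); split=> //.
by rewrite ev_linform_mx -row_mul mulmx_ker !mxE.
Qed.
End ExistsOrth.

Section Noether.
Variable K : closedFieldType.
Implicit Types (G X Y Z W A B : {mpoly K[3]}) (P L M N T E : 'rV[K]_3).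
Variable F : {mpoly K[3]}.
Hypothesis hF : F \is 4.-homog.

Definition regular Y := forall Z, dvdm F (Y * Z) -> dvdm F Z.

Section Line.
Variables E O L : 'rV[K]_3.
Hypothesis FO : ev F O != 0.
Hypothesis E0 : E != 0.
Hypothesis OE : ~~ (O <= E)%MS.
Hypothesis LE : ev (linform L) E = 0.
Hypothesis LO : ev (linform L) O = 0.
Hypothesis L0 : L != 0.

Lemma size_restrF : size (restr E O F) = 5%N.
Proof.
apply/eqP; rewrite eqn_leq (restr_size E0 OE hF) /=.
rewrite ltnNge; apply/negP => h; move: FO.
by rewrite -(restr_top E0 OE LE LO L0 hF) nth_default ?eqxx.
Qed.

Lemma restrF_neq0 : restr E O F != 0.
Proof. by rewrite -size_poly_eq0 size_restrF. Qed.

(** The quartic F does not vanish on the line, and L generates a prime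
    ideal. *)
Lemma line_cancel Z : dvdm F (Z * linform L) -> dvdm F Z.
Proof.
move=> [C e]; have : dvdm (linform L) (C * F) by rewrite -e; exists Z.
case/linform_prime => // [] [D eD].
  exists D; apply: (@mulIf _ (linform L)); first by rewrite linform_eq0.
  by rewrite e eD; ring.
by move: restrF_neq0; rewrite eD restr_dvd0 // eqxx.
Qed.

(** On the line, the restriction of A is a multiple of that of F, because it is
    so at each of the roots.  The multiple lifts to a form B, and A - B F
    vanishes on the line. *)
Lemma line_step d A : A \is d.-homog ->
    (forall t, root (restr E O F) t ->
       exists2 w, w.[t] != 0 & restr E O F %| w * restr E O A) ->
  exists B A1, [/\ A1 \is d.-1.-homog, A = B * F + A1 * linform L
    & d = 0%N -> A = 0].
Proof.
move=> hA loc; have := dvdp_local restrF_neq0 loc.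
case/dvdpP => q eq.
have [M [N [mE mO nE nO]]] := line_coords E0 OE.
have qs : q != 0 -> (size q + 4 <= d.+1)%N.
  move=> q0; have := restr_size E0 OE hA.
  by rewrite eq size_mul ?restrF_neq0 // size_restrF addnS.
pose B := if q == 0 then 0 else hlift (linform M) (linform N) (d - 4) q.
have [hB eB] : B * F \is d.-homog /\ restr E O B = q.
  rewrite /B; case: eqVneq => [->|q0]; [|have s := qs q0]; first by rewrite mul0r dhomog0 rmorph0.
  have d4 : (4 <= d)%N.
    by rewrite -ltnS; apply: leq_trans s; rewrite -[4%N]add0n ltn_add2r lt0n size_poly_eq0.
  split; first by rewrite -{2}(subnK d4); apply: dhomogM => //; apply: hlift_homog; exact: linform_homog.
  apply: restr_hlift; rewrite ?restr_linform ?mE ?mO ?nE ?nO ?scale0r ?addr0 ?scale1r ?add0r //.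
  by rewrite -subSn // leq_subRL 1?addnC // leqW.
have hAB : A - B * F \is d.-homog by apply: rpredB.
have [A0 eA0] : dvdm (linform L) (A - B * F).
  by apply: (restr_eq0 E0 OE LE LO L0 hAB); rewrite rmorphB rmorphM /= eB eq subrr.
have [A1 hA1 eA1] := homog_cofactor hAB (linform_homog L) eA0.
exists B, A1; split; first by rewrite -subn1.
  by rewrite -eA1 addrC subrK.
move=> d0; have q0 : q = 0.
  by apply/eqP; apply: contraT => /qs; rewrite d0 addn4.
move: eA0; rewrite /B q0 eqxx mul0r subr0 => eA0.
move: hA; rewrite d0 => hA.
by rewrite -[A](pihomog_dE hA) eA0 (pihomog_mulr _ _ (linform_homog L)).
Qed.
End Line.

Variable O : 'rV[K]_3.
Hypothesis FO : ev F O != 0.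

Lemma O_neq0 : O != 0.
Proof.
apply: contraNneq FO => O0.
by rewrite O0 -(scale0r 0) (ev_scale _ _ hF) expr0n mul0r.
Qed.

Lemma line_through L : L != 0 -> ev (linform L) O = 0 ->
  exists E, [/\ E != 0, ~~ (O <= E)%MS & ev (linform L) E = 0].
Proof.
move=> L0 LO; have [E [hE EO]] := exists_orth_notin L O.
have E0 : E != 0 by apply: contraNneq EO => ->; rewrite sub0mx.
exists E; split=> //; last by rewrite ev_linform_sym.
apply: contra EO => /sub_rVP [c e]; have c0 : c != 0.
  by apply: contraNneq O_neq0 => c0; rewrite e c0 scale0r.
by apply/sub_rVP; exists c^-1; rewrite e scalerA mulVf // scale1r.
Qed.

Lemma line_point E t : E != 0 -> ~~ (O <= E)%MS -> E + t *: O != 0.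
Proof.
move=> E0; apply: contraNneq => /eqP; rewrite addr_eq0 => /eqP e.
have t0 : t != 0 by apply: contraNneq E0 => t0; rewrite e t0 scale0r oppr0.
apply/sub_rVP; exists (- t^-1); rewrite e scaleNr scalerN opprK scalerA.
by rewrite mulVf // scale1r.
Qed.

Lemma exists_line : exists L, L != 0 /\ ev (linform L) O = 0.
Proof.
have [L [LO L0]] := exists_orth_notin O 0; exists L; split=> //.
by apply: contraNneq L0 => ->; apply: sub0mx.
Qed.

(** A line through a point off the curve can be divided out again and again,
    until the degree is 0. *)
Lemma dvdm_local_homog d Z : Z \is d.-homog ->
    (forall P, on_curve F P -> exists2 W, ev W P != 0 & dvdm F (W * Z)) ->
  dvdm F Z.
Proof.
have [L [L0 LO]] := exists_line.
have [E [E0 OE LE]] := line_through L0 LO.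
have loc0 d' Z' : Z' \is d'.-homog ->
    (forall P, on_curve F P -> exists2 W, ev W P != 0 & dvdm F (W * Z')) ->
    exists B A1, [/\ A1 \is d'.-1.-homog, Z' = B * F + A1 * linform L
      & d' = 0%N -> Z' = 0].
  move=> hZ loc; apply: (line_step FO E0 OE LE LO L0 hZ) => t rt.
  have [|W WP [C e]] := loc (E + t *: O).
    by split; [exact: line_point | rewrite -horner_restr; apply/eqP].
  exists (restr E O W); first by rewrite horner_restr.
  by rewrite -rmorphM e rmorphM dvdp_mulIr.
elim: d Z => [|d IHd] Z hZ loc; have [B [A1 [hA1 e z]]] := loc0 _ _ hZ loc.
  by rewrite z //; apply: dvdm0.
rewrite e; apply: dvdmD; first by exists B.
apply: dvdm_mulr; apply: IHd => // P PF; have [W WP [C eW]] := loc P PF.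
exists W => //; apply: (line_cancel FO E0 OE LE LO L0).
by exists (C - W * B); rewrite -mulrA mulrBl -eW e; ring.
Qed.

(** A polynomial that annihilates Y modulo F is treated one homogeneous part
    after the other. *)
Lemma regular_of_local d Y : Y \is d.-homog ->
    (forall P, on_curve F P -> forall Z, dvdm F (Y * Z) ->
       exists2 W, ev W P != 0 & dvdm F (W * Z)) ->
  regular Y.
Proof.
move=> hY loc Z [C eC].
rewrite [Z](pihomog_partitionE (mf := mdeg) (leqnn _)).
apply: (big_ind (dvdm F)); [exact: dvdm0 | exact: dvdmD |] => i _.
apply: (dvdm_local_homog (pihomogP mdeg i Z)) => P PF; apply: loc => //.
have h1 := pihomog_mulr (i + d) Z hY.
have h2 := pihomog_mulr (i + d) C hF.
rewrite leq_addl addnK in h1.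
rewrite mulrC -h1 [Z * Y]mulrC eC h2; case: ifP => _; last exact: dvdm0.
by eexists.
Qed.

Section Forms.
Variables (dX dY : nat) (X Y : {mpoly K[3]}).
Hypothesis hX : X \is dX.-homog.
Hypothesis hY : Y \is dY.-homog.
Hypothesis Yreg : regular Y.
Hypothesis loc : forall P, on_curve F P ->
  exists2 W, ev W P != 0 & exists A B, W * X = A * Y + B * F.

(** When a line is removed, the relation L b X = A' Y + B' F says on the line
    that A' Y is divisible by F.  The local hypothesis and the regularity of Y
    imply that A' itself is so locally, and [line_step] makes A' divisible by L
    modulo F. *)
Lemma strip_lines (ls : seq 'rV[K]_3) :
    all (fun L => (L != 0) && (ev (linform L) O == 0)) ls ->
    (exists A B, (\prod_(L <- ls) linform L) * X = A * Y + B * F) ->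
  exists A B, X = A * Y + B * F.
Proof.
elim: ls => [|L ls IHls] /=; first by rewrite big_nil mul1r.
case/andP => /andP [L0 /eqP LO] /IHls {}IHls [A [B]].
rewrite big_cons; set b1 := \prod_(_ <- ls) _ => e; apply: IHls; rewrite -/b1.
have [E [E0 OE LE]] := line_through L0 LO.
have [e' hb1] : exists e', b1 \is e'.-homog.
  exists (size ls); rewrite /b1; elim: (ls) => [|M l IHl] /=.
    by rewrite big_nil dhomog1.
    by rewrite big_cons; apply: (dhomogM (linform_homog M) IHl).
have hbX : linform L * b1 * X \is (1 + e' + dX).-homog.
  by apply: dhomogM => //; apply: dhomogM => //; apply: linform_homog.
have [A' [B' [hA' _ {}e]]] := homog_cofactor2 hbX hY hF e.
have [] := @line_step E O L FO E0 OE LE LO L0 _ A' hA'.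
  move=> t rt; have [|W WP [V [V' eW]]] := loc (P := E + t *: O).
    by split; [exact: line_point | rewrite -horner_restr; apply/eqP].
  have : dvdm F (Y * (linform L * b1 * V - W * A')).
    exists (W * B' - linform L * b1 * V').
    have : linform L * b1 * (W * X) = W * (linform L * b1 * X) by ring.
    rewrite eW e => h.
    by rewrite mulrBr mulrBl -[RHS]addr0 -(subrr (linform L * b1 * (V * Y + V' * F))) {2}h; ring.
  case/Yreg => C /(congr1 (restr E O)).
  rewrite rmorphB !rmorphM /= restr_linform LE LO scale0r addr0 !mul0r sub0r => eC.
  exists (restr E O W); first by rewrite horner_restr.
  by rewrite -[_ * _]opprK eC dvdpNr dvdp_mulIr.
move=> B1 [A1 [_ eA1 _]].
have : dvdm F ((b1 * X - A1 * Y) * linform L).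
  exists (B1 * Y + B').
  have -> : (b1 * X - A1 * Y) * linform L
    = linform L * b1 * X - A1 * linform L * Y by ring.
  by rewrite e eA1; ring.
case/(line_cancel FO E0 OE LE LO L0) => B2 eB2.
by exists A1, B2; rewrite -eB2; ring.
Qed.
End Forms.
End Noether.

(** * Elimination and Max Noether's theorem *)

Section Elimination.
Variable K : closedFieldType.
Implicit Types (G X Y Z W A B : {mpoly K[3]}) (P L M N T E : 'rV[K]_3).

Lemma exists_line_through2 P T :
  exists L, [/\ L != 0, ev (linform L) P = 0 & ev (linform L) T = 0].
Proof.
have : kermx (row_mx P^T T^T) != 0.
  rewrite -mxrank_eq0 mxrank_ker -lt0n subn_gt0.
  by apply: leq_ltn_trans (rank_leq_col _) _.
case/rowV0Pn => L /sub_kermxP; rewrite mul_mx_row.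
rewrite -[0]hsubmxK => /eq_row_mx [e1 e2] L0; exists L; split=> //.
  by rewrite ev_linform_mx e1 !mxE.
by rewrite ev_linform_mx e2 !mxE.
Qed.

Let O : 'rV[K]_3 := delta_mx 0 ord_max.

Lemma ev_linformO L : ev (linform L) O = L 0 ord_max.
Proof.
rewrite ev_linform (bigD1 ord_max) //= mxE !eqxx mulr1 big1 ?addr0 // => j nj.
by rewrite mxE (negPf nj) mulr0.
Qed.

(** It fixes exactly the polynomials in the first two variables; the forms
    among them are products of lines through O = (0 : 0 : 1). *)
Definition last_to0 : {mpoly K[3]} -> {mpoly K[3]} :=
  mmap (@mpolyC 3 K) (fun i => if i == ord_max then 0 else 'X_i).
HB.instance Definition _ := GRing.RMorphism.copy last_to0
  (mmap (@mpolyC 3 K) (fun i => if i == ord_max then 0 else 'X_i)).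

Lemma last_to0X i : last_to0 'X_i = if i == ord_max then 0 else 'X_i.
Proof. by rewrite /last_to0 mmapX mmap1U. Qed.
Lemma last_to0C c : last_to0 c%:MP = c%:MP.
Proof. by rewrite /last_to0 mmapC. Qed.

Lemma last_to0_mwiden (b : {mpoly K[2]}) : last_to0 (mwiden b) = mwiden b.
Proof.
pose f : {rmorphism {mpoly K[2]} -> {mpoly K[3]}} := last_to0 \o @mwiden 2 K.
pose g : {rmorphism {mpoly K[2]} -> {mpoly K[3]}} := @mwiden 2 K.
apply: (@rmorph_mpoly_ext 2 K _ f g) => [c|i].
  by rewrite /f /g /= mwidenC last_to0C.
by rewrite /f /g /= mwidenX mnmwiden1 last_to0X -val_eqE /= (ltn_eqF (ltn_ord i)).
Qed.

Lemma last_to0_linform L : L 0 ord_max = 0 -> last_to0 (linform L) = linform L.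
Proof.
move=> Lo; rewrite /linform raddf_sum; apply: eq_bigr => j _ /=.
rewrite -mul_mpolyC rmorphM /= last_to0C last_to0X.
by case: eqP => // ->; rewrite Lo mpolyC0 !mul0r.
Qed.

(** A zero of a binary form in the line at infinity gives a linear factor. *)
Lemma factor_binary d G : G \is d.-homog -> G != 0 -> last_to0 G = G ->
  exists c (ls : seq 'rV[K]_3), [/\ c != 0,
    all (fun L => (L != 0) && (ev (linform L) O == 0)) ls &
    G = c%:MP * \prod_(L <- ls) linform L].
Proof.
elim: d G => [|d IHd] G hG G0 kG.
  have [c e] := homog0_const hG; exists c, [::]; rewrite big_nil mulr1; split=> //.
  by apply: contraNneq G0 => c0; rewrite e c0 mpolyC0.
have notin (V : 'rV[K]_3) : V 0 ord_max = 0 -> ~~ (O <= V)%MS.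
  move=> V0; apply/negP => /sub_rVP [c /rowP /(_ ord_max)].
  by rewrite !mxE !eqxx V0 mulr0 => /eqP; rewrite oner_eq0.
have [E [E0 Em GE]] : exists E, [/\ E != 0, E 0 ord_max = 0 & ev G E = 0].
  pose E1 : 'rV[K]_3 := delta_mx 0 ord0.
  pose E2 : 'rV[K]_3 := delta_mx 0 (inord 1).
  have nz (V : 'rV[K]_3) j : V 0 j != 0 -> V != 0.
    by apply: contraNneq => ->; rewrite mxE.
  have E10 : E1 != 0 by apply: (nz _ ord0); rewrite mxE !eqxx oner_neq0.
  have [/closed_rootP [t rt]|] := boolP (size (restr E1 E2 G) != 1).
    exists (E1 + t *: E2); split.
    - apply: (nz _ ord0); rewrite !mxE !eqxx -!val_eqE /= inordK //.
      by rewrite mulr0 addr0 oner_neq0.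
    - by rewrite !mxE -!val_eqE /= !inordK //= mulr0 addr0.
    - by rewrite -horner_restr; apply/eqP.
  rewrite negbK => /eqP s1; exists E2; split.
  - by apply: (nz _ (inord 1)); rewrite mxE !eqxx oner_neq0.
  - by rewrite !mxE -!val_eqE /= inordK.
  have E21 : ~~ (E2 <= E1)%MS.
    apply/negP => /sub_rVP [c /rowP /(_ (inord 1))].
    rewrite !mxE !eqxx -!val_eqE /= inordK // mulr0 => /eqP.
    by rewrite oner_eq0.
  have [L [L0 L1 L2]] := exists_line_through2 E1 E2.
  by rewrite -(restr_top E10 E21 L1 L2 L0 hG) nth_default // s1.
have OE := notin _ Em.
have [L [L0 LE LO]] := exists_line_through2 E O.
have Lm : L 0 ord_max = 0 by rewrite -ev_linformO.
have rG : restr E O G = 0.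
  pose f : {rmorphism {mpoly K[3]} -> {poly K}} := restr E O \o last_to0.
  pose g : {rmorphism {mpoly K[3]} -> {poly K}} :=
    @polyC K \o meval (fun j => E 0 j).
  have fg : f =1 g.
    apply: (@rmorph_mpoly_ext 3 K _ f g) => [c|i].
      by rewrite /f /g /= last_to0C restrC mevalC.
    rewrite /f /g /= last_to0X mevalXU; case: eqP => [->|/eqP ni].
      by rewrite rmorph0 Em.
    by rewrite restrX !mxE (negPf ni) scale0r addr0.
  by rewrite -kG -[LHS]/(f G) fg /g /= -[meval _ _]/(ev G E) GE.
have [A0 eA0] := restr_eq0 E0 OE LE LO L0 hG rG.
have [A1 hA1 eA1] := homog_cofactor hG (linform_homog L) eA0.
have kA1 : last_to0 A1 = A1.
  apply: (@mulIf _ (linform L)); first by rewrite linform_eq0.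
  by rewrite -eA1 -[RHS]kG eA1 rmorphM /= (last_to0_linform Lm).
have [||c [ls [c0 al e]]] := IHd A1 _ _ kA1; first by rewrite subn1 in hA1.
  by apply: contraNneq G0 => A10; rewrite eA1 A10 mul0r.
exists c, (L :: ls); split=> //=; first by rewrite L0 LO eqxx al.
by rewrite big_cons eA1 e; ring.
Qed.

Let cst : {rmorphism K -> {poly {mpoly K[2]}}} :=
  @polyC {mpoly K[2]} \o @mpolyC 2 K.
Let var (i : 'I_3) : {poly {mpoly K[2]}} :=
  if unlift ord_max i is Some j then ('X_j)%:P else 'X.
(** The identification of K[X, Y, Z] with K[X, Y][Z], which gives access to
    resultants with respect to Z. *)
Definition mlast_poly : {mpoly K[3]} -> {poly {mpoly K[2]}} := mmap cst var.
HB.instance Definition _ := GRing.RMorphism.copy mlast_poly (mmap cst var).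

Lemma mlast_polyU i : mlast_poly 'X_i = var i.
Proof. by rewrite /mlast_poly mmapX mmap1U. Qed.
Lemma mlast_polyC c : mlast_poly c%:MP = (c%:MP)%:P.
Proof. by rewrite /mlast_poly mmapC. Qed.

Definition mpoly_last : {poly {mpoly K[2]}} -> {mpoly K[3]} := fun p =>
  horner_eval ('X_ord_max : {mpoly K[3]})
    (map_poly (@mwiden 2 K : {mpoly K[2]} -> {mpoly K[3]}) p).
HB.instance Definition _ := GRing.RMorphism.copy mpoly_last
  (horner_eval ('X_ord_max : {mpoly K[3]})
    \o map_poly (@mwiden 2 K : {mpoly K[2]} -> {mpoly K[3]})).

Lemma mpoly_lastC b : mpoly_last b%:P = mwiden b.
Proof. by rewrite /mpoly_last /= map_polyC /horner_eval hornerC. Qed.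
Lemma mpoly_lastX : mpoly_last 'X = 'X_ord_max.
Proof. by rewrite /mpoly_last /= map_polyX /horner_eval hornerX. Qed.

Lemma mpoly_last_comb p q r s :
  mpoly_last (p * q + r * s)
  = mpoly_last p * mpoly_last q + mpoly_last r * mpoly_last s.
Proof. by rewrite rmorphD !rmorphM. Qed.

Lemma mwidenU (j : 'I_2) : mwiden ('X_j : {mpoly K[2]}) = 'X_(lift ord_max j).
Proof.
rewrite mwidenX mnmwiden1.
suff -> : widen_ord (leqnSn 2) j = lift ord_max j by [].
by apply/val_inj; rewrite /= /bump leqNgt ltn_ord.
Qed.

Lemma mlast_polyK : cancel mlast_poly mpoly_last.
Proof.
pose f : {rmorphism {mpoly K[3]} -> {mpoly K[3]}} := mpoly_last \o mlast_poly.
apply: (@rmorph_mpoly_ext 3 K _ f idfun) => [c|i].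
  by rewrite /f /= mlast_polyC mpoly_lastC mwidenC.
rewrite /f /= mlast_polyU /var; case: unliftP => [j ->|->].
  by rewrite mpoly_lastC mwidenU.
by rewrite mpoly_lastX.
Qed.

Lemma mlast_poly_mwiden b : mlast_poly (mwiden b) = b%:P.
Proof.
pose f : {rmorphism {mpoly K[2]} -> {poly {mpoly K[2]}}} :=
  mlast_poly \o @mwiden 2 K.
pose g : {rmorphism {mpoly K[2]} -> {poly {mpoly K[2]}}} := @polyC _.
apply: (@rmorph_mpoly_ext 2 K _ f g) => [c|i].
  by rewrite /f /g /= mwidenC mlast_polyC.
by rewrite /f /g /= mwidenU mlast_polyU /var liftK.
Qed.

Lemma mpoly_lastK : cancel mpoly_last mlast_poly.
Proof.
elim/poly_ind => [|p c IHp]; first by rewrite !rmorph0.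
rewrite !rmorphD !rmorphM /= IHp mpoly_lastC mlast_poly_mwiden mpoly_lastX.
by rewrite mlast_polyU /var unlift_none.
Qed.

Local Opaque mpoly_last mlast_poly.

Section Noether2.
Variable F : {mpoly K[3]}.
Hypothesis hF : F \is 4.-homog.
Hypothesis FO : ev F O != 0.

(** The resultant of Y and F with respect to the last variable.  It does not
    vanish: a common factor of positive degree would make the complementary
    factor of F annihilate Y modulo F, although its degree is too small to be
    divisible by F. *)
Lemma elim_last d Y : Y \is d.-homog -> regular F Y ->
  exists2 b : {mpoly K[2]}, b != 0 & exists A B, mwiden b = A * Y + B * F.
Proof.
move=> hY Yreg.
have [pF eF] : exists pF, mpoly_last pF = F.
  by exists (mlast_poly F); apply: mlast_polyK.
have [pY eY] : exists pY, mpoly_last pY = Y.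
  by exists (mlast_poly Y); apply: mlast_polyK.
have F0 : F != 0 by apply: contraNneq FO => ->; rewrite ev0.
have sF : (1 < size pF)%N.
  rewrite ltnNge; apply/negP => /size1_polyC e.
  have eF2 : F = mwiden (pF`_0) by rewrite -eF {1}e mpoly_lastC.
  have : ev (last_to0 F) O = ev F 0.
    pose f : {rmorphism {mpoly K[3]} -> K} := meval (fun j => O 0 j) \o last_to0.
    pose g : {rmorphism {mpoly K[3]} -> K} := meval (fun j => (0 : 'rV[K]_3) 0 j).
    apply: (@rmorph_mpoly_ext 3 K _ f g) => [c|i].
      by rewrite /f /g /= last_to0C !mevalC.
    rewrite /f /g /= last_to0X !mevalXU; case: eqP => [->|/eqP ni].
      by rewrite meval0 mxE.
    by rewrite mevalXU !mxE (negPf ni).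
  rewrite {1}eF2 last_to0_mwiden -eF2 -(scale0r 0) (ev_scale _ _ hF) expr0n mul0r.
  by move/eqP; rewrite (negPf FO).
have Y0 : Y != 0.
  apply: contraNneq FO => Y0.
  have [|C e1] := Yreg 1; first by rewrite Y0 mul0r; apply: dvdm0.
  move/(congr1 (fun G => ev G 0)): e1; rewrite evM ev1 -{2}(scale0r 0).
  rewrite (ev_scale _ _ hF) expr0n mul0r mulr0 => /eqP.
  by rewrite oner_eq0.
have [sY|sY] := leqP (size pY) 1.
  exists pY`_0.
    apply: contraNneq Y0 => e0.
    by rewrite -eY (size1_polyC sY) e0 rmorph0.
  by exists 1, 0; rewrite -mpoly_lastC -(size1_polyC sY) eY mul1r mul0r addr0.
have [[p q] [_ _ /= e]] := resultant_in_ideal sF sY.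
have e' : mwiden (resultant pF pY) = mpoly_last q * Y + mpoly_last p * F.
  rewrite -mpoly_lastC; move: (resultant _ _) e => r -> {r}.
  by rewrite mpoly_last_comb eF eY addrC.
exists (resultant pF pY); last by exists (mpoly_last q), (mpoly_last p).
(* With c1 F = h g and c2 Y = h' g, the product of Y and c2 h is divisible by
   F. *)
rewrite resultant_eq0 -leqNgt leqNgt; apply/negP => sg.
set g := gcdp pF pY in sg.
have pF0 : pF != 0 by rewrite -size_poly_gt0 ltnW.
have /Pdiv.Idomain.dvdpP [[c1 h] /= c10 eh] := dvdp_gcdl pF pY.
have /Pdiv.Idomain.dvdpP [[c2 h'] /= c20 eh'] := dvdp_gcdr pF pY.
rewrite -/g in eh eh'.
have h0 : h != 0.
  apply: contraNneq pF0 => h0; move/eqP: eh.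
  by rewrite h0 mul0r scale_poly_eq0 (negPf c10).
have g0 : g != 0 by rewrite -size_poly_gt0 ltnW.
have [|C eC] := Yreg (mpoly_last (c2 *: h)).
  exists (mpoly_last (c1 *: h')); rewrite -{1}eY -[F in RHS]eF -!rmorphM.
  by rewrite -scalerAr scalerAl eh' -mulrA [g * h]mulrC -eh -scalerAl scalerAr.
have e1 : c2 *: h = mlast_poly C * pF.
  by rewrite -[LHS]mpoly_lastK eC rmorphM /= -eF mpoly_lastK.
have ch0 : c2 *: h != 0 by rewrite scale_poly_eq0 negb_or c20.
have C0 : mlast_poly C != 0.
  by apply: contraNneq ch0 => C0; rewrite e1 C0 mul0r.
have : (size h < size pF)%N.
  rewrite -(size_scale pF c10) eh size_mul // -subn1 ltn_subRL addnC.
  by rewrite addn1 -addn2 leq_add2l.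
have : (size pF <= size h)%N.
  rewrite -(size_scale h c20) e1 size_mul // -subn1 leq_subRL ?leq_add2r.
    by rewrite size_poly_gt0.
  by rewrite addn_gt0 size_poly_gt0 C0.
by move=> le1 lt1; move: (leq_ltn_trans le1 lt1); rewrite ltnn.
Qed.

Lemma homog_elim d Y : Y \is d.-homog -> regular F Y ->
  exists e (b : {mpoly K[3]}), [/\ b != 0, last_to0 b = b, b \is e.-homog
    & exists A B, b = A * Y + B * F].
Proof.
move=> hY Yreg; have [b b0 [A [B e]]] := elim_last hY Yreg.
have hom i : mwiden (pihomog mdeg i b) \is i.-homog.
  rewrite /pihomog raddf_sum; apply: rpred_sum => m /eqP <-.
  rewrite /= mwidenZ mwidenX; apply: dhomogZ; rewrite dhomogX /=.
  rewrite !mdegE big_ord_recr /= mnmwiden_ordmax addn0; apply/eqP.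
  by apply: eq_bigr => j _; rewrite mnmwiden_widen.
have comm i : pihomog mdeg i (mwiden b) = mwiden (pihomog mdeg i b).
  have -> : mwiden b
      = \sum_(j < mmeasure mdeg b) mwiden (pihomog mdeg j b).
    rewrite {1}[b](pihomog_partitionE (mf := mdeg) (leqnn _)).
    exact: (raddf_sum (@mwiden 2 K)).
  rewrite linear_sum /=.
  set n := mmeasure _ b; have [lt|ge] := ltnP i n.
    rewrite (bigD1 (Ordinal lt)) //= (pihomog_dE (hom _)) big1 ?addr0 // => j ne.
    by apply: pihomog_ne0 (hom j); rewrite -val_eqE /= in ne.
  rewrite big1 => [|j _].
    rewrite pihomogE big1_seq ?raddf0 // => m /andP [/eqP mi mb].
    by have := mmeasure_mnm_lt mdeg mb; rewrite -/n mi ltnNge ge.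
  apply: pihomog_ne0 (hom j); apply: contraTneq (ltn_ord j) => ->.
  by rewrite -leqNgt.
have [i bi] : exists i, pihomog mdeg i b != 0.
  have : b != 0 by [].
  rewrite {1}[b](pihomog_partitionE (mf := mdeg) (leqnn _)).
  set n := mmeasure _ b => sn.
  have [/forallP all0|] := boolP [forall i : 'I_n, pihomog mdeg i b == 0].
    by move: sn; rewrite big1 ?eqxx // => i _; apply/eqP.
  by rewrite negb_forall => /existsP [j hj]; exists j.
exists i, (mwiden (pihomog mdeg i b)); split=> //.
- apply: contraNneq bi => e0; apply/eqP/(@inj_mwiden 2 K).
  by rewrite e0 mwiden0.
- exact: last_to0_mwiden.
rewrite -comm e pihomogD (pihomog_mulr _ _ hY) (pihomog_mulr _ _ hF).
exists (if (d <= i)%N then pihomog mdeg (i - d) A else 0).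
exists (if (4 <= i)%N then pihomog mdeg (i - 4) B else 0).
by do 2!case: ifP => _; rewrite ?mul0r.
Qed.

(** Max Noether's theorem, that membership in (Y, F) is local on the curve.  By
    elimination a form in two variables multiplies X into the ideal; its linear
    factors are removed one by one. *)
Theorem noether dX dY X Y : X \is dX.-homog -> Y \is dY.-homog ->
    regular F Y ->
    (forall P, on_curve F P ->
      exists2 W, ev W P != 0 & exists A B, W * X = A * Y + B * F) ->
  exists2 A, A \is (dX - dY).-homog & exists B, X = A * Y + B * F.
Proof.
move=> hX hY Yreg loc.
have [e [b [b0 kb hb [A [B eb]]]]] := homog_elim hY Yreg.
have [c [ls [c0 als els]]] := factor_binary hb b0 kb.
have [|A1 [B1 e1]] := strip_lines hF FO hX hY Yreg loc als.
  exists (c^-1%:MP * A * X), (c^-1%:MP * B * X).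
  have -> : \prod_(L <- ls) linform L = c^-1%:MP * b.
    by rewrite els mulrA -mpolyCM mulVf // mpolyC1 mul1r.
  by rewrite eb; ring.
have [A' [B' [hA' _ e']]] := homog_cofactor2 hX hY hF e1.
by exists A' => //; exists B'.
Qed.
End Noether2.
End Elimination.

(** * Gradients and local orders *)

Section Derivatives.
Variable K : closedFieldType.
Implicit Types (F G X Y Z W A B : {mpoly K[3]}) (P L M N T E : 'rV[K]_3).

Lemma mderiv_linform L i : (linform L)^`M(i) = (L 0 i)%:MP.
Proof.
rewrite /linform raddf_sum (bigD1 i) //= mderivZ mderivX mnm1E eqxx scale1r.
have -> : (U_(i) - U_(i) = 0 :> 'X_{1..3})%MM.
  by apply/mnmP => j; rewrite mnmBE mnm0E subnn.
rewrite mpolyX0 -mul_mpolyC mulr1 big1 ?addr0 // => j ji.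
by rewrite mderivZ mderivX mnm1E (negPf ji) scale0r scaler0.
Qed.

Lemma euler d G : G \is d.-homog -> \sum_i 'X_i * G^`M(i) = G *+ d.
Proof.
move=> hG; rewrite [in RHS](mpolyE G) -sumrMnl.
under eq_bigr do rewrite [in G^`M(_)](mpolyE G) raddf_sum mulr_sumr /=.
rewrite exchange_big /=; apply: eq_big_seq => m mG.
have <- : mdeg m = d by exact: (dhomog_mf hG mG).
rewrite mdegE -sumrMnr; apply: eq_bigr => i _.
rewrite mderivZ mderivX -scalerAr -scalerAr scalerMnr; congr (_ *: _).
have [->|mi] := eqVneq (m i) 0%N; first by rewrite scale0r mulr0n.
by rewrite -mpolyXD addmC submK ?lep1mP // scaler_nat.
Qed.

(** Euler's relation. *)
Lemma ev_grad_self d F P : F \is d.-homog -> ev F P = 0 ->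
  ev (linform (grad F P)) P = 0.
Proof.
move=> hF FP; have := congr1 (fun G => ev G P) (euler hF).
rewrite /ev raddfMn /= -/(ev F P) FP mul0rn raddf_sum /= => e.
rewrite -/(ev _ _) ev_linform -[RHS]e; apply: eq_bigr => i _.
by rewrite mxE mevalM mevalXU mulrC.
Qed.

Lemma gradD F G P : grad (F + G) P = grad F P + grad G P.
Proof. by apply/rowP => i; rewrite !mxE mderivD evD. Qed.

Lemma gradB F G P : grad (F - G) P = grad F P - grad G P.
Proof. by apply/rowP => i; rewrite !mxE mderivB evB. Qed.

Lemma gradM F G P : grad (F * G) P = ev G P *: grad F P + ev F P *: grad G P.
Proof.
by apply/rowP => i; rewrite !mxE mderivM evD !evM [ev G P * _]mulrC.
Qed.

Lemma grad_sqr F P : grad (F ^+ 2) P = (ev F P *: grad F P) *+ 2.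
Proof. by rewrite expr2 gradM mulr2n. Qed.

Lemma gradZ c F P : grad (c *: F) P = c *: grad F P.
Proof. by apply/rowP => i; rewrite !mxE mderivZ evZ. Qed.

Lemma grad_linform L P : grad (linform L) P = L.
Proof. by apply/rowP => i; rewrite !mxE mderiv_linform evC. Qed.

End Derivatives.

Section LocalOrder.
Variable K : closedFieldType.
Implicit Types (G H X Y Z W A B U V : {mpoly K[3]}) (P L M N T E : 'rV[K]_3).
Variable F : {mpoly K[3]}.
Hypothesis hF : F \is 4.-homog.
Hypothesis smF : smooth_curve F.

(** The lines through P other than the tangent line are the uniformizers at P
    used in [ord_at]. *)
Definition unif P M := ev (linform M) P = 0 /\ ~~ (M <= grad F P)%MS.

(** Equality up to a unit of the local ring of the curve at P. *)
Definition assoc_at P G H := exists U V A,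
  [/\ ev U P != 0, ev V P != 0 & U * G = V * H + A * F].

(** The order [ord_at] without the condition that the multipliers be forms;
    this makes it compatible with products. *)
Definition ordP P G n := exists2 M, unif P M & assoc_at P G (linform M ^+ n).

Lemma assoc_at_refl P G : assoc_at P G G.
Proof. by exists 1, 1, 0; rewrite ev1 oner_neq0 mul0r addr0. Qed.

Lemma assoc_at_sym P G H : assoc_at P G H -> assoc_at P H G.
Proof.
by move=> [U [V [A [UP VP e]]]]; exists V, U, (- A); split=> //; rewrite e; ring.
Qed.

Lemma assoc_at_trans P G H X : assoc_at P G H -> assoc_at P H X -> assoc_at P G X.
Proof.
move=> [U [V [A [UP VP e]]]] [U' [V' [A' [UP' VP' e']]]].
exists (U' * U), (V * V'), (U' * A + V * A').
rewrite !evM !mulf_neq0 //; split=> //.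
have -> : U' * U * G = U' * (U * G) by ring.
by rewrite e mulrDr mulrCA e'; ring.
Qed.

Lemma assoc_at_mul P G H G' H' : assoc_at P G H -> assoc_at P G' H' ->
  assoc_at P (G * G') (H * H').
Proof.
move=> [U [V [A [UP VP e]]]] [U' [V' [A' [UP' VP' e']]]].
exists (U * U'), (V * V'), (V * H * A' + A * (V' * H') + A * A' * F).
rewrite !evM !mulf_neq0 //; split=> //.
have -> : U * U' * (G * G') = (U * G) * (U' * G') by ring.
by rewrite e e'; ring.
Qed.

Lemma assoc_at_exp P G H n : assoc_at P G H -> assoc_at P (G ^+ n) (H ^+ n).
Proof.
move=> l; elim: n => [|n IHn]; first by rewrite !expr0; apply: assoc_at_refl.
by rewrite !exprS; apply: assoc_at_mul.
Qed.

Lemma assoc_at_unit P G : ev G P != 0 -> assoc_at P G 1.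
Proof.
by move=> GP; exists 1, G, 0; rewrite ev1 oner_neq0 mul0r addr0 mul1r mulr1.
Qed.

Lemma assoc_at_mod P G H A : G = H + A * F -> assoc_at P G H.
Proof. by move=> ->; exists 1, 1, A; rewrite ev1 oner_neq0 !mul1r. Qed.

Lemma exists_unif P : exists M, unif P M.
Proof. exact: exists_orth_notin. Qed.

Section AtPoint.
Variable P : 'rV[K]_3.
Hypothesis PF : on_curve F P.

Let P0 : P != 0. Proof. by case: PF. Qed.
Let FP : ev F P = 0. Proof. by case: PF. Qed.
Let T := grad F P.
Let T0 : T != 0. Proof. exact: smF. Qed.
Let TP : ev (linform T) P = 0. Proof. exact: ev_grad_self hF FP. Qed.

(** Since B(P) = 1 and A(P) = 0, the tangent line T equals - A M up to a unit
    modulo F, so that it vanishes to order at least 2. *)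
Lemma tangent_decomp M : unif P M ->
  exists A B, [/\ A \is 3.-homog, B \is 3.-homog, ev A P = 0, ev B P = 1
    & F = A * linform M + B * linform T].
Proof.
move=> [MP MT]; have [A [B [hA hB e]]] := ideal_of_point P0 MP TP T0 MT hF FP.
have eT : T = ev A P *: M + ev B P *: T.
  rewrite {1}/T {1}e gradD !gradM !grad_linform MP TP !scale0r !add0r.
  by [].
have AP : ev A P = 0.
  apply/eqP; apply: contraNT MT => a0; apply/sub_rVP.
  exists ((ev A P)^-1 * (1 - ev B P)).
  rewrite -scalerA scalerBl scale1r -/T {1}eT addrK scalerA mulVf // scale1r.
  by [].
exists A, B; split=> //; apply/eqP; rewrite -subr_eq0; apply: contraNT T0 => b0.
rewrite -/T -(inj_eq (scalerI b0)) scaler0 scalerBl scale1r.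
by rewrite subr_eq0 {2}eT AP scale0r add0r.
Qed.

Lemma unif_neq0 M : unif P M -> M != 0.
Proof. by case=> _; apply: contraNneq => ->; apply: sub0mx. Qed.

(** If the line M divided the curve, it would be the tangent line. *)
Lemma unif_regular M : unif P M -> regular F (linform M).
Proof.
move=> uM Z [C e]; have M0 := unif_neq0 uM.
have : dvdm (linform M) (C * F) by rewrite -e mulrC; exists Z.
case/linform_prime => // [] [D eD].
  exists D; apply: (@mulfI _ (linform M)); first by rewrite linform_eq0.
  by rewrite e eD; ring.
case: uM => MP /negP [].
have eT : T = ev D P *: M.
  by rewrite /T {1}eD gradM grad_linform MP scale0r add0r.
have c0 : ev D P != 0 by apply: contraNneq T0 => c0; rewrite eT c0 scale0r.
apply/sub_rVP; exists (ev D P)^-1.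
by rewrite -/T eT scalerA mulVf // scale1r.
Qed.

Lemma regular_exp X n : regular F X -> regular F (X ^+ n).
Proof.
move=> rX; elim: n => [|n IHn] Z; first by rewrite expr0 mul1r.
by rewrite exprS -mulrA => /rX /IHn.
Qed.

Lemma unif_assoc_at M M' : unif P M -> unif P M' ->
  assoc_at P (linform M') (linform M).
Proof.
move=> uM uM'; have [A [B [_ _ AP BP e]]] := tangent_decomp uM.
case: (uM) (uM') => MP MT [MP' MT'].
have [a [b eM']] := span_of_orth P0 MP TP T0 MT MP'.
exists B, (a%:MP * B - b%:MP * A), b%:MP; rewrite BP oner_neq0; split=> //.
  rewrite !evE AP BP mulr0 subr0 mulr1; apply: contraNneq MT' => a0.
  by rewrite eM' a0 scale0r add0r scalemx_sub.
by rewrite eM' linformD !linformZ -!mul_mpolyC e; ring.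
Qed.

Lemma ordP_unif M G n : unif P M -> ordP P G n -> assoc_at P G (linform M ^+ n).
Proof.
move=> uM [M' uM' l]; apply: (assoc_at_trans l); apply: assoc_at_exp.
exact: unif_assoc_at.
Qed.

Lemma ordP_assoc_at G H n : assoc_at P G H -> ordP P H n -> ordP P G n.
Proof. by move=> l [M uM l']; exists M => //; apply: assoc_at_trans l'. Qed.

Lemma ordP_mul G H m n : ordP P G m -> ordP P H n -> ordP P (G * H) (m + n).
Proof.
move=> [M uM l] oH; exists M => //; rewrite exprD.
by apply: assoc_at_mul => //; apply: ordP_unif.
Qed.

Lemma ordP_exp G n m : ordP P G n -> ordP P (G ^+ m) (n * m).
Proof. by move=> [M uM l]; exists M => //; rewrite exprM; apply: assoc_at_exp. Qed.

Lemma ordP_unit G : ev G P != 0 -> ordP P G 0.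
Proof.
by have [M uM] := exists_unif P; exists M; rewrite // expr0; apply: assoc_at_unit.
Qed.

(** Uniformizers are regular modulo F. *)
Lemma assoc_at_cancel M n G H : unif P M ->
  assoc_at P (linform M ^+ n * G) (linform M ^+ n * H) -> assoc_at P G H.
Proof.
move=> uM [U [V [A [UP VP e]]]].
have [|B eB] := regular_exp (n := n) (unif_regular uM) (Z := U * G - V * H).
  exists A; have -> : linform M ^+ n * (U * G - V * H)
    = U * (linform M ^+ n * G) - V * (linform M ^+ n * H) by ring.
  by rewrite e; ring.
by exists U, V, B; split=> //; rewrite -eB; ring.
Qed.

Lemma assoc_at_vanish G H : assoc_at P G H -> ev G P = 0 -> ev H P = 0.
Proof.
move=> [U [V [A [UP VP e]]]] GP; have := congr1 (fun X => ev X P) e.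
rewrite !evE GP FP !mulr0 addr0 => /esym /eqP.
by rewrite mulf_eq0 (negPf VP) => /eqP.
Qed.

(** Two different orders would make a positive power of a uniformizer a
    unit. *)
Lemma ordP_uniq G m n : ordP P G m -> ordP P G n -> m = n.
Proof.
have lt a b : (a < b)%N -> ordP P G a -> ordP P G b -> False.
  move=> ab oa ob; have [M uM] := exists_unif P; have [MP _] := uM.
  have := assoc_at_trans (assoc_at_sym (ordP_unif uM ob)) (ordP_unif uM oa).
  rewrite -(subnKC (ltnW ab)) exprD -{2}[linform M ^+ a]mulr1.
  move/(assoc_at_cancel uM)/assoc_at_vanish; rewrite evX MP expr0n subn_eq0 leqNgt ab.
  by rewrite ev1 => /(_ erefl) /eqP; rewrite oner_eq0.
move=> om on; case: (ltngtP m n) => // h.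
  by case: (lt _ _ h om on).
by case: (lt _ _ h on om).
Qed.

Lemma ordP_local X Y m n : (n <= m)%N -> ordP P X m -> ordP P Y n ->
  exists2 W, ev W P != 0 & exists A B, W * X = A * Y + B * F.
Proof.
move=> nm oX oY; have [M uM] := exists_unif P.
have [U [V [A [UP VP e]]]] := ordP_unif uM oX.
have [U' [V' [A' [UP' VP' e']]]] := assoc_at_sym (ordP_unif uM oY).
exists (U * U'); first by rewrite evM mulf_neq0.
exists (V * linform M ^+ (m - n) * V'), (U' * A + V * linform M ^+ (m - n) * A').
have -> : U * U' * X = U' * (U * X) by ring.
rewrite e mulrDr -{1}(subnK nm) exprD.
have -> : U' * (V * (linform M ^+ (m - n) * linform M ^+ n))
  = V * linform M ^+ (m - n) * (U' * linform M ^+ n) by ring.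
by rewrite e'; ring.
Qed.

(** A form vanishing at P lies in the ideal (M, T), and T is a multiple of M in
    the local ring. *)
Lemma unif_divide M d G : unif P M -> G \is d.-homog -> ev G P = 0 ->
  exists d' G', G' \is d'.-homog /\ assoc_at P G (linform M * G').
Proof.
move=> uM; case: (uM) => MP MT; case: d => [|d] hG GP.
  have [c e] := homog0_const hG; move: GP; rewrite e evC => c0.
  exists 0%N, 0; split; first exact: dhomog0.
  by rewrite c0 mpolyC0 mulr0; apply: assoc_at_refl.
have [A [B [hA hB AP BP eF]]] := tangent_decomp uM.
have [C [D [hC hD eG]]] := ideal_of_point P0 MP TP T0 MT hG GP.
exists (d + 3)%N, (C * B - D * A); split.
  by apply: rpredB; apply: dhomogM.
exists B, 1, D; rewrite BP ev1 oner_neq0; split=> //.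
by rewrite eG eF; ring.
Qed.

Lemma unif_divide_exp M d G n : unif P M -> G \is d.-homog ->
    (exists2 m, (m < n)%N & ordP P G m) \/
  exists d' G', G' \is d'.-homog /\ assoc_at P G (linform M ^+ n * G').
Proof.
move=> uM hG; elim: n => [|n [[m lt o]|[d' [G' [hG' l]]]]].
- by right; exists d, G; rewrite expr0 mul1r; split=> //; apply: assoc_at_refl.
- by left; exists m => //; apply: ltnW.
have [GP|GP] := eqVneq (ev G' P) 0; last first.
  left; exists n => //; exists M => //; apply: (assoc_at_trans l).
  by rewrite -[X in assoc_at _ _ X]mulr1; apply: assoc_at_mul (assoc_at_refl _ _) (assoc_at_unit GP).
have [d'' [G'' [hG'' l']]] := unif_divide uM hG' GP.
right; exists d'', G''; split=> //; apply: (assoc_at_trans l).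
by rewrite exprSr -mulrA; apply: assoc_at_mul (assoc_at_refl _ _) l'.
Qed.

(** If Q were divisible by the (n + 1)-st power of a uniformizer, its square
    would have an order larger than 2 n. *)
Lemma ordP_sqrt d Q n : Q \is d.-homog -> ordP P (Q ^+ 2) n.*2 -> ordP P Q n.
Proof.
move=> hQ o2; have [M uM] := exists_unif P.
case: (unif_divide_exp n.+1 uM hQ) => [[m ltm om]|[d' [G [hG l]]]].
  have := ordP_uniq (ordP_exp 2 om) o2.
  by rewrite muln2 => /double_inj <-.
have [MP _] := uM.
have l2 := assoc_at_exp 2 l.
have l3 := assoc_at_trans (assoc_at_sym (ordP_unif uM o2)) l2.
have : assoc_at P 1 (linform M ^+ 2 * G ^+ 2).
  apply: (assoc_at_cancel (n := n.*2) uM); rewrite mulr1.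
  by rewrite mulrA -exprD addn2 -doubleS -[n.+1.*2]muln2 exprM -exprMn.
move/assoc_at_sym/assoc_at_vanish; rewrite evM evX MP expr0n mul0r ev1.
by move/(_ erefl)/eqP; rewrite oner_eq0.
Qed.

Lemma ord_at_ordP G n : ord_at F P G n -> ordP P G n.
Proof.
move=> [M [MP MT [d1 [d2 [U [V [A [hU hV UP VP e]]]]]]]].
exists M; first by split.
by exists U, V, A; split=> //; rewrite -e; ring.
Qed.

(** Some homogeneous part of the multiplier U is nonzero at P.  In the
    corresponding part of the relation, the multiplier V' satisfies U V' = U_i
    V modulo F, hence it is nonzero at P too. *)
Lemma ordP_ord_at d G n : G \is d.-homog -> ordP P G n -> ord_at F P G n.
Proof.
move=> hG [M uM [U [V [A [UP VP e]]]]]; have [MP MT] := uM.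
exists M; split=> //.
have [i UiP] : exists i, ev (pihomog mdeg i U) P != 0.
  move: UP; rewrite {1}[U](pihomog_partitionE (mf := mdeg) (leqnn _)).
  set k := mmeasure _ U => sn.
  have [/forallP all0|] := boolP [forall i : 'I_k, ev (pihomog mdeg i U) P == 0].
    move: sn; rewrite /ev raddf_sum big1 ?eqxx // => j _; apply/eqP.
    exact: all0.
  by rewrite negb_forall => /existsP [j hj]; exists j.
have hMn : linform M ^+ n \is n.-homog.
  by rewrite -[X in X.-homog]mul1n; apply: dhomogMn; apply: linform_homog.
have /(congr1 (pihomog mdeg (i + d))) := e.
rewrite pihomogD (pihomog_mulr _ _ hG) (pihomog_mulr _ _ hMn) (pihomog_mulr _ _ hF).
rewrite leq_addl addnK; set Ui := pihomog mdeg i U.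
set Vi := pihomog mdeg _ V; set Ai := pihomog mdeg _ A => ei.
pose V' := if (n <= i + d)%N then Vi else 0.
pose A' := if (4 <= i + d)%N then Ai else 0.
have {}ei : Ui * G = V' * linform M ^+ n + A' * F.
  by rewrite ei /V' /A'; congr (_ + _); case: ifP; rewrite ?mul0r.
have [|C eC] := regular_exp (n := n) (unif_regular uM) (Z := U * V' - Ui * V).
  exists (Ui * A - U * A').
  have -> : linform M ^+ n * (U * V' - Ui * V)
    = U * (V' * linform M ^+ n) - Ui * (V * linform M ^+ n) by ring.
  have -> : V' * linform M ^+ n = Ui * G - A' * F by rewrite ei; ring.
  have -> : V * linform M ^+ n = U * G - A * F by rewrite e; ring.
  by ring.
(* U V' and U_i V differ by a multiple of F. *)
have V'P : ev V' P != 0.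
  have := congr1 (fun X => ev X P) eC; rewrite !evE FP mulr0 => /eqP.
  rewrite subr_eq0 => /eqP h; apply: contraNneq (mulf_neq0 UiP VP) => v0.
  by rewrite -h v0 mulr0.
exists i, (i + d - n)%N, Ui, V', A'; split=> //.
- exact: pihomogP.
- by rewrite /V'; case: ifP => _; [apply: pihomogP | apply: dhomog0].
- by rewrite ei; ring.
Qed.

End AtPoint.

Lemma ordP_regular O d Y : ev F O != 0 -> Y \is d.-homog ->
  (forall P, on_curve F P -> exists n, ordP P Y n) -> regular F Y.
Proof.
move=> FO hY ord; apply: (regular_of_local hF FO hY) => P PF Z [C e].
have [n [M uM [U [V [A [UP VP eY]]]]]] := ord P PF.
exists V => //; apply: (regular_exp (n := n) (unif_regular PF uM)).
exists (U * C - A * Z).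
have -> : linform M ^+ n * (V * Z) = (V * linform M ^+ n) * Z by ring.
have -> : V * linform M ^+ n = U * Y - A * F by rewrite eY; ring.
have -> : (U * Y - A * F) * Z = U * (Y * Z) - A * F * Z by ring.
by rewrite e; ring.
Qed.
End LocalOrder.

(** * Contact divisors of lines *)

Section PlaneQuarticDivisors.
Variable K : closedFieldType.
Implicit Types (G H X Y Z W A B U V : {mpoly K[3]}) (P L M N T E : 'rV[K]_3).
Variable F : {mpoly K[3]}.
Hypothesis hF : F \is 4.-homog.
Hypothesis smF : smooth_curve F.

Lemma line_meets L d G : G \is d.+1.-homog ->
  exists P, [/\ P != 0, ev (linform L) P = 0 & ev G P = 0].
Proof.
move=> hG; have [E [LE E0]] := exists_orth_notin L 0.
have {}E0 : E != 0 by apply: contraNneq E0 => ->; apply: sub0mx.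
have [O [LO OE]] := exists_orth_notin L E.
rewrite ev_linform_sym in LE; rewrite ev_linform_sym in LO.
have O0 : O != 0 by apply: contraNneq OE => ->; apply: sub0mx.
have [/closed_rootP [t rt]|] := boolP (size (restr E O G) != 1).
  exists (E + t *: O); split.
  - apply: contraNneq OE => /eqP; rewrite addr_eq0 => /eqP e.
    have t0 : t != 0 by apply: contraNneq E0 => t0; rewrite e t0 scale0r oppr0.
    apply/sub_rVP; exists (- t^-1); rewrite e scaleNr scalerN opprK scalerA.
    by rewrite mulVf // scale1r.
  - rewrite ev_linform_sym linformD linformZ evD evZ.
    by rewrite !(ev_linform_sym _ L) LE LO mulr0 addr0.
  - by rewrite -horner_restr; apply/eqP.
rewrite negbK => /eqP s1; exists O; split=> //.
have [M [M0 ME MO]] := exists_line_through2 E O.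
by rewrite -(restr_top E0 OE ME MO M0 hG) nth_default // s1.
Qed.

(** A curve that contains a line is singular where the line meets the rest. *)
Lemma line_not_dvd L : ~ dvdm (linform L) F.
Proof.
case=> W0 eW0.
have [W hW eW] := homog_cofactor hF (linform_homog L) eW0.
have [P [P0 LP WP]] := line_meets L hW.
have /negP [] : grad F P != 0 by apply: smF; split=> //; rewrite eW evM WP mul0r.
by rewrite eW gradM LP WP !scale0r addr0.
Qed.

(** Where Q meets the line L, both squares have zero gradient, but F has
    not. *)
Lemma no_double_line d c Q L S : c != 0 -> Q \is d.+1.-homog ->
  c%:MP * F = Q ^+ 2 - linform L ^+ 2 * S -> False.
Proof.
move=> c0 hQ e; have [P [P0 LP QP]] := line_meets L hQ.
have FP : ev F P = 0.
  have /eqP := congr1 (fun X => ev X P) e.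
  by rewrite !evE QP LP !expr0n mul0r subr0 mulf_eq0 (negPf c0) => /eqP.
have /negP [] : grad F P != 0 by apply: smF; split.
have := congr1 (fun X => grad X P) e.
rewrite mul_mpolyC gradZ gradB gradM !grad_sqr evX QP LP expr0n.
rewrite !(scale0r, mul0rn, scaler0, addr0, subr0) => /eqP.
by rewrite scaler_eq0 (negPf c0).
Qed.

(** Modulo F the line L is Q^2 up to a unit at each of its points on the curve,
    because F is smooth there.  If Q is transversal to L at P, the order is 2;
    otherwise Q restricted to the line has a double zero, and the order is
    4. *)
Lemma contact_even c Q L S : c != 0 -> Q \is 2.-homog ->
    c%:MP * F = Q ^+ 2 - linform L * S ->
  forall P, on_curve F P -> exists n, ordP F P (linform L) n.*2.
Proof.
move=> c0 hQ e P PF; have [P0 FP] := PF.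
have [LP|LP] := eqVneq (ev (linform L) P) 0; last first.
  by exists 0%N; rewrite double0; apply: ordP_unit.
have QP : ev Q P = 0.
  have /eqP := congr1 (fun X => ev X P) e.
  by rewrite !evE FP LP mulr0 mul0r subr0 eq_sym sqrf_eq0 => /eqP.
have T0 : grad F P != 0 by apply: smF.
have eT : c *: grad F P = - ev S P *: L.
  have := congr1 (fun X => grad X P) e.
  rewrite mul_mpolyC gradZ gradB gradM grad_sqr grad_linform QP LP.
  by rewrite !scale0r mul0rn addr0 sub0r scaleNr.
have SP : ev S P != 0.
  apply: contraNneq T0 => s0; rewrite -(inj_eq (scalerI c0)) scaler0 eT s0.
  by rewrite oppr0 scale0r.
have L0 : L != 0.
  apply: contraNneq T0 => L0; rewrite -(inj_eq (scalerI c0)) scaler0 eT L0.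
  by rewrite scaler0.
have [M uM] := exists_unif F P; have [MP MT] := uM.
have ML : ~~ (M <= L)%MS.
  apply: contra MT => /submx_trans; apply; apply/sub_rVP.
  exists ((- ev S P)^-1 * c); rewrite -scalerA eT scalerA mulVf ?oppr_eq0 //.
  by rewrite scale1r.
have [A [B [hA hB eQ]]] := ideal_of_point P0 MP LP L0 ML hQ QP.
(* Q = A M + B L; the line L and the square A^2 M^2 agree up to a unit modulo
   F. *)
have [AP|AP] := eqVneq (ev A P) 0; last first.
  exists 1%N, M => //; exists (S - 2%:R * linform M * A * B - linform L * B ^+ 2).
  exists (A ^+ 2), (- c%:MP); split.
  - by rewrite !evE MP LP !mulr0 !mul0r !subr0.
  - by rewrite evX expf_neq0.
  have -> : A ^+ 2 * linform M ^+ 1.*2 + - c%:MP * F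
    = A ^+ 2 * linform M ^+ 2 - c%:MP * F by rewrite mulNr.
  by rewrite e eQ; ring.
have [A0 [B0 [hA0 hB0 eA]]] := ideal_of_point P0 MP LP L0 ML hA AP.
have [a ea] := homog0_const hA0.
have a0 : a != 0.
  apply/negP => /eqP a0.
  have : dvdm (linform L) F.
    exists (c^-1%:MP * ((B0 * linform M + B) * Q - S)).
    have -> : F = c^-1%:MP * (c%:MP * F).
      by rewrite mulrA -mpolyCM mulVf // mpolyC1 mul1r.
    by rewrite e eQ eA ea a0 mpolyC0; ring.
  exact: line_not_dvd.
pose k := B0 * linform M + B.
exists 2%N, M => //; exists (S - 2%:R * a%:MP * linform M ^+ 2 * k - linform L * k ^+ 2).
exists (a ^+ 2)%:MP, (- c%:MP); split.
- by rewrite !evE MP LP !(expr0n, mulr0, mul0r, subr0).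
- by rewrite evC expf_neq0.
have -> : (a ^+ 2)%:MP * linform M ^+ 2.*2 + - c%:MP * F
    = a%:MP ^+ 2 * linform M ^+ 4 - c%:MP * F by rewrite mulNr rmorphXn.
by rewrite e eQ eA ea /k; ring.
Qed.

Let O : 'rV[K]_3 := delta_mx 0 ord_max.
Hypothesis FO : ev F O != 0.

Lemma exists_on_curve : exists P, on_curve F P.
Proof. by have [P [P0 _ FP]] := line_meets 0 hF; exists P. Qed.

(** By Max Noether's theorem X is a multiple of Y modulo F, and the multiplier
    has degree 0. *)
Lemma same_order e X Y : X \is e.-homog -> Y \is e.-homog ->
    (forall P, on_curve F P -> exists2 n, ordP F P X n & ordP F P Y n) ->
  exists2 c, c != 0 & exists B, X = c%:MP * Y + B * F.
Proof.
move=> hX hY o.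
have rX : regular F X.
  by apply: (ordP_regular hF smF FO hX) => P /o [n oX _]; exists n.
have rY : regular F Y.
  by apply: (ordP_regular hF smF FO hY) => P /o [n _ oY]; exists n.
have [|A hA [B eX]] := noether hF FO hX hY rY.
  by move=> P PF; have [n oX oY] := o P PF; apply: (ordP_local hF smF PF (leqnn n)).
rewrite subnn in hA; have [c ec] := homog0_const hA.
exists c; last by exists B; rewrite -ec.
apply/negP => /eqP c0; have [|C e1] := rX 1.
  by exists B; rewrite mulr1 eX ec c0 mpolyC0 mul0r add0r.
have [P [_ FP]] := exists_on_curve.
have := congr1 (fun G => ev G P) e1; rewrite ev1 evM FP mulr0 => /eqP.
by rewrite oner_eq0.
Qed.

Lemma low_degree d G : (d < 4)%N -> G \is d.-homog -> dvdm F G -> G = 0.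
Proof.
move=> d4 hG [A e]; rewrite -(pihomog_dE hG) e (pihomog_mulr _ _ hF).
by rewrite leqNgt d4.
Qed.

(** By Max Noether's theorem, G = N H modulo F with a linear form N.  Then N^2
    and c L M have the same divisor for some c, and they are equal, because
    their degree is less than 4; unique factorization gives the result. *)
Lemma contact_inequiv d L M G H : L != 0 -> M != 0 ->
    G \is d.+1.-homog -> H \is d.-homog ->
    (forall P, on_curve F P -> exists h a b,
       [/\ ordP F P H h, ordP F P (linform L) a.*2, ordP F P (linform M) b.*2
         & ordP F P G (h + a + b)]) ->
  (L <= M)%MS.
Proof.
move=> L0 M0 hG hH o.
have rH : regular F H.
  by apply: (ordP_regular hF smF FO hH) => P /o [h [a [b [oH _ _ _]]]]; exists h.
have [|N0 hN [B eG]] := noether hF FO hG hH rH.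
  move=> P PF; have [h [a [b [oH _ _ oG]]]] := o P PF.
  by apply: (ordP_local hF smF PF _ oG oH); rewrite -addnA leq_addr.
rewrite subSn // subnn in hN; have [N eN] := homog1_linform hN.
rewrite {}eN {hN} in eG.
have hLMH : linform L * linform M * H ^+ 2 \is (d.+1 * 2).-homog.
  rewrite (_ : (d.+1 * 2 = 1 + 1 + d * 2)%N); last by rewrite mulSn.
  apply: dhomogM; last exact: dhomogMn.
  by apply: dhomogM; apply: linform_homog.
have [|c c0 [B' e2]] := same_order (dhomogMn 2 hG) hLMH.
  move=> P PF; have [h [a [b [oH oL oM oG]]]] := o P PF.
  exists (a.*2 + b.*2 + h * 2)%N; last first.
    apply: (ordP_mul hF smF PF); last exact: (ordP_exp 2 oH).
    exact: (ordP_mul hF smF PF).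
  have -> : (a.*2 + b.*2 + h * 2 = (h + a + b) * 2)%N.
    by rewrite !mulnDl -!muln2 addnC addnA.
  exact: (ordP_exp 2 oG).
have hN2 : linform N ^+ 2 - c%:MP * (linform L * linform M) \is 2.-homog.
  apply: rpredB; first exact: (dhomogMn 2 (linform_homog N)).
  by rewrite mul_mpolyC; apply: dhomogZ; exact: (dhomogM (linform_homog L) (linform_homog M)).
have eN2 : linform N ^+ 2 = c%:MP * (linform L * linform M).
  apply/eqP; rewrite -subr_eq0; apply/eqP; apply: (low_degree _ hN2) => //.
  apply: (rH); apply: (rH).
  exists (B' - 2%:R * linform N * H * B - B ^+ 2 * F).
  have e3 : (linform N * H + B * F) ^+ 2
     = c%:MP * (linform L * linform M * H ^+ 2) + B' * F by rewrite -eG.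
  have -> : H * (H * (linform N ^+ 2 - c%:MP * (linform L * linform M)))
    = (linform N * H + B * F) ^+ 2 - 2%:R * linform N * H * B * F - B ^+ 2 * F * F
      - c%:MP * (linform L * linform M * H ^+ 2) by ring.
  by rewrite e3; ring.
have [A eA] : dvdm (linform L) (linform N).
  have : dvdm (linform L) (linform N * linform N).
    by exists (c%:MP * linform M); rewrite -expr2 eN2; ring.
  by case/(linform_prime L0).
have [A1 hA1 {}eA] := homog_cofactor (linform_homog N) (linform_homog L) eA.
have [c' ec'] := homog0_const hA1.
have eL : (c' ^+ 2) *: L = c *: M.
  apply: linform_inj; rewrite !linformZ -!mul_mpolyC rmorphXn /=.
  apply: (@mulfI _ (linform L)); first by rewrite linform_eq0.
  have -> : linform L * (c'%:MP ^+ 2 * linform L) = (c'%:MP * linform L) ^+ 2 by ring.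
  by rewrite -ec' -eA eN2; ring.
have c'0 : c' ^+ 2 != 0.
  apply: contraNneq M0 => c'0; rewrite -(inj_eq (scalerI c0)) -eL c'0.
  by rewrite scale0r scaler0.
apply/sub_rVP; exists ((c' ^+ 2)^-1 * c).
by rewrite -scalerA -eL scalerA mulVf // scale1r.
Qed.

End PlaneQuarticDivisors.

(** * The net of quadrics *)

Definition ord4 (i : nat) (h : (i < 4)%N) : 'I_4 := Ordinal h.
Notation o0 := (@ord4 0 isT).
Notation o1 := (@ord4 1 isT).
Notation o2 := (@ord4 2 isT).
Notation o3 := (@ord4 3 isT).

Lemma sum4 (V : nmodType) (G : 'I_4 -> V) :
  \sum_i G i = G o0 + G o1 + G o2 + G o3.
Proof.
rewrite !big_ord_recl big_ord0 addr0 !addrA.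
by congr (_ + _ + _ + _); congr (G _); apply/val_inj.
Qed.

Section NetMatrix.
Variable R : comNzRingType.

(** The symmetric matrices of the net.  The coefficients of x, y and z are the
    matrices of X0 X2 - X1^2, of X2^2 - X0 X3 and of a quadric that restricts
    to the octic on the curve X0 X2 = X1^2, X2^2 = X0 X3, each with the factor
    2. *)
Definition net (a : nat -> R) (x y z : R) : 'M[R]_4 :=
  \matrix_(i, j) (nth [::] [:: [:: 2 * a 0%N * z; a 1%N * z; x + a 2%N * z; - y];
                     [:: a 1%N * z; - (2 * x); a 3%N * z; a 5%N * z];
                     [:: x + a 2%N * z; a 3%N * z; 2 * y + 2 * a 4%N * z; a 6%N * z];
                     [:: - y; a 5%N * z; a 6%N * z; 2 * z]] i)`_j.

(** The parametrization of the curve X0 X2 = X1^2, X2^2 = X0 X3. *)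
Definition quart_pt (t : R) : 'rV[R]_4 := \row_j [:: 1; t; t ^+ 2; t ^+ 4]`_j.

Lemma net_sym a x y z : (net a x y z)^T = net a x y z.
Proof.
apply/matrixP => i j; rewrite !mxE.
by case: i j => [[|[|[|[|[]]]]] // hi] [[|[|[|[|[]]]]] // hj].
Qed.

Lemma det2 (M : 'M[R]_2) (m := fun i j : nat => M (inord i) (inord j)) :
  \det M = m 0%N 0%N * m 1%N 1%N - m 0%N 1%N * m 1%N 0%N.
Proof.
have E (i j : 'I_2) : M i j = m i j by rewrite /m !inord_val.
rewrite (expand_det_row _ ord0) !big_ord_recl big_ord0 /cofactor !det_mx11 !mxE !E.
rewrite /= /bump /= !(add0n, addn0, addn1).
by ring.
Qed.

Lemma det3 (M : 'M[R]_3) (m := fun i j : nat => M (inord i) (inord j)) : \det M =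
  m 0%N 0%N * (m 1%N 1%N * m 2%N 2%N - m 1%N 2%N * m 2%N 1%N)
  - m 0%N 1%N * (m 1%N 0%N * m 2%N 2%N - m 1%N 2%N * m 2%N 0%N)
  + m 0%N 2%N * (m 1%N 0%N * m 2%N 1%N - m 1%N 1%N * m 2%N 0%N).
Proof.
have E (i j : 'I_3) : M i j = m i j by rewrite /m !inord_val.
rewrite (expand_det_row _ ord0) !big_ord_recl big_ord0 /cofactor !det2 !mxE !E.
rewrite /= /bump /=.
rewrite ?inordK //= !(add0n, addn0, addn1).
by ring.
Qed.

Lemma det_net a x y z : \det (net a x y z) = quartic a x y z.
Proof.
rewrite (expand_det_row _ ord0) !big_ord_recl big_ord0 /cofactor !det3 !mxE.
rewrite /= /bump /= !inordK //= !(add0n, addn0, addn1) /=.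
rewrite /quartic.
by ring.
Qed.
End NetMatrix.

(** * The octad of base points *)

Lemma net_bilE (R : comNzRingType) a (x y z : R) (u w : 'rV[R]_4) :
  (u *m net a x y z *m w^T) 0 0 =
   (2 * a 0%N * z * u 0 o0 + a 1%N * z * u 0 o1 + (x + a 2%N * z) * u 0 o2 - y * u 0 o3)
     * w 0 o0
   + (a 1%N * z * u 0 o0 - 2 * x * u 0 o1 + a 3%N * z * u 0 o2 + a 5%N * z * u 0 o3)
     * w 0 o1
   + ((x + a 2%N * z) * u 0 o0 + a 3%N * z * u 0 o1 + (2 * y + 2 * a 4%N * z) * u 0 o2
      + a 6%N * z * u 0 o3) * w 0 o2
   + (a 5%N * z * u 0 o1 + a 6%N * z * u 0 o2 + 2 * z * u 0 o3 - y * u 0 o0)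
     * w 0 o3.
Proof. by rewrite !mxE sum4 !mxE !sum4 !mxE /=; ring. Qed.

Section Octad.
Variable K : closedFieldType.
Hypothesis char2 : (2%:R : K) != 0.
Variable th : 'I_8 -> K.
Hypothesis th_inj : injective th.
Hypothesis th_sum : \sum_j th j = 0.
Hypothesis th_four : forall i j k l, uniq [:: i; j; k; l] ->
  th i + th j + th k + th l != 0.

Definition octic : {poly K} := \prod_j ('X - (th j)%:P).
Definition oct_coef (i : nat) : K := octic`_i.
Local Notation a := oct_coef.

Lemma octic_seq : octic = \prod_(x <- [seq th j | j <- enum 'I_8]) ('X - x%:P).
Proof. by rewrite big_map big_enum. Qed.

Lemma size_octic : size octic = 9%N.
Proof. by rewrite octic_seq size_prod_XsubC size_map size_enum_ord. Qed.

Lemma octic_monic : octic \is monic.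
Proof. by rewrite octic_seq monic_prod_XsubC. Qed.

Lemma octic8 : octic`_8 = 1.
Proof. by have /monicP := octic_monic; rewrite /lead_coef size_octic. Qed.

Lemma octic7 : octic`_7 = 0.
Proof.
have := @coefPn_prod_XsubC K [seq th j | j <- enum 'I_8].
rewrite size_map size_enum_ord -octic_seq => -> //.
by rewrite big_map big_enum /= th_sum oppr0.
Qed.

Lemma root_octic t : root octic t -> exists j, t = th j.
Proof.
rewrite octic_seq root_prod_XsubC => /mapP [j _ ->]; by exists j.
Qed.

Lemma octic_th j : octic.[th j] = 0.
Proof.
apply/eqP; rewrite -[_ == _]/(root _ _) octic_seq root_prod_XsubC.
by rewrite map_f // mem_enum.
Qed.

Lemma hornerE_octic t : octic.[t] =
  a 0%N + a 1%N * t + a 2%N * t ^+ 2 + a 3%N * t ^+ 3 + a 4%N * t ^+ 4 + a 5%N * t ^+ 5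
  + a 6%N * t ^+ 6 + t ^+ 8.
Proof.
rewrite horner_coef size_octic !big_ord_recr big_ord0 /= octic7 octic8 /oct_coef.
by ring.
Qed.

Lemma horner_deriv_octic t : octic^`().[t] =
  a 1%N + 2 * a 2%N * t + 3 * a 3%N * t ^+ 2 + 4 * a 4%N * t ^+ 3 + 5 * a 5%N * t ^+ 4
  + 6 * a 6%N * t ^+ 5 + 8 * t ^+ 7.
Proof.
have s : (size (octic^`()) <= 8)%N.
  by rewrite -ltnS -size_octic lt_size_deriv // -size_poly_eq0 size_octic.
rewrite (horner_coef_wide _ s) !big_ord_recr big_ord0 /= !coef_deriv octic7 octic8.
by rewrite /oct_coef; ring.
Qed.

Lemma octic_simple j : octic^`().[th j] != 0.
Proof.
rewrite /octic (bigD1 j) //= derivM derivXsubC mul1r hornerD hornerM.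
rewrite !hornerXsubC subrr mul0r addr0 horner_prod.
rewrite prodf_seq_neq0; apply/allP => i _; apply/implyP => ij.
by rewrite hornerXsubC subr_eq0 (inj_eq th_inj) eq_sym.
Qed.

Section AtPoint.
Variables x y z : K.
Local Notation N := (net a x y z).
Local Notation b u w := ((u *m N *m w^T) 0 0).

Lemma bil_sym (u w : 'rV[K]_4) : b u w = b w u.
Proof.
have <- : (u *m N *m w^T)^T = w *m N *m u^T.
  by rewrite !trmx_mul trmxK net_sym mulmxA.
by rewrite [RHS]mxE.
Qed.

Lemma bil_diag t : b (quart_pt t) (quart_pt t) = 2 * z * octic.[t].
Proof. by rewrite net_bilE hornerE_octic !mxE /=; ring. Qed.

(** The tangent vector of the rational curve at the j-th point pairs with the
    quadric to z f'(t), and the octic f has simple roots. *)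
Lemma net_transversal j : quart_pt (th j) *m N = 0 -> [/\ x = 0, y = 0 & z = 0].
Proof.
move=> e; have bz (w : 'rV[K]_4) : b (quart_pt (th j)) w = 0 by rewrite e mul0mx mxE.
set t := th j in e bz.
have z0 : z = 0.
  have := bz (\row_j [:: 0; 1; 2 * t; 4 * t ^+ 3]`_j).
  rewrite net_bilE !mxE /= => h; apply/eqP.
  have /eqP : z * octic^`().[t] = 0 by rewrite horner_deriv_octic -[RHS]h; ring.
  by rewrite mulf_eq0 (negPf (octic_simple j)) orbF.
have y0 : y = 0.
  have := bz (delta_mx 0 o3); rewrite net_bilE !mxE /= z0 => h.
  by rewrite -[RHS]oppr0 -[in RHS]h; ring.
have x0 : x = 0.
  have := bz (delta_mx 0 o2); rewrite net_bilE !mxE /= z0 y0 => h.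
  by rewrite -[RHS]h; ring.
by [].
Qed.

Hypothesis nz : ~ [/\ x = 0, y = 0 & z = 0].

(** The polar of the j-th base point, restricted to the rational curve; the
    exponent 3 does not occur in its parametrization. *)
Let g j : {poly K} := let h := quart_pt (th j) *m N in
  Poly [:: h 0 o0; h 0 o1; h 0 o2; 0; h 0 o3].

Lemma horner_g j t : (g j).[t] = b (quart_pt (th j)) (quart_pt t).
Proof.
rewrite /g horner_Poly /= [RHS]mxE sum4 [(quart_pt t)^T _ _]mxE.
rewrite ![(quart_pt t)^T _ _]mxE ![quart_pt t _ _]mxE /=.
by ring.
Qed.

Lemma size_g j : (size (g j) <= 5)%N.
Proof. exact: size_Poly. Qed.

Lemma coef3_g j : (g j)`_3 = 0.
Proof. by rewrite /g coef_Poly. Qed.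

Lemma g_neq0 j : g j != 0.
Proof.
apply/eqP => e; apply: nz; apply: (@net_transversal j).
have c i : [:: (quart_pt (th j) *m N) 0 o0; (quart_pt (th j) *m N) 0 o1;
   (quart_pt (th j) *m N) 0 o2; 0; (quart_pt (th j) *m N) 0 o3]`_i = 0.
  by rewrite -coef_Poly -/(g j) e coef0.
apply/rowP => i; rewrite [RHS]mxE.
case: i => [[|[|[|[|[]]]]] // hi].
- by rewrite -[RHS](c 0%N) /=; congr (_ 0 _); apply/val_inj.
- by rewrite -[RHS](c 1%N) /=; congr (_ 0 _); apply/val_inj.
- by rewrite -[RHS](c 2%N) /=; congr (_ 0 _); apply/val_inj.
- by rewrite -[RHS](c 4%N) /=; congr (_ 0 _); apply/val_inj.
Qed.

(** If the rank were at most 2, the Gram determinant of any three points would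
    vanish.  For two base points with nonzero polar value u, this expresses the
    octic, up to a factor, as the product of their polars restricted to the
    rational curve.  These are quartic polynomials without cubic term, so four
    of the parameters would have sum 0. *)
Lemma net_rank : (3 <= \rank N)%N.
Proof.
rewrite leqNgt; apply/negP => rk.
have gram s r t (u := b (quart_pt s) (quart_pt r)) :
    b (quart_pt s) (quart_pt s) = 0 -> b (quart_pt r) (quart_pt r) = 0 ->
    b (quart_pt t) (quart_pt t) * u ^+ 2
    = 2 * u * b (quart_pt s) (quart_pt t) * b (quart_pt r) (quart_pt t).
  move=> ss rr.
  pose X : 'M[K]_(3, 4) := \matrix_i nth 0 [:: quart_pt s; quart_pt r; quart_pt t] i.
  have d0 : \det (X *m N *m X^T) = 0.
    apply/eqP; apply: contraTT rk => d0; rewrite -leqNgt.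
    have r3 : \rank (X *m N *m X^T) = 3%N.
      by apply: mxrank_unit; rewrite unitmxE unitfE.
    apply: leq_trans (mxrankM_maxr X N).
    by apply: leq_trans (mxrankM_maxl _ X^T); rewrite r3.
  have ent i j : (X *m N *m X^T) i j = b (row i X) (row j X).
    rewrite -row_mul tr_row -[_ *m col _ _]/(_ *m _) colE mulmxA -row_mul -colE.
    by rewrite !mxE.
  move: d0; rewrite det3 !ent !rowK !inordK //= ss rr.
  rewrite (bil_sym (quart_pt r) (quart_pt s)) (bil_sym (quart_pt t) (quart_pt s)).
  rewrite (bil_sym (quart_pt t) (quart_pt r)) -/u => h.
  by apply/eqP; rewrite -subr_eq0 -oppr_eq0 -[X in X == _]addr0 -{2}h; apply/eqP; ring.
have diag0 j : b (quart_pt (th j)) (quart_pt (th j)) = 0.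
  by rewrite bil_diag octic_th mulr0.
(* Otherwise a polar, of degree at most 4, would have eight roots. *)
have [[i j] /= bij] : exists p : 'I_8 * 'I_8,
    b (quart_pt (th p.1)) (quart_pt (th p.2)) != 0.
  apply/existsP; apply: contraT; rewrite negb_exists => /forallP all0.
  have : (size [seq th j | j <- enum 'I_8] < size (g ord0))%N.
    apply: max_poly_roots; first exact: g_neq0.
      apply/allP => _ /mapP [j _ ->]; rewrite /root horner_g.
      by have := all0 (ord0, j); rewrite negbK.
    by rewrite map_inj_uniq ?enum_uniq.
  by rewrite size_map size_enum_ord ltnNge (leq_trans (size_g _)).
set u := b _ _ in bij.
have eg : (z * u) *: octic = g i * g j.
  apply/eqP; rewrite -subr_eq0; apply: contraT => /closed_nonrootP [t].
  rewrite /root hornerD hornerN hornerZ hornerM !horner_g => /negP []; rewrite subr_eq0.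
  have := gram (th i) (th j) t (diag0 i) (diag0 j); rewrite bil_diag -/u => h.
  apply/eqP; apply: (mulfI char2); apply: (mulfI bij).
  by rewrite -[LHS]/(u * (2 * (z * u * octic.[t]))); transitivity (2 * z * octic.[t] * u ^+ 2);
     [ring | rewrite h; ring].
have gg0 : g i * g j != 0 by rewrite mulf_neq0 ?g_neq0.
have zu : z * u != 0 by apply: contraNneq gg0 => zu; rewrite -eg zu scale0r.
have sz : (size (g i) + size (g j)).-1 = 9%N.
  by rewrite -size_mul ?g_neq0 // -eg size_scale // size_octic.
have si : size (g i) = 5%N.
  apply/eqP; rewrite eqn_leq size_g /= -(leq_add2r (size (g j))).
  have -> : (size (g i) + size (g j) = 10)%N.
    by move: sz; case: (_ + _)%N => //= n ->.
  by rewrite -[10%N]/(5 + 5)%N leq_add2l size_g.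
have : g i %| octic by rewrite -(dvdpZr _ _ zu) eg dvdp_mulr.
case/(@dvdp_prod_XsubC _ _ _ th) => m em.
set s := mask m _ in em.
have us : uniq s by rewrite mask_uniq ?index_enum_uniq.
have ss : size s = 4%N.
  by apply/eqP; rewrite -eqSS -(size_prod_XsubC s th) -(eqp_size em) si.
have /eqpP [[c d] /= /andP [cn dn]] := em.
move/(congr1 (fun p : {poly K} => p`_3)); rewrite !coefZ coef3_g mulr0 => /esym/eqP.
rewrite mulf_eq0 (negPf dn) /= => /eqP.
have := @coefPn_prod_XsubC K [seq th j | j <- s]; rewrite size_map ss !big_map.
move=> -> // /eqP; rewrite oppr_eq0.
move: s us ss {em} => [|j1 [|j2 [|j3 [|j4 []]]]] //= um _.
rewrite !big_cons big_nil addr0 !addrA => e0.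
by have := th_four um; rewrite e0.
Qed.
End AtPoint.
End Octad.

(** * Kernels of symmetric pencils and homogeneity *)

Section KernelDerivative.
Variables (K : fieldType) (n : nat) (A B : 'M[K]_n) (v : 'rV[K]_n).
Hypothesis Asym : A^T = A.
Hypothesis v0 : v != 0.
Hypothesis vA : v *m A = 0.
Hypothesis kerA : forall u : 'rV_n, u *m A = 0 -> (u <= v)%MS.

(** The rows of the adjugate are in the kernel, and by symmetry so are the
    columns.  The coefficient does not vanish: if v_i is nonzero, the minor
    that omits i is invertible, since a kernel vector of it extends by 0 to a
    kernel vector of A. *)
Lemma adj_kernel : exists2 c, c != 0 & \adj A = c *: (v^T *m v).
Proof.
have /rV0Pn [i vi] := v0.
have dA : \det A = 0.
  by apply/eqP/det0P; exists v.
have ker j : exists c, row j (\adj A) = c *: v.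
  apply/sub_rVP; apply: kerA.
  by rewrite -row_mul mul_adj_mx dA -scalemx1 scale0r row0.
have [c ec] := ker i.
(* The entry at (j, k) is proportional to v_k along rows and to v_j along
   columns. *)
have asym : (\adj A)^T = \adj A by rewrite trmx_adj Asym.
have ent j k : \adj A j k = (c / v 0 i) * (v 0 j * v 0 k).
  have [d ed] := ker j.
  have e1 l : \adj A j l = d * v 0 l.
    by move/rowP/(_ l): ed; rewrite !mxE.
  have e2 l : \adj A i l = c * v 0 l.
    by move/rowP/(_ l): ec; rewrite !mxE.
  rewrite e1.
  have : d * v 0 i = c * v 0 j by rewrite -e1 -e2 -[in RHS]asym [RHS]mxE.
  move/(canRL (mulfK vi)) => ->; rewrite -!mulrA; congr (_ * _).
  by rewrite mulrCA.
exists (c / v 0 i); last first.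
  by apply/matrixP => j k; rewrite ent !mxE big_ord1 !mxE.
have : \adj A i i != 0.
  rewrite mxE /cofactor mulf_eq0 signr_eq0 /=.
  apply/det0P => - [u u0 eu].
  (* The extension of u by 0 at i. *)
  pose w : 'rV[K]_n := \row_j if unlift i j is Some k then u 0 k else 0.
  have wi : w 0 i = 0 by rewrite mxE unlift_none.
  have wl k : w 0 (lift i k) = u 0 k by rewrite mxE liftK.
  have wA j : j != i -> (w *m A) 0 j = 0.
    case: (unliftP i j) => [k -> _|->]; last by rewrite eqxx.
    rewrite mxE (bigD1_ord i) //= wi mul0r add0r.
    move/rowP/(_ k): eu; rewrite !mxE => eu; rewrite -[RHS]eu.
    by apply: eq_bigr => l _; rewrite wl !mxE.
  have wAi : (w *m A) 0 i = 0.
    have : (w *m A *m v^T) 0 0 = 0.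
      have Av : A *m v^T = 0 by rewrite -{1}Asym -trmx_mul vA trmx0.
      by rewrite -mulmxA Av mulmx0 mxE.
    rewrite mxE (bigD1 i) //= big1 => [|j ij]; last by rewrite wA ?mul0r.
    by rewrite addr0 [v^T _ _]mxE => /eqP; rewrite mulf_eq0 (negPf vi) orbF => /eqP.
  have /kerA /sub_rVP [d ed] : w *m A = 0.
    apply/rowP => j; rewrite [RHS]mxE; case: (eqVneq j i) => [->|]; [exact: wAi|exact: wA].
  have d0 : d = 0.
    move/rowP/(_ i): (ed); rewrite wi mxE => /esym/eqP.
    by rewrite mulf_eq0 (negPf vi) orbF => /eqP.
  case/negP: u0; apply/eqP/rowP => k; rewrite -wl ed d0 scale0r !mxE.
  by [].
by apply: contraNneq => c0; rewrite ent c0 mul0r.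
Qed.

(** The derivative of the determinant of A + t B at t = 0 is the trace of
    adj(A) B, that is, v B v^T up to a nonzero factor. *)
Lemma kernel_derivative :
  'X^2 %| \det (map_mx polyC A + 'X *: map_mx polyC B) ->
  (v *m B *m v^T) 0 0 = 0.
Proof.
set M := _ + _ => /dvdpP [k ek].
pose V := map_mx polyC v.
have eV : V *m M = 'X *: (V *m map_mx polyC B).
  by rewrite mulmxDr -map_mxM vA map_mx0 add0r -scalemxAr.
have e1 : V *m map_mx polyC B *m \adj M = (k * 'X) *: V.
  have e2 : 'X *: (V *m map_mx polyC B *m \adj M) = 'X *: ((k * 'X) *: V).
    rewrite scalemxAl -eV -mulmxA mul_mx_adj ek mul_mx_scalar scalerA.
    by congr (_ *: _); ring.
  apply/matrixP => i j; apply: (@mulfI _ ('X : {poly K})); first by rewrite polyX_eq0.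
  by move/matrixP/(_ i j): e2; rewrite [LHS]mxE [RHS]mxE.
have := congr1 (map_mx (horner_eval 0)) e1.
rewrite !map_mxM map_mx_adj map_mxZ /= /horner_eval hornerM hornerX mulr0 scale0r.
have hC m (C : 'M[K]_(m, n)) : map_mx (horner_eval 0) (map_mx polyC C) = C.
  by apply/matrixP => i j; rewrite !mxE /horner_eval hornerC.
have eM : map_mx (horner_eval 0) M = A.
  by apply/matrixP => i j; rewrite !mxE /horner_eval !hornerE.
rewrite !hC -/(horner_eval 0) eM.
have [c c0 ->] := adj_kernel.
rewrite -scalemxAr mulmxA => /eqP; rewrite scaler_eq0 (negPf c0) /=.
rewrite [v *m B *m v^T]mx11_scalar mul_scalar_mx scaler_eq0 (negPf v0) orbF.
by rewrite !mxE mulr1n => /eqP ->.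
Qed.
End KernelDerivative.

(** The coordinates are chosen so that the point (0 : 0 : 1) is not on the
    curve ([ev_quarticm_O]) and that the last two coordinates of each bitangent
    differ by 1 ([bitan_row_coord]). *)
Definition quarticm (R : comNzRingType) (a : nat -> R) : {mpoly R[3]} :=
  quartic (fun i => (a i)%:MP) 'X_(inord 2) ('X_(inord 1) + 'X_(inord 2)) 'X_(inord 0).

Lemma rmorph_quartic (R S : comNzRingType) (phi : {rmorphism R -> S}) a x y z :
  phi (quartic a x y z) = quartic (phi \o a) (phi x) (phi y) (phi z).
Proof.
by rewrite /quartic /= !(rmorph_nat, rmorphXn, rmorphM, rmorphN, rmorphB, rmorphD).
Qed.

Lemma rmorph_bitan (R S : comNzRingType) (phi : {rmorphism R -> S}) a u n x y z :
  phi (bitan a u n x y z) = bitan (phi \o a) (phi u) (phi n) (phi x) (phi y) (phi z).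
Proof.
by rewrite /bitan /= !(rmorph_nat, rmorphXn, rmorphM, rmorphN, rmorphB, rmorphD).
Qed.

Section HomogTools.
Variables (n : nat) (R : comNzRingType).
Implicit Types p q : {mpoly R[n]}.

Lemma homogD d p q : p \is d.-homog -> q \is d.-homog -> p + q \is d.-homog.
Proof. exact: rpredD. Qed.

Lemma homogB d p q : p \is d.-homog -> q \is d.-homog -> p - q \is d.-homog.
Proof. exact: rpredB. Qed.

Lemma homogM d e k p q : (d + e = k)%N ->
  p \is d.-homog -> q \is e.-homog -> p * q \is k.-homog.
Proof. by move=> <-; apply: dhomogM. Qed.

Lemma homogX1 i p : p \is 1.-homog -> p ^+ i \is i.-homog.
Proof. by move=> hp; rewrite -[X in X.-homog]mul1n; apply: dhomogMn. Qed.

Lemma homog0M p q : p \is 0.-homog -> q \is 0.-homog -> p * q \is 0.-homog.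
Proof. exact: homogM. Qed.

Lemma homog0X i p : p \is 0.-homog -> p ^+ i \is 0.-homog.
Proof. by move=> hp; rewrite -[X in X.-homog](mul0n i); apply: dhomogMn. Qed.

Lemma homogC c : (c%:MP : {mpoly R[n]}) \is 0.-homog.
Proof. by rewrite -[c%:MP]mulr1 mul_mpolyC; apply: dhomogZ; apply: dhomog1. Qed.

Lemma homog_nat i : (i%:R : {mpoly R[n]}) \is 0.-homog.
Proof. by rewrite -mpolyC_nat; apply: homogC. Qed.

Lemma homogU i : ('X_i : {mpoly R[n]}) \is 1.-homog.
Proof. by rewrite dhomogX /= mdeg1. Qed.
End HomogTools.

Ltac homog0 := repeat lazymatch goal with
  | |- is_true (in_mem (_ - _) _) => apply: homogB
  | |- is_true (in_mem (_ + _) _) => apply: homogD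
  | |- is_true (in_mem (_ * _) _) => apply: homog0M
  | |- is_true (in_mem (_ ^+ _) _) => apply: homog0X
  | |- is_true (in_mem (_%:MP) _) => exact: homogC
  | |- is_true (in_mem (_%:R) _) => exact: homog_nat
  end.
Ltac homog_cM d h := apply: (homogM (d := 0%N) (e := d)) h => //; homog0.

Lemma quarticm_homog (R : comNzRingType) (a : nat -> R) : quarticm a \is 4.-homog.
Proof.
rewrite /quarticm; set X := 'X_(inord 2); set Y := _ + X; set Z := 'X_(inord 0).
have hX : X \is 1.-homog by apply: homogU.
have hZ : Z \is 1.-homog by apply: homogU.
have hY : Y \is 1.-homog by apply: homogD => //; apply: homogU.
rewrite /quartic.
apply: homogD; last by apply: (homogM (d := 1%N)) (homogX1 3 hY) => //; homog_cM 1%N hX.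
apply: homogD; last first.
  apply: (homogM (d := 3%N)) hZ => //.
  by apply: (homogM (d := 1%N)) (homogX1 2 hY) => //; homog_cM 1%N hX.
apply: homogD; last first.
  apply: (homogM (d := 3%N)) hZ => //; apply: (homogM (d := 2%N)) hY => //.
  by homog_cM 2%N (homogX1 2 hX).
apply: homogD; last first.
  by apply: (homogM (d := 3%N)) hZ => //; homog_cM 3%N (homogX1 3 hX).
apply: homogD; last first.
  apply: (homogM (d := 2%N)) (homogX1 2 hZ) => //.
  by homog_cM 2%N (homogX1 2 hY).
apply: homogD; last first.
  apply: (homogM (d := 2%N)) (homogX1 2 hZ) => //.
  by apply: (homogM (d := 1%N)) hY => //; homog_cM 1%N hX.
apply: homogD; last first.
  apply: (homogM (d := 2%N)) (homogX1 2 hZ) => //.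
  by homog_cM 2%N (homogX1 2 hX).
apply: homogD; last first.
  by apply: (homogM (d := 1%N)) (homogX1 3 hZ) => //; homog_cM 1%N hY.
apply: homogD; last first.
  by apply: (homogM (d := 1%N)) (homogX1 3 hZ) => //; homog_cM 1%N hX.
by homog_cM 4%N (homogX1 4 hZ).
Qed.

Lemma steiner_homog (R : comNzRingType) (X Y Z : {mpoly R[3]})
    (v c2 c1 c0 d2 d1 d0 : R) :
    X \is 1.-homog -> Y \is 1.-homog -> Z \is 1.-homog ->
  [/\ steinerA v%:MP c2%:MP c1%:MP c0%:MP d2%:MP d1%:MP d0%:MP Y Z X \is 2.-homog,
      steinerB v%:MP c2%:MP c1%:MP c0%:MP d2%:MP d1%:MP d0%:MP Y Z X \is 2.-homog
    & steinerC v%:MP c2%:MP c1%:MP c0%:MP d2%:MP d1%:MP d0%:MP Y Z X \is 2.-homog].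
Proof.
move=> hX hY hZ; split; rewrite /steinerA /steinerB /steinerC.
- apply: homogD; last by homog_cM 2%N (homogX1 2 hZ).
  apply: homogD; last by apply: (homogM (d := 1%N)) hZ => //; homog_cM 1%N hY.
  apply: homogB; first exact: homogX1.
  by apply: (homogM (d := 1%N)) hZ => //; homog_cM 1%N hX.
- apply: homogD; last by homog_cM 2%N (homogX1 2 hZ).
  apply: homogD; last by apply: (homogM (d := 1%N)) hZ => //; homog_cM 1%N hY.
  apply: homogD; last by apply: (homogM (d := 1%N)) hZ => //; homog_cM 1%N hX.
  by apply: (homogM (d := 1%N)) hY => //; homog_cM 1%N hX.
- apply: homogD; last by homog_cM 2%N (homogX1 2 hZ).
  apply: homogD; last by apply: (homogM (d := 1%N)) hZ => //; homog_cM 1%N hX.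
  apply: homogB; first exact: homogX1.
  by apply: (homogM (d := 1%N)) hY => //; homog_cM 1%N hX.
Qed.

(** * Smoothness of the discriminant curve *)

Lemma sum3 (V : nmodType) (G : 'I_3 -> V) :
  \sum_i G i = G (inord 0) + G (inord 1) + G (inord 2).
Proof.
rewrite !big_ord_recl big_ord0 addr0 !addrA.
by congr (_ + _ + _); congr (G _); apply/val_inj; rewrite /= inordK.
Qed.

Section DerivRestr.
Variable K : closedFieldType.
Implicit Types (G : {mpoly K[3]}) (E O P : 'rV[K]_3).

Lemma deriv_restr E O G :
  (restr E O G)^`() = \sum_i O 0 i *: restr E O (G^`M(i)).
Proof.
pose D G := \sum_i O 0 i *: restr E O (G^`M(i)).
rewrite -/(D G).
have DM G1 G2 : (restr E O G1)^`() = D G1 -> (restr E O G2)^`() = D G2 ->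
    (restr E O (G1 * G2))^`() = D (G1 * G2).
  move=> e1 e2; rewrite rmorphM derivM e1 e2 /D mulr_suml mulr_sumr -big_split /=.
  apply: eq_bigr => i _; rewrite mderivM rmorphD !rmorphM /= scalerDr.
  by rewrite scalerAl scalerAr.
have D1 : (restr E O 1)^`() = D 1.
  rewrite rmorph1 derivC /D big1 // => i _.
  by rewrite -mpolyC1 mderivC rmorph0 scaler0.
elim/mpolyind: G => [|c m p _ _ IHp].
  by rewrite rmorph0 deriv0 /D big1 // => i _; rewrite mderiv0 rmorph0 scaler0.
rewrite rmorphD /= derivD IHp restrZ derivZ.
suff -> : (restr E O 'X_[m])^`() = D 'X_[m].
  rewrite /D scaler_sumr -big_split; apply: eq_bigr => i _ /=.
  by rewrite mderivD mderivZ rmorphD /= restrZ scalerDr !scalerA mulrC.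
rewrite mpolyXE_id; apply: (big_ind (fun G => (restr E O G)^`() = D G)) => //.
move=> i _; elim: (m i) => [|k IHk]; first by rewrite expr0.
rewrite exprS; apply: (DM) => //.
rewrite restrX derivD derivC add0r derivZ derivX /D (bigD1 i) //=.
rewrite big1 => [|j ji].
  rewrite addr0 mderivX mnm1E eqxx scale1r.
  have -> : (U_(i) - U_(i) = 0 :> 'X_{1..3})%MM.
    by apply/mnmP => j; rewrite mnmBE mnm0E subnn.
  by rewrite mpolyX0 rmorph1.
by rewrite mderivX mnm1E eq_sym (negPf ji) scale0r rmorph0 scaler0.
Qed.

(** The derivative of the restriction is a combination of the partial
    derivatives. *)
Lemma restr_singular G P O : ev G P = 0 -> grad G P = 0 -> 'X^2 %| restr P O G.
Proof.
move=> GP gP.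
have ev0 H : (restr P O H).[0] = ev H P by rewrite horner_restr scale0r addr0.
have /factor_theorem [q eq] : root (restr P O G) 0 by rewrite /root ev0 GP.
have : (restr P O G)^`().[0] = 0.
  rewrite deriv_restr horner_sum big1 // => i _; rewrite hornerZ ev0.
  by move/rowP/(_ i): gP; rewrite !mxE => ->; rewrite mulr0.
rewrite eq subr0 derivM derivX mulr1 hornerD hornerM hornerX mulr0 add0r.
move/eqP/factor_theorem => [r ->]; rewrite subr0 -mulrA -expr2.
exact: dvdp_mull.
Qed.
End DerivRestr.

Section SmoothQuartic.
Variable K : closedFieldType.
Hypothesis char2 : (2%:R : K) != 0.
Variable th : 'I_8 -> K.
Hypothesis th_inj : injective th.
Hypothesis th_sum : \sum_j th j = 0.
Hypothesis th_four : forall i j k l, uniq [:: i; j; k; l] ->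
  th i + th j + th k + th l != 0.
Local Notation a := (oct_coef th).
Local Notation F := (quarticm a).
Implicit Types (P E O : 'rV[K]_3) (u v w : 'rV[K]_4).

Definition netP P : 'M[K]_4 :=
  net a (P 0 (inord 2)) (P 0 (inord 1) + P 0 (inord 2)) (P 0 (inord 0)).

Definition pt (x y z : K) : 'rV[K]_3 := \row_j [:: z; y - x; x]`_j.

Lemma netP_pt x y z : netP (pt x y z) = net a x y z.
Proof. by rewrite /netP !mxE !inordK //= subrK. Qed.

Lemma netP_sym P : (netP P)^T = netP P. Proof. exact: net_sym. Qed.

Lemma netP_nz P : P != 0 -> ~ [/\ P 0 (inord 2) = 0,
  P 0 (inord 1) + P 0 (inord 2) = 0 & P 0 (inord 0) = 0].
Proof.
move=> P0 [x y z]; case/negP: P0; rewrite x addr0 in y.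
apply/eqP/rowP => i; rewrite [RHS]mxE.
rewrite -[i]inord_val; case: i => [[|[|[]]]] //=.
Qed.

Lemma netPD E O t : netP (E + t *: O) = netP E + t *: netP O.
Proof.
apply/matrixP => i j; rewrite !mxE.
by case: i j => [[|[|[|[|[]]]]] // hi] [[|[|[|[|[]]]]] // hj] /=; ring.
Qed.

Lemma ev_quarticm P : ev F P = \det (netP P).
Proof.
rewrite det_net /quarticm /ev rmorph_quartic /= rmorphD /= !mevalXU.
by rewrite /quartic /= !mevalC.
Qed.

Lemma restr_quarticm E O :
  restr E O F = \det (map_mx polyC (netP E) + 'X *: map_mx polyC (netP O)).
Proof.
rewrite /quarticm rmorph_quartic /= rmorphD /= !restrX -det_net; congr (\det _).
apply/matrixP => i j; rewrite !mxE /= !restrC.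
case: i j => [[|[|[|[|[]]]]] // hi] [[|[|[|[|[]]]]] // hj] /=;
  rewrite -?mul_polyC ?(rmorphD, rmorphM, rmorphN, rmorph_nat) /=; ring.
Qed.

Lemma netP_rank P : P != 0 -> (3 <= \rank (netP P))%N.
Proof. by move=> /netP_nz; apply: net_rank. Qed.

Lemma netP_kernel P v : P != 0 -> v != 0 -> v *m netP P = 0 ->
  forall u, u *m netP P = 0 -> (u <= v)%MS.
Proof.
move=> P0 v0 vN u uN.
have sub : (v <= kermx (netP P))%MS by apply/sub_kermxP.
have : (kermx (netP P) <= v)%MS.
  rewrite -(geq_leqif (mxrank_leqif_sup sub)) mxrank_ker rank_rV v0.
  by rewrite leq_subLR addnC (leq_add2l 1) netP_rank.
by apply: submx_trans; apply/sub_kermxP.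
Qed.

Lemma netP_transversal j P : P != 0 -> quart_pt (th j) *m netP P != 0.
Proof.
move=> P0; apply/eqP => /(net_transversal th_inj th_sum) h.
exact: (netP_nz P0 h).
Qed.

(** The first two quadrics put the point on the rational curve, and the third
    makes its parameter a root of the octic. *)
Lemma base_point v : v != 0 ->
    (forall P, (v *m netP P *m v^T) 0 0 = 0) ->
  exists c j, c != 0 /\ v = c *: quart_pt (th j).
Proof.
move=> v0 h.
have bE x y z := net_bilE a x y z v v.
have {}h x y z : (v *m net a x y z *m v^T) 0 0 = 0 by rewrite -netP_pt h.
have e1 := h 1 0 0; have e2 := h 0 1 0; have e3 := h 0 0 1.
rewrite !bE !(mulr0, mul0r, addr0, add0r, subr0, mulr1, mul1r) in e1 e2 e3.
have q1 : v 0 o0 * v 0 o2 = v 0 o1 ^+ 2.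
  apply/eqP; rewrite -subr_eq0; apply/eqP; apply: (mulfI char2).
  by rewrite mulr0 -[RHS]e1; ring.
have q2 : v 0 o2 ^+ 2 = v 0 o0 * v 0 o3.
  apply/eqP; rewrite -subr_eq0; apply/eqP; apply: (mulfI char2).
  by rewrite mulr0 -[RHS]e2; ring.
have vE (i : 'I_4) : v 0 i = [:: v 0 o0; v 0 o1; v 0 o2; v 0 o3]`_i.
  by case: i => [[|[|[|[|[]]]]] // hi] /=; congr (v 0 _); apply/val_inj.
have [z0|nz0] := eqVneq (v 0 o0) 0.
  have z1 : v 0 o1 = 0 by apply/eqP; rewrite -sqrf_eq0 -q1 z0 mul0r.
  have z2 : v 0 o2 = 0 by apply/eqP; rewrite -sqrf_eq0 q2 z0 mul0r.
  have z3 : v 0 o3 = 0.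
    apply/eqP; rewrite -sqrf_eq0; apply/eqP; apply: (mulfI char2).
    by rewrite mulr0 -[RHS]e3 z0 z1 z2; ring.
  case/negP: v0; apply/eqP/rowP => i; rewrite vE z0 z1 z2 z3 mxE.
  by case: i => [[|[|[|[|[]]]]]].
pose t := v 0 o1 / v 0 o0.
have t1 : v 0 o1 = v 0 o0 * t by rewrite mulrC divfK.
have t2 : v 0 o2 = v 0 o0 * t ^+ 2.
  by apply: (mulfI nz0); rewrite q1 t1; ring.
have t4 : v 0 o3 = v 0 o0 * t ^+ 4.
  by apply: (mulfI nz0); rewrite -q2 t2; ring.
have ev : v = v 0 o0 *: quart_pt t.
  apply/rowP => i; rewrite {1}vE !mxE t1 t2 t4.
  by case: i => [[|[|[|[|[]]]]]] //= _; rewrite ?mulr1.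
have : root (octic th) t.
  apply/eqP; apply: (mulfI char2); apply: (mulfI (expf_neq0 2 nz0)).
  by rewrite !mulr0 (hornerE_octic th_sum) -[RHS]e3 t1 t2 t4; ring.
by case/root_octic => j tj; exists (v 0 o0), j; rewrite -tj.
Qed.

(** At a singular point, the kernel of the quadric is isotropic for the whole
    net by [kernel_derivative], hence it is a base point.  But no quadric of
    the net is singular at a base point. *)
Theorem quarticm_smooth : smooth_curve F.
Proof.
move=> P [P0 FP]; apply/eqP => gP.
have /eqP/det0P [v v0 vN] : \det (netP P) = 0 by rewrite -ev_quarticm.
have ker := netP_kernel P0 v0 vN.
have [c [j [c0 ev]]] : exists c j, c != 0 /\ v = c *: quart_pt (th j).
  apply: (base_point v0) => O.
  apply: (kernel_derivative (netP_sym P) v0 vN ker).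
  by rewrite -restr_quarticm; apply: restr_singular.
case/eqP: (netP_transversal j P0); apply: (scalerI c0).
by rewrite scalemxAl -ev vN scaler0.
Qed.
End SmoothQuartic.

(** * Conics through the contact points of a tetrad *)

Section BitangentForms.
Variable R : comNzRingType.
Implicit Types (a : nat -> R).

(** The coefficients of [bitan] in the coordinates of [quarticm]. *)
Definition bitan_row a (u n : R) : 'rV[R]_3 :=
  \row_j [:: bitan a u n 0 0 1; - u ^+ 2; 1 - u ^+ 2]`_j.

Definition bitanm a (u n : R) : {mpoly R[3]} :=
  bitan (fun i => (a i)%:MP) u%:MP n%:MP
    'X_(inord 2) ('X_(inord 1) + 'X_(inord 2)) 'X_(inord 0).

Lemma rmorph_prod_coef (S : comNzRingType) (phi : {rmorphism R -> S})
    v c2 c1 c0 d2 d1 d0 i :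
  phi (prod_coef v c2 c1 c0 d2 d1 d0 i) =
  prod_coef (phi v) (phi c2) (phi c1) (phi c0) (phi d2) (phi d1) (phi d0) i.
Proof.
rewrite /prod_coef; case: i => [|[|[|[|[|[|[|i]]]]]]];
  rewrite /= ?(rmorphXn, rmorphM, rmorphN, rmorphB, rmorphD) //.
by rewrite !nth_nil rmorph0.
Qed.

Lemma eq_quartic a b x y z : (forall i, (i < 7)%N -> a i = b i) ->
  quartic a x y z = quartic b x y z.
Proof.
by move=> h; rewrite /quartic !(h 0%N, h 1%N, h 2%N, h 3%N, h 4%N, h 5%N, h 6%N).
Qed.

Lemma eq_bitan a b u n x y z : (forall i, (i < 7)%N -> a i = b i) ->
  bitan a u n x y z = bitan b u n x y z.
Proof. by move=> h; rewrite /bitan !(h 3%N, h 4%N, h 5%N, h 6%N). Qed.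

(** The two factors of the octic play symmetric roles. *)
Lemma prod_coef_swap (v c2 c1 c0 d2 d1 d0 : R) :
  prod_coef v c2 c1 c0 d2 d1 d0 =1 prod_coef (- v) d2 (- d1) d0 c2 (- c1) c0.
Proof.
move=> i; rewrite /prod_coef.
by case: i => [|[|[|[|[|[|[|i]]]]]]] /=; try ring; rewrite !nth_nil.
Qed.

Lemma steiner_swap (v c2 c1 c0 d2 d1 d0 y z x : R) :
  [/\ steinerA (- v) d2 (- d1) d0 c2 (- c1) c0 y z x
      = steinerA v c2 c1 c0 d2 d1 d0 y z x,
      steinerB (- v) d2 (- d1) d0 c2 (- c1) c0 y z x
      = steinerB v c2 c1 c0 d2 d1 d0 y z x
    & steinerC (- v) d2 (- d1) d0 c2 (- c1) c0 y z x
      = steinerC v c2 c1 c0 d2 d1 d0 y z x].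
Proof. by rewrite /steinerA /steinerB /steinerC; split; ring. Qed.
End BitangentForms.

Lemma linform_bitan (K : closedFieldType) a (u n : K) :
  linform (bitan_row a u n) = bitanm a u n.
Proof.
rewrite /linform sum3 !mxE !inordK //= /bitanm /bitan.
rewrite -!mul_mpolyC !(rmorphXn, rmorphM, rmorphN, rmorphB, rmorphD, rmorph_nat) /=.
rewrite !rmorph0 !rmorph1 /=.
by ring.
Qed.

Section Tetrads.
Variable K : closedFieldType.
Hypothesis char2 : (2%:R : K) != 0.
Variable th : 'I_8 -> K.
Hypothesis th_inj : injective th.
Hypothesis th_sum : \sum_j th j = 0.
Hypothesis th_four : forall i j k l, uniq [:: i; j; k; l] ->
  th i + th j + th k + th l != 0.
Local Notation a := (oct_coef th).
Local Notation F := (quarticm a).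

Definition ell i j := linform (bitan_row a (th i + th j) (th i * th j)).

Let e1 (t1 t2 t3 t4 : K) := t1 + t2 + t3 + t4.
Let e2 (t1 t2 t3 t4 : K) := t1 * t2 + t3 * t4 + (t1 + t2) * (t3 + t4).
Let e3 (t1 t2 t3 t4 : K) := (t1 + t2) * (t3 * t4) + (t3 + t4) * (t1 * t2).
Let e4 (t1 t2 t3 t4 : K) := t1 * t2 * (t3 * t4).

(** The octic is the product of its two quartic factors, whose cubic
    coefficients are opposite since the eight parameters have sum 0. *)
Lemma oct_coef_split j1 j2 j3 j4 j5 j6 j7 j8 :
    uniq [:: j1; j2; j3; j4; j5; j6; j7; j8] ->
  e1 (th j5) (th j6) (th j7) (th j8) = - e1 (th j1) (th j2) (th j3) (th j4) /\
  forall i, (i < 7)%N -> a i =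
    prod_coef (e1 (th j1) (th j2) (th j3) (th j4))
      (e2 (th j1) (th j2) (th j3) (th j4)) (e3 (th j1) (th j2) (th j3) (th j4))
      (e4 (th j1) (th j2) (th j3) (th j4)) (e2 (th j5) (th j6) (th j7) (th j8))
      (- e3 (th j5) (th j6) (th j7) (th j8)) (e4 (th j5) (th j6) (th j7) (th j8)) i.
Proof.
set s := [:: _; _; _; _; _; _; _; _] => us.
have ps : perm_eq (index_enum 'I_8) s.
  apply: uniq_perm; rewrite ?index_enum_uniq // => j.
  rewrite mem_index_enum; apply/esym.
  have sub : {subset s <= enum 'I_8} by move=> x _; rewrite mem_enum.
  have [|_ ->] := uniq_min_size us sub; first by rewrite size_enum_ord.
  by rewrite mem_enum.
have := th_sum; rewrite (perm_big s) //= !big_cons big_nil addr0 => es.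
have e5 : e1 (th j5) (th j6) (th j7) (th j8) = - e1 (th j1) (th j2) (th j3) (th j4).
  by apply/eqP; rewrite -addr_eq0 -[X in _ == X]es /e1; apply/eqP; ring.
split=> // i i7.
have : octic th = \prod_(j <- s) ('X - (th j)%:P) by rewrite /octic (perm_big s).
rewrite !big_cons big_nil mulr1.
move: e5; rewrite /a /oct_coef.
move: (th j1) (th j2) (th j3) (th j4) (th j5) (th j6) (th j7) (th j8).
move=> t1 t2 t3 t4 t5 t6 t7 t8 e5 eo.
pose v := e1 t1 t2 t3 t4.
pose k := prod_coef v (e2 t1 t2 t3 t4) (e3 t1 t2 t3 t4) (e4 t1 t2 t3 t4)
  (e2 t5 t6 t7 t8) (- e3 t5 t6 t7 t8) (e4 t5 t6 t7 t8).
rewrite -/v -/(k i).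
have f1 : ('X - t1%:P) * ('X - t2%:P) * ('X - t3%:P) * ('X - t4%:P)
   = 'X^4 - v%:P * 'X^3 + (e2 t1 t2 t3 t4)%:P * 'X^2
     - (e3 t1 t2 t3 t4)%:P * 'X + (e4 t1 t2 t3 t4)%:P.
  by rewrite /v /e1 /e2 /e3 /e4 !(rmorphD, rmorphM) /=; ring.
have f2 : ('X - t5%:P) * ('X - t6%:P) * ('X - t7%:P) * ('X - t8%:P)
   = 'X^4 + v%:P * 'X^3 + (e2 t5 t6 t7 t8)%:P * 'X^2
     - (e3 t5 t6 t7 t8)%:P * 'X + (e4 t5 t6 t7 t8)%:P.
  have -> : v = - e1 t5 t6 t7 t8 by rewrite e5 opprK.
  by rewrite /e1 /e2 /e3 /e4 !(rmorphN, rmorphD, rmorphM) /=; ring.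
have -> : octic th = 'X^8 + (k 6%N)%:P * 'X^6 + (k 5%N)%:P * 'X^5
  + (k 4%N)%:P * 'X^4 + (k 3%N)%:P * 'X^3 + (k 2%N)%:P * 'X^2
  + (k 1%N)%:P * 'X + (k 0%N)%:P.
  rewrite eo !mulrA f1 -!mulrA [X in _ * X]mulrA [X in _ * X]mulrA f2.
  rewrite /k !(rmorph_prod_coef (@polyC K)) /prod_coef /= !polyCN.
  by ring.
move: k {f1 f2 eo} => k.
case: i i7 => [|[|[|[|[|[|[|i]]]]]]] // _;
  rewrite !coefD !coefCM coefC coefX !coefXn /=; ring.
Qed.

Let X2 : {mpoly K[3]} := 'X_(inord 2).
Let Y2 : {mpoly K[3]} := 'X_(inord 1) + 'X_(inord 2).
Let Z2 : {mpoly K[3]} := 'X_(inord 0).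

(** The first two values of the pencil come from two pairings of the first four
    points, the third one from a pairing of the other four. *)
Lemma steiner_pencil j1 j2 j3 j4 j5 j6 j7 j8 :
    uniq [:: j1; j2; j3; j4; j5; j6; j7; j8] ->
  exists A B C v, let q m := A * m%:MP ^+ 2 + B * m%:MP + C in
    [/\ [/\ A \is 2.-homog, B \is 2.-homog & C \is 2.-homog],
        v != 0, B ^+ 2 - 4 * A * C = (v ^+ 2)%:MP * F
      & [/\ ell j1 j2 * ell j3 j4 = q ((th j1 + th j2) * (th j3 + th j4)),
            ell j2 j3 * ell j4 j1 = q ((th j2 + th j3) * (th j4 + th j1))
          & ell j5 j6 * ell j7 j8 = q ((th j5 + th j6) * (th j7 + th j8))]].
Proof.
move=> us; have [e5 ha] := oct_coef_split us.
have v0 : e1 (th j1) (th j2) (th j3) (th j4) != 0.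
  by apply: th_four; move: us; rewrite -[X in uniq X]/([:: j1; j2; j3; j4] ++ _) cat_uniq => /andP [].
move: v0 e5 ha; rewrite /ell !linform_bitan /bitanm {us}.
move: (th j1) (th j2) (th j3) (th j4) (th j5) (th j6) (th j7) (th j8).
move=> t1 t2 t3 t4 t5 t6 t7 t8.
set v := e1 t1 t2 t3 t4; set c2 := e2 t1 t2 t3 t4; set c1 := e3 t1 t2 t3 t4.
set c0 := e4 t1 t2 t3 t4; set d2 := e2 t5 t6 t7 t8; set d1 := - e3 t5 t6 t7 t8.
set d0 := e4 t5 t6 t7 t8 => v0 e5 ha.
pose A := steinerA v%:MP c2%:MP c1%:MP c0%:MP d2%:MP d1%:MP d0%:MP Y2 Z2 X2.
pose B := steinerB v%:MP c2%:MP c1%:MP c0%:MP d2%:MP d1%:MP d0%:MP Y2 Z2 X2.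
pose C := steinerC v%:MP c2%:MP c1%:MP c0%:MP d2%:MP d1%:MP d0%:MP Y2 Z2 X2.
have haM i : (i < 7)%N -> (a i)%:MP =
    prod_coef v%:MP c2%:MP c1%:MP c0%:MP d2%:MP d1%:MP d0%:MP i :> {mpoly K[3]}.
  by move=> i7; rewrite ha // (rmorph_prod_coef (@mpolyC 3 K)).
have hX : X2 \is 1.-homog by apply: homogU.
have hZ : Z2 \is 1.-homog by apply: homogU.
have hY : Y2 \is 1.-homog by apply: homogD; apply: homogU.
exists A, B, C, v; split=> //; first exact: steiner_homog.
  rewrite rmorphXn /=; apply: etrans (steiner_disc _ _ _ _ _ _ _ _ _ _) _.
  by congr (_ * _); exact: esym (eq_quartic _ _ _ haM).
have pair s1 s2 s3 s4 : e1 s1 s2 s3 s4 = v -> e2 s1 s2 s3 s4 = c2 ->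
    e3 s1 s2 s3 s4 = c1 -> e4 s1 s2 s3 s4 = c0 ->
    bitan (fun i => (a i)%:MP) (s1 + s2)%:MP (s1 * s2)%:MP X2 Y2 Z2
    * bitan (fun i => (a i)%:MP) (s3 + s4)%:MP (s3 * s4)%:MP X2 Y2 Z2
    = A * ((s1 + s2) * (s3 + s4))%:MP ^+ 2 + B * ((s1 + s2) * (s3 + s4))%:MP + C.
  move=> ev ec2 ec1 ec0; rewrite !(eq_bitan _ _ _ _ _ haM).
  rewrite /A /B /C -ev -ec2 -ec1 -ec0 /e1 /e2 /e3 /e4.
  rewrite -[s1 + s2 + s3 + s4]addrA !(rmorphD, rmorphM) /=.
  exact: bitan_pair_steiner.
split.
- exact: pair.
- by apply: pair; rewrite /v /c2 /c1 /c0 /e1 /e2 /e3 /e4; ring.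
have [sA sB sC] := steiner_swap v%:MP c2%:MP c1%:MP c0%:MP d2%:MP d1%:MP d0%:MP Y2 Z2 X2.
rewrite /A /B /C -sA -sB -sC.
have haM' i : (i < 7)%N -> (a i)%:MP = prod_coef (- v%:MP) d2%:MP (- d1%:MP)
    d0%:MP c2%:MP (- c1%:MP) c0%:MP i :> {mpoly K[3]}.
  by move=> i7; rewrite haM // prod_coef_swap.
rewrite !(eq_bitan _ _ _ _ _ haM').
have -> : - v%:MP = (t5 + t6)%:MP + (t7 + t8)%:MP :> {mpoly K[3]}.
  by rewrite -rmorphN -e5 /e1 -addrA rmorphD.
rewrite -rmorphN /d1 opprK /d2 /d0 /e2 /e3 /e4 !(rmorphD, rmorphM) /=.
exact: bitan_pair_steiner.
Qed.

Lemma th_diff i j : i != j -> th i - th j != 0.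
Proof. by move=> ij; rewrite subr_eq0 (inj_eq th_inj). Qed.

(** For q(m) = A m^2 + B m + C, the polarization Q = 2 A m m' + B (m + m') + 2
    C satisfies Q^2 - 4 q(m) q(m') = (m - m')^2 (B^2 - 4 A C). *)
Lemma pencil_square (A B C l1 l2 l3 l4 : {mpoly K[3]}) (m m' v : K) :
  B ^+ 2 - 4 * A * C = (v ^+ 2)%:MP * F ->
  l1 * l2 = A * m%:MP ^+ 2 + B * m%:MP + C ->
  l3 * l4 = A * m'%:MP ^+ 2 + B * m'%:MP + C ->
  ((m - m') ^+ 2 * v ^+ 2)%:MP * F
  = (2 * A * m%:MP * m'%:MP + B * (m%:MP + m'%:MP) + 2 * C) ^+ 2
    - l1 * (4 * l2 * (l3 * l4)).
Proof.
move=> eF e12 e34; rewrite rmorphM /= -mulrA -eF e34.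
have -> : l1 * (4 * l2 * (A * m'%:MP ^+ 2 + B * m'%:MP + C))
  = 4 * (l1 * l2) * (A * m'%:MP ^+ 2 + B * m'%:MP + C) by ring.
by rewrite e12 rmorphXn rmorphB /=; ring.
Qed.

Lemma pencil_conic_homog (A B C : {mpoly K[3]}) (m m' : K) :
    A \is 2.-homog -> B \is 2.-homog -> C \is 2.-homog ->
  2 * A * m%:MP * m'%:MP + B * (m%:MP + m'%:MP) + 2 * C \is 2.-homog.
Proof.
move=> hA hB hC; have h2 : (2 : {mpoly K[3]}) \is 0.-homog by apply: homog_nat.
apply: homogD; last exact: (homogM (d := 0%N)).
apply: homogD; last first.
  rewrite -mpolyCD mulrC.
  by apply: (homogM (d := 0%N)) => //; apply: homogC.
apply: (homogM (e := 0%N) (d := 2)) => //; last exact: homogC.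
apply: (homogM (e := 0%N) (d := 2)) => //; last exact: homogC.
exact: (homogM (d := 0%N)).
Qed.

(** Two pairings of the same quadruple; their parameters differ by the product
    of two differences of the t_j. *)
Lemma cycle_conic j1 j2 j3 j4 : uniq [:: j1; j2; j3; j4] ->
  exists c Q, [/\ c != 0, Q \is 2.-homog & c%:MP * F
    = Q ^+ 2 - ell j1 j2 * (4 * ell j3 j4 * (ell j2 j3 * ell j4 j1))].
Proof.
move=> us; have [s ps] : exists s, perm_eq (enum 'I_8) ([:: j1; j2; j3; j4] ++ s).
  pose p i := i \in [:: j1; j2; j3; j4].
  exists [seq i <- enum 'I_8 | ~~ p i].
  rewrite -(perm_filterC p (enum 'I_8)) perm_cat2r.
  apply: uniq_perm; [by rewrite filter_uniq -?enumT ?enum_uniq | by [] | move=> i].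
  by rewrite mem_filter -?enumT mem_enum andbT.
have := perm_size ps; rewrite size_cat size_enum_ord /=.
have := enum_uniq 'I_8; rewrite (perm_uniq ps).
case: s {ps} => [|j5 [|j6 [|j7 [|j8 []]]]] // us8 _.
have [A [B [C [v /= [[hA hB hC] v0 eF [e12 e23 _]]]]]] := steiner_pencil us8.
have e := pencil_square eF e12 e23; do 2!eexists; split; last exact: e.
  rewrite mulf_neq0 // sqrf_eq0 //.
  rewrite (_ : _ - _ = (th j1 - th j3) * (th j4 - th j2)); last by ring.
  move: us; rewrite /= !inE !negb_or => /and4P [/and3P [_ n13 _] /andP [_ n24] _ _].
  by rewrite mulf_neq0 // th_diff // eq_sym.
exact: pencil_conic_homog.
Qed.

(** A pairing of each quadruple; their parameters differ by a product of two
    sums of four of the t_j. *)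
Lemma matching_conic j1 j2 j3 j4 j5 j6 j7 j8 :
    uniq [:: j1; j2; j3; j4; j5; j6; j7; j8] ->
  exists c Q, [/\ c != 0, Q \is 2.-homog & c%:MP * F
    = Q ^+ 2 - ell j1 j2 * (4 * ell j3 j4 * (ell j5 j6 * ell j7 j8))].
Proof.
move=> us8; have [e5 _] := oct_coef_split us8.
have [A [B [C [v /= [[hA hB hC] v0 eF [e12 _ e56]]]]]] := steiner_pencil us8.
have e := pencil_square eF e12 e56; do 2!eexists; split; last exact: e.
  rewrite mulf_neq0 // sqrf_eq0 //.
  have -> : (th j1 + th j2) * (th j3 + th j4) - (th j5 + th j6) * (th j7 + th j8)
      = (th j1 + th j2 + th j5 + th j6) * (th j3 + th j4 + th j5 + th j6).
    have -> : th j8 = - (th j1 + th j2 + th j3 + th j4) - th j5 - th j6 - th j7.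
      by rewrite -[th j1 + _ + _ + _]/(e1 _ _ _ _) -e5 /e1; ring.
    by ring.
  rewrite mulf_neq0 // th_four //.
    apply: subseq_uniq us8; rewrite -[X in subseq X _]/(mask [:: true; true; false; false; true; true] [:: j1; j2; j3; j4; j5; j6; j7; j8]).
    exact: mask_subseq.
  apply: subseq_uniq us8; rewrite -[X in subseq X _]/(mask [:: false; false; true; true; true; true] [:: j1; j2; j3; j4; j5; j6; j7; j8]).
  exact: mask_subseq.
exact: pencil_conic_homog.
Qed.
End Tetrads.

(** * Intersection multiplicities with lines *)

Section LineOrder.
Variable K : closedFieldType.
Implicit Types (G : {mpoly K[3]}) (P E O L M N : 'rV[K]_3).

Lemma hlift_pow (mu nu : {mpoly K[3]}) d r t (w : {poly K}) : (size w <= d.+1)%N ->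
  hlift mu nu (r + d) (('X - t%:P) ^+ r * w) = (nu - t *: mu) ^+ r * hlift mu nu d w.
Proof.
elim: r => [|r IHr] sw; first by rewrite add0n !expr0 !mul1r.
rewrite !exprS -!mulrA -IHr // addSn.
rewrite {1}(_ : 'X - t%:P = (- t)%:P + 1 *: 'X); last by rewrite scale1r addrC polyCN.
rewrite hliftS; first by congr (_ * _); rewrite scale1r scaleNr addrC.
rewrite (leq_trans (size_polyMleq _ _)) //.
by rewrite size_exp_XsubC addSn /= -addnS leq_add2l.
Qed.

Lemma ev_hlift (mu nu : {mpoly K[3]}) d (w : {poly K}) P t :
    (size w <= d.+1)%N -> ev mu P = 1 -> ev nu P = t ->
  ev (hlift mu nu d w) P = w.[t].
Proof.
move=> sw m1 nt; rewrite (horner_coef_wide _ sw) /hlift /ev rmorph_sum.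
apply: eq_bigr => j _ /=; rewrite -[LHS]/(ev (_ *: _) P) !evE m1 nt.
by rewrite expr1n mul1r.
Qed.

Lemma ev_linform_line L E O t :
  ev (linform L) (E + t *: O) = ev (linform L) E + t * ev (linform L) O.
Proof.
by rewrite -horner_restr restr_linform hornerD hornerC hornerZ hornerX mulrC.
Qed.

Variable F : {mpoly K[3]}.
Hypothesis hF : F \is 4.-homog.
Hypothesis smF : smooth_curve F.
Variables E O L : 'rV[K]_3.
Hypothesis E0 : E != 0.
Hypothesis OE : ~~ (O <= E)%MS.
Hypothesis LE : ev (linform L) E = 0.
Hypothesis LO : ev (linform L) O = 0.
Hypothesis L0 : L != 0.

(** The order of a line at a point of the curve is the multiplicity r of the
    root of the restriction of F.  Indeed F = m^r W modulo L, where m is the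
    line through the point that vanishes at t and O.  For r > 1 the line L is
    the tangent line and m is a uniformizer; for r = 1 the line L itself is
    one. *)
Lemma line_order r t (w : {poly K}) : (size w <= 5 - r)%N -> (0 < r <= 4)%N -> w.[t] != 0 ->
    restr E O F = ('X - t%:P) ^+ r * w ->
  on_curve F (E + t *: O) /\ ordP F (E + t *: O) (linform L) r.
Proof.
move=> sw /andP [r0 r4] wt e; set P : 'rV[K]_3 := E + t *: O.
have [M [N [ME MO NE NO]]] := line_coords E0 OE.
have [B eB] := line_modulo E0 LE LO L0 hF ME MO NE NO.
have sw' : (size w <= (4 - r).+1)%N by rewrite -subSn.
rewrite e -{1}(subnKC r4) hlift_pow // in eB.
pose m := N - t *: M; pose W := hlift (linform M) (linform N) (4 - r) w.
have em : linform N - t *: linform M = linform m.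
  by rewrite /m linformD -[in RHS]scaleNr linformZ scaleNr.
rewrite em -/W in eB; move/eqP: eB; rewrite subr_eq => /eqP eB.
have MP : ev (linform M) P = 1 by rewrite ev_linform_line ME MO mulr0 addr0.
have NP : ev (linform N) P = t by rewrite ev_linform_line NE NO mulr1 add0r.
have LP : ev (linform L) P = 0 by rewrite ev_linform_line LE LO mulr0 addr0.
have mP : ev (linform m) P = 0 by rewrite -em !evE MP NP mulr1 subrr.
have mO : ev (linform m) O = 1 by rewrite -em !evE MO NO mulr0 subr0.
have WP : ev W P = w.[t] by apply: ev_hlift.
have P0 : P != 0.
  apply: contra_eq_neq MP => ->; rewrite ev_linform big1 1?eq_sym ?oner_eq0 //.
  by move=> j _; rewrite mxE mulr0.
have PF : on_curve F P.
  split=> //; rewrite eB !evE LP mulr0 add0r mP.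
  by case: (r) r0 => // s _; rewrite expr0n mul0r.
split=> //.
have gF : grad F P = ev B P *: L + (ev W P * (r == 1)%:R) *: m.
  rewrite eB gradD !gradM !grad_linform LP scale0r add0r; congr (_ + _).
  case: (r) r0 => [|[|s]] // _.
    by rewrite expr1 grad_linform mP scale0r addr0 mulr1.
  rewrite exprSr gradM !evE mP expr0n /=.
  by rewrite !(mulr0, mul0r, scale0r, scaler0, addr0).
have gO x : ev (linform (x *: grad F P)) O = x * (ev W P * (r == 1)%:R).
  by rewrite gF linformZ linformD !linformZ !evE LO mO mulr0 add0r mulr1.
have [r1|r1] := eqVneq r 1%N.
  rewrite r1; exists L; last by rewrite expr1; apply: assoc_at_refl.
  split=> //; apply/sub_rVP => -[x ex]; case/negP: L0.
  have := gO x; rewrite -ex LO r1 mulr1 => /esym/eqP.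
  by rewrite mulf_eq0 WP (negbTE wt) orbF ex => /eqP ->; rewrite scale0r.
exists m.
  split=> //; apply/sub_rVP => -[x ex].
  by have := gO x; rewrite -ex mO (negbTE r1) !mulr0 => /eqP; rewrite oner_eq0.
exists B, (- W), 1; split.
- have := smF PF; apply: contraNneq => BP.
  by rewrite gF BP scale0r add0r (negbTE r1) mulr0 scale0r.
- by rewrite evN WP oppr_eq0.
by rewrite eB; ring.
Qed.
End LineOrder.

Lemma even_halves (T : eqType) (s : seq T) :
  (forall x, ~~ odd (count_mem x s)) -> exists s', perm_eq s (s' ++ s').
Proof.
have [n] := ubnP (size s); elim: n s => // n IHn [|x s] /= sn ev.
  by exists [::].
have xs : x \in s.
  rewrite -has_pred1 has_count lt0n; apply: contraNneq (ev x) => ->.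
  by rewrite eqxx.
have [||s' ps'] := IHn (rem x s).
- by rewrite size_rem //; case: (s) xs sn => //= y s0 _; rewrite ltnS => /ltnW.
- move=> y; have := ev y; rewrite (seq.permP (perm_to_rem xs)) /= addnA.
  by rewrite oddD; case: (x == y).
exists (x :: s'); rewrite /= perm_cons (perm_trans (perm_to_rem xs)) //.
by rewrite perm_sym perm_catC /= perm_cons perm_sym.
Qed.

Lemma even_roots_square (K : closedFieldType) (h : {poly K}) : h != 0 ->
    (forall t r (w : {poly K}), h = ('X - t%:P) ^+ r * w -> w.[t] != 0 -> ~~ odd r) ->
  exists c (s : seq K), c != 0 /\ h = c *: (\prod_(z <- s) ('X - z%:P)) ^+ 2.
Proof.
move=> h0 ev; have [s es] := closed_field_poly_normal h.
have c0 : lead_coef h != 0 by rewrite lead_coef_eq0.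
have [t|s' ps] := @even_halves _ s.
  have := ev t (count_mem t s)
    (lead_coef h *: \prod_(z <- s | z != t) ('X - z%:P)); apply.
    rewrite {1}es (bigID (pred1 t)) /= scalerAr; congr (_ * _).
    rewrite (eq_bigr (fun=> 'X - t%:P)) => [|z /eqP -> //].
    rewrite big_const_seq.
    by elim: (count _ _) => [|r IHr] //=; rewrite exprS IHr.
  rewrite hornerZ mulf_neq0 // horner_prod prodf_seq_neq0.
  by apply/allP => z _; apply/implyP => zt; rewrite hornerXsubC subr_eq0 eq_sym.
exists (lead_coef h), s'; split=> //.
by rewrite {1}es (perm_big _ ps) big_cat expr2.
Qed.

(** * Every bitangent comes from a pair of base points *)

Lemma bitan_row_neq0 (R : comNzRingType) (c : nat -> R) u n : bitan_row c u n != 0.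
Proof.
apply/eqP => B0; have /eqP := oner_neq0 R; apply.
have -> : 1 = bitan_row c u n 0 (inord 2) - bitan_row c u n 0 (inord 1).
  by rewrite !mxE !inordK //=; ring.
by rewrite B0 !mxE subrr.
Qed.

Section AllBitangents.
Variable K : closedFieldType.
Hypothesis char2 : (2%:R : K) != 0.
Variable th : 'I_8 -> K.
Hypothesis th_inj : injective th.
Hypothesis th_sum : \sum_j th j = 0.
Hypothesis th_four : forall i j k l, uniq [:: i; j; k; l] ->
  th i + th j + th k + th l != 0.
Local Notation a := (oct_coef th).
Local Notation F := (quarticm a).
Local Notation p j := (quart_pt (th j)).
Implicit Types (P E O L : 'rV[K]_3) (u v w : 'rV[K]_4).

Lemma netPZ c P : netP th (c *: P) = c *: netP th P.
Proof.
have n0 : netP th 0 = 0.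
  by have := netPD th 0 0 1; rewrite scaler0 addr0 scale1r -{1}[netP th 0]addr0 => /addrI.
by rewrite -[c *: P]add0r netPD n0 add0r.
Qed.

Lemma netP_delta P : netP th P = \sum_m P 0 m *: netP th (delta_mx 0 m).
Proof.
by rewrite {1}[P]row_sum_delta !sum3 !netPD netPZ.
Qed.

(** Let T be the matrix of the pencil, so that the restriction of F is its
    characteristic polynomial up to a factor; by hypothesis it is a square g^2.
    The image of U = g(T) is isotropic for both quadrics, since U is self-
    adjoint and U^2 = 0, and its dimension is at least 2, as U is the product
    of two matrices of rank at least 3. *)
Lemma pencil_isotropic c x y E O : E != 0 -> ~~ (O <= E)%MS -> ev F O != 0 ->
    restr E O F = c *: (('X - x%:P) * ('X - y%:P)) ^+ 2 -> c != 0 ->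
  exists W : 'M[K]_(2, 4), [/\ row_free W,
    W *m netP th E *m W^T = 0 & W *m netP th O *m W^T = 0].
Proof.
move=> E0 OE FO eh c0; set Q0 := netP th E; set Q1 := netP th O.
have Q1u : Q1 \in unitmx by rewrite unitmxE unitfE -ev_quarticm.
pose T : 'M[K]_4 := - (Q0 *m invmx Q1).
have TQ1 : T *m Q1 = - Q0 by rewrite mulNmx mulmxKV.
have Q1T : Q1 *m T^T = - Q0.
  by rewrite -[Q1]netP_sym -trmx_mul TQ1 linearN /= netP_sym.
have eT : char_poly T * (\det Q1)%:P = restr E O F.
  rewrite restr_quarticm /char_poly /char_poly_mx -det_map_mx -det_mulmx.
  congr (\det _); rewrite mulmxBl mul_scalar_mx -map_mxM TQ1 map_mxN opprK.
  by rewrite addrC.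
have {eT} hT : horner_mx T (('X - x%:P) * ('X - y%:P)) ^+ 2 = 0.
  apply: (scalerI c0); rewrite -rmorphXn /= -linearZ /= -eh -eT rmorphM /=.
  by rewrite Cayley_Hamilton mul0r scaler0.
have TX z : horner_mx T ('X - z%:P) = T - z%:M.
  by rewrite rmorphB /= horner_mx_X horner_mx_C.
set U := horner_mx T _ in hT.
have eU : U = (T - x%:M) *m (T - y%:M) by rewrite /U rmorphM /= !TX.
have comTU : T *m U = U *m T.
  by rewrite -[X in X *m U](horner_mx_X T) /U -[LHS]rmorphM mulrC rmorphM /= horner_mx_X.
(* By the theorem of Cayley and Hamilton. *)
have UU : U *m U = 0 by rewrite -[RHS]hT expr2.
have sym z : (T - z%:M) *m Q1 = Q1 *m (T - z%:M)^T.
  rewrite linearB /= tr_scalar_mx mulmxBl mulmxBr TQ1 Q1T.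
  by rewrite mul_scalar_mx mul_mx_scalar.
have UQ : U *m Q1 = Q1 *m U^T.
  have eU' : U = (T - y%:M) *m (T - x%:M).
    by rewrite /U mulrC rmorphM /= !TX.
  by rewrite {1}eU -mulmxA sym mulmxA sym -mulmxA -trmx_mul -eU'.
have rT z : (3 <= \rank (T - z%:M)%R)%N.
  rewrite -(mxrankMfree _ (_ : row_free Q1)) ?row_free_unit //.
  rewrite mulmxBl TQ1 mul_scalar_mx -opprD mxrank_opp -netPD.
  by apply: netP_rank => //; apply: line_point.
have rU : (2 <= \rank U)%N.
  rewrite eU; apply: leq_trans (mxrank_mul_min _ _).
  by rewrite leq_subRL ?(leq_trans _ (leq_add (rT x) (rT y))) //; apply: (leq_add (rT x) (rT y)).
(* Two independent vectors of the image of U. *)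
pose W : 'M[K]_(2, 4) := pid_mx 2 *m row_ebase U.
have WU : (W <= U)%MS.
  rewrite -(eq_row_base U) /W /row_base.
  have -> : (pid_mx 2 : 'M[K]_(2, 4)) = (pid_mx 2 : 'M_(2, \rank U)) *m pid_mx (\rank U).
    by rewrite mul_pid_mx (minn_idPl rU) (minn_idPr rU).
  by rewrite -mulmxA submxMl.
have [X eW] := submxP WU.
exists W; split.
- rewrite /row_free /W mxrankMfree ?row_free_unit ?row_ebase_unit //.
  by rewrite rank_pid_mx.
- have -> : Q0 = - (T *m Q1) by rewrite TQ1 opprK.
  rewrite eW trmx_mul mulmxN mulNmx -!mulmxA (mulmxA Q1) -UQ !mulmxA.
  by rewrite -(mulmxA X U T) -comTU -!mulmxA (mulmxA U U) UU !(mul0mx, mulmx0) oppr0.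
- rewrite eW trmx_mul -!mulmxA (mulmxA Q1) -UQ !mulmxA -(mulmxA X) UU.
  by rewrite !(mul0mx, mulmx0).
Qed.

Definition net_form P v w : K := (v *m netP th P *m w^T) 0 0.
Local Notation b := net_form.

Lemma netP_bilD P u v w : b P (u + v) w = b P u w + b P v w.
Proof. by rewrite /b mulmxDl mulmxDl mxE. Qed.

Lemma netP_bilZ P c v w : b P (c *: v) w = c * b P v w.
Proof. by rewrite /b -!scalemxAl mxE. Qed.

Lemma netP_bilC P v w : b P v w = b P w v.
Proof. exact: bil_sym. Qed.

Lemma netP_bil_line E O v w x y :
  b (x *: E + y *: O) v w = x * b E v w + y * b O v w.
Proof.
by rewrite /b netPD netPZ mulmxDr mulmxDl -!scalemxAr -!scalemxAl mxE [in LHS]mxE [X in _ + X]mxE.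
Qed.

(** The third quadric of the net has a zero on the line W that is isotropic for
    the pencil, and this zero is a base point p_i.  The zero is simple, since
    p_i is a smooth point of all quadrics; so there is another one. *)
Lemma base_pair L E O (W : 'M[K]_(2, 4)) : L != 0 -> E != 0 -> ~~ (O <= E)%MS ->
    ev (linform L) E = 0 -> ev (linform L) O = 0 -> row_free W ->
    W *m netP th E *m W^T = 0 -> W *m netP th O *m W^T = 0 ->
  exists i j, [/\ i != j, (p i <= W)%MS & (p j <= W)%MS].
Proof.
move=> L0 E0 OE LE LO Wfree WE WO.
have [R LR] : exists R, ev (linform L) R = 1.
  have /rV0Pn [j Lj] := L0; exists ((L 0 j)^-1 *: delta_mx 0 j).
  rewrite ev_linform (bigD1 j) //= big1 => [|i ij]; last first.
    by rewrite !mxE (negbTE ij) andbF !mulr0.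
  by rewrite !mxE !eqxx mulr1 addr0 mulfV.
pose isoW := forall v w, (v <= W)%MS -> (w <= W)%MS -> forall P,
  b P v w = ev (linform L) P * b R v w.
have bW : isoW.
  move=> _ _ /submxP [v ->] /submxP [w ->] P.
  have zero Q : W *m netP th Q *m W^T = 0 -> b Q (v *m W) (w *m W) = 0.
    by move=> e; rewrite /b trmx_mul -!mulmxA (mulmxA (netP th Q)) (mulmxA W) (mulmxA W) e mul0mx mulmx0 mxE.
  have [x [y eP]] : exists x y, P - ev (linform L) P *: R = x *: O + y *: E.
    apply: (@span_of_orth _ L) => //; rewrite ev_linform_sym //.
    by rewrite -scaleNr ev_linform_line LR mulr1 subrr.
  have e1 : P = 1 *: (x *: O + y *: E) + ev (linform L) P *: R.
    by rewrite scale1r -eP subrK.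
  rewrite [in LHS]e1 !netP_bil_line (zero _ WO) (zero _ WE).
  by rewrite !(mulr0, add0r).
have bR v w u : b R (u + v) w = b R u w + b R v w by exact: netP_bilD.
pose w0 := row 0 W; pose w1 := row 1 W.
have w0W : (w0 <= W)%MS by apply: row_sub.
have w1W : (w1 <= W)%MS by apply: row_sub.
have indep x y : x *: w0 + y *: w1 = 0 -> x = 0 /\ y = 0.
  move=> e; pose z : 'rV[K]_2 := \row_j (if j == 0 then x else y).
  have z0 : z = 0.
    apply: (row_free_inj Wfree); rewrite mul0mx mulmx_sum_row.
    by rewrite !big_ord_recl big_ord0 addr0 !mxE /= -[RHS]e; congr (_ + _ *: row _ _); apply/val_inj.
  by split; [have /rowP/(_ 0) := z0 | have /rowP/(_ 1) := z0]; rewrite !mxE.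
have [v [vW v0 bv]] : exists v, [/\ (v <= W)%MS, v != 0 & b R v v = 0].
  have [b1|b1] := eqVneq (b R w1 w1) 0.
    exists w1; split=> //; apply/eqP => e; have [|_ /eqP] := indep 0 1.
      by rewrite e !scaler0 scale0r addr0.
    by rewrite oner_eq0.
  pose q := Poly [:: b R w0 w0; 2 * b R w0 w1; b R w1 w1].
  have [t /rootP qt] : exists t, root q t.
    by apply/closed_rootP; rewrite (PolyK (c := 0)).
  exists (w0 + t *: w1); split.
  - by rewrite addmx_sub // scalemx_sub.
  - apply/eqP => e; have [|/eqP] := indep 1 t; first by rewrite scale1r.
    by rewrite oner_eq0.
  rewrite bR netP_bilZ !(netP_bilC R _ (_ + _)) !bR !netP_bilZ.
  by move: qt; rewrite horner_Poly /= (netP_bilC R w1 w0) => <-; ring.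
have base u : (u <= W)%MS -> u != 0 -> b R u u = 0 ->
    exists c j, c != 0 /\ u = c *: p j.
  by move=> uW u0 bu; apply: (base_point char2 th_sum u0) => P; rewrite -/(b P u u) bW // bu mulr0.
have [c [i [c0 ev]]] := base v vW v0 bv.
have piW : (p i <= W)%MS by move: vW; rewrite ev (eqmx_scale _ c0).
have pi0 : p i != 0 by apply: contraNneq v0 => e; rewrite ev e scaler0.
have bpi : b R (p i) (p i) = 0.
  move: bv; rewrite ev netP_bilZ netP_bilC netP_bilZ => /eqP.
  by rewrite !mulf_eq0 (negbTE c0) => /eqP.
have [w wW wpi] : exists2 w : 'rV[K]_4, (w <= W)%MS & ~~ (w <= p i)%MS.
  have /row_subPn [k kn] : ~~ (W <= p i)%MS.
    apply/negP => /mxrankS; rewrite rank_rV pi0.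
    by move: Wfree; rewrite /row_free => /eqP ->.
  by exists (row k W); rewrite ?row_sub.
(* If the zero p i were double, the vectors p i Q, for Q in the net, would all
   be orthogonal to p i and to w, so that p i Q = 0 for some Q. *)
have [bw|bw] := eqVneq (b R (p i) w) 0.
  pose M : 'M[K]_(3, 4) := \matrix_m (p i *m netP th (delta_mx 0 m)).
  have PM P : P *m M = p i *m netP th P.
    rewrite netP_delta mulmx_sumr mulmx_sum_row; apply: eq_bigr => m _.
    by rewrite rowK scalemxAr.
  have Mw u : (u <= W)%MS -> b R (p i) u = 0 -> M *m u^T = 0.
    move=> uW bu; apply/row_matrixP => m; rewrite row_mul rowK row0.
    by apply/matrixP => k1 k2; rewrite !ord1 -/(b _ _ _) bW // bu mulr0 mxE.
  have [P0 P0nz P0M] : exists2 P : 'rV[K]_3, P != 0 & P *m M = 0.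
    pose N := col_mx (p i) w.
    have NM : M *m N^T = 0 by rewrite tr_col_mx mul_mx_row !Mw // row_mx0.
    have rN : (1 < \rank N)%N.
      have : (p i < N)%MS.
        by rewrite /ltmx /N -!addsmxE addsmxSl addsmx_sub negb_and wpi orbT.
      by rewrite ltmxErank rank_rV pi0 => /andP [].
    have : ~~ row_free M.
      rewrite /row_free neq_ltn (leq_ltn_trans (mxrankS (_ : M <= kermx N^T)%MS)) //.
        by apply/sub_kermxP.
      by rewrite mxrank_ker mxrank_tr ltn_subLR ?rank_leq_col // addnC (ltn_add2l 3).
    rewrite -kermx_eq0 => /rowV0Pn [P /sub_kermxP PM0 Pn0].
    by exists P.
  by case/eqP: (netP_transversal th_inj th_sum i P0nz); rewrite -PM.
pose s := - (b R w w / (2 * b R (p i) w)).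
have s0 : s *: p i + w != 0.
  apply: contraNneq wpi => /eqP; rewrite addrC addr_eq0 => /eqP ->.
  by rewrite eqmx_opp scalemx_sub.
have [||c' [j [c'0 ej]]] := base (s *: p i + w) _ s0.
- by rewrite addmx_sub // scalemx_sub.
- rewrite bR netP_bilZ !(netP_bilC R _ (_ + _)) !bR !netP_bilZ bpi (netP_bilC R w).
  by rewrite /s; field; rewrite bw char2.
exists i, j; split=> //.
- apply: contraNneq wpi => ij; rewrite -ij in ej.
  have -> : w = (c' - s) *: p i by rewrite scalerBl -ej addrAC subrr add0r.
  exact: scalemx_sub.
- have : ((s *: p i + w)%R <= W)%MS by rewrite addmx_sub // scalemx_sub.
  by rewrite ej (eqmx_scale _ c'0).
Qed.

Lemma ev_ell i j P : ev (ell th i j) P =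
  bitan a (th i + th j) (th i * th j) (P 0 (inord 2)) (P 0 (inord 1) + P 0 (inord 2))
    (P 0 (inord 0)).
Proof.
rewrite /ell linform_bitan /bitanm /ev rmorph_bitan /= !mevalXU.
by rewrite /bitan /= !(mevalD, mevalC) !mevalXU.
Qed.

(** Modulo the relations f(t_i) = f(t_j) = 0 the polar form of two points of
    the rational curve is divisible by (t_i - t_j)^2. *)
Lemma netP_ell i j P : b P (p i) (p j) = (th i - th j) ^+ 2 * ev (ell th i j) P.
Proof.
have fi := octic_th th i; have fj := octic_th th j.
rewrite ev_ell /b /netP net_bilE !mxE /= /bitan.
move: fi fj; rewrite !(hornerE_octic th_sum).
move: (P 0 _) (P 0 _ + _) (P 0 _) (th i) (th j) => x y z s t fs ft.
have eq0 (l r A B : K) : A = 0 -> B = 0 -> l - r = z * (A + B) -> l = r.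
  by move=> -> -> /eqP; rewrite addr0 mulr0 subr_eq0 => /eqP.
by apply: (eq0 _ _ _ _ fs ft); ring.
Qed.

(** The orders of a bitangent are even, and they are the multiplicities of the
    roots of the restriction of F. *)
Lemma bitangent_even_mult L E O : bitangent F L -> E != 0 -> ~~ (O <= E)%MS ->
    ev (linform L) E = 0 -> ev (linform L) O = 0 -> ev F O != 0 ->
  exists c x y, c != 0 /\ restr E O F = c *: (('X - x%:P) * ('X - y%:P)) ^+ 2.
Proof.
move=> [L0 [D LD]] E0 OE LE LO FO.
have sm := quarticm_smooth char2 th_inj th_sum th_four.
have hF := quarticm_homog a.
have s5 : size (restr E O F) = 5%N by apply: (size_restrF (L := L) hF FO).
have h0 : restr E O F != 0 by rewrite -size_poly_eq0 s5.
have [t r w e wt|c [s [c0 es]]] := even_roots_square h0.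
  have [->//|r0] := posnP r.
  have w0 : w != 0 by apply: contraNneq wt => ->; rewrite horner0.
  have sz : (r + size w = 5)%N.
    move: s5; rewrite e size_monicM ?monic_exp ?monicXsubC //.
    by rewrite size_exp_XsubC addSn.
  have sw : (size w <= 5 - r)%N by rewrite -sz addKn.
  have r4 : (r <= 4)%N.
    by rewrite -ltnS -sz -[X in (X < _)%N]addn0 ltn_add2l size_poly_gt0.
  have [|PF ordL] := line_order hF sm E0 OE LE LO L0 sw _ wt e.
    by rewrite r0.
  have [n /ord_at_ordP ordn En] := LD _ PF.
  have -> : r = n by apply: (ordP_uniq hF sm PF ordL ordn).
  have := congr1 absz En; rewrite -mulr_natr abszM /= => <-.
  by rewrite muln2 odd_double.
have : size s = 2%N.
  have := congr1 predn s5; rewrite es size_scale // size_exp.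
  rewrite size_prod_XsubC /= muln2 => /(congr1 half).
  by rewrite doubleK.
case: s es => [|x [|y []]] // es _; exists c, x, y; split=> //.
by rewrite es !big_cons big_nil mulr1.
Qed.

Definition pair_row i j := bitan_row a (th i + th j) (th i * th j).

Lemma pair_row_neq0 i j : pair_row i j != 0. Proof. exact: bitan_row_neq0. Qed.

(** The isotropic line of the pencil given by L contains two base points, and
    the line of this pair vanishes where L does. *)
Theorem bitangent_pair_row L : bitangent F L ->
  exists i j, i != j /\ (pair_row i j == L)%MS.
Proof.
move=> bL; have [L0 _] := bL; have hF := quarticm_homog a.
have sm := quarticm_smooth char2 th_inj th_sum th_four.
have [E [O [E0 OE LE LO FO]]] : exists E O, [/\ E != 0, ~~ (O <= E)%MS,
    ev (linform L) E = 0, ev (linform L) O = 0 & ev F O != 0].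
  have [E1 [LE1 E1n]] := exists_orth_notin L 0.
  have [E2 [LE2 E21]] := exists_orth_notin L E1.
  rewrite ev_linform_sym in LE1; rewrite ev_linform_sym in LE2.
  have E10 : E1 != 0 by apply: contraNneq E1n => ->; rewrite sub0mx.
  have E20 : E2 != 0 by apply: contraNneq E21 => ->; rewrite sub0mx.
  have : restr E1 E2 F != 0.
    apply/eqP => e; apply: (line_not_dvd hF sm (L := L)).
    exact: (restr_eq0 E10 E21 LE1 LE2 L0 hF e).
  case/closed_nonrootP => t; rewrite /root horner_restr => Ft.
  exists E2, (E1 + t *: E2); split=> //; last by rewrite ev_linform_line LE1 LE2 mulr0 addr0.
  apply: contra E21 => /sub_rVP [z ez]; apply/sub_rVP.
  have e1 : E1 = (z - t) *: E2 by rewrite scalerBl -ez addrK.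
  have zt : z - t != 0 by apply: contraNneq E10 => zt; rewrite e1 zt scale0r.
  by exists (z - t)^-1; rewrite e1 scalerA mulVf // scale1r.
have [c [x [y [c0 eh]]]] := bitangent_even_mult bL E0 OE LE LO FO.
have [W [Wfree WE WO]] := pencil_isotropic E0 OE FO eh c0.
have [i [j [ij piW pjW]]] := base_pair L0 E0 OE LE LO Wfree WE WO.
exists i, j; split=> //.
have vanish P : W *m netP th P *m W^T = 0 -> ev (ell th i j) P = 0.
  move=> WP; have : b P (p i) (p j) = 0.
    have [u ->] := submxP piW; have [v ->] := submxP pjW.
    by rewrite /b trmx_mul -!mulmxA (mulmxA (netP th P)) (mulmxA W) (mulmxA W) WP mul0mx mulmx0 mxE.
  move/eqP; rewrite netP_ell mulf_eq0 expf_eq0 /= subr_eq0 (inj_eq th_inj).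
  by rewrite (negbTE ij) => /eqP.
have [M [N [_ _ NE NO]]] := line_coords E0 OE.
have [|z [y' eB]] := span_of_orth E0 NE LE L0 _ (vanish _ WE).
  apply/negP => /sub_rVP [z ez]; have := NO.
  by rewrite ez linformZ evZ LO mulr0 => /eqP; rewrite eq_sym oner_eq0.
rewrite -/(pair_row i j) in eB; have := vanish _ WO; rewrite /ell -/(pair_row i j) eB linformD !linformZ !evE LO NO.
rewrite mulr0 addr0 mulr1 => z0; rewrite z0 scale0r add0r in eB.
have y0 : y' != 0.
  by have := pair_row_neq0 i j; rewrite eB; apply: contraNneq => ->; rewrite scale0r.
rewrite z0 scale0r add0r; apply/eqmxP; exact: eqmx_scale.
Qed.

(** Two distinct edges belong to a 4-cycle, and its conic excludes that they
    define the same line ([no_double_line]). *)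
Lemma pair_row_inj i j k l : i != j -> k != l -> (pair_row i j <= pair_row k l)%MS ->
  [set i; j] = [set k; l].
Proof.
have sm := quarticm_smooth char2 th_inj th_sum th_four.
have noline m1 m2 m3 m4 : uniq [:: m1; m2; m3; m4] ->
    (pair_row m1 m2 <= pair_row m3 m4)%MS \/ (pair_row m1 m2 <= pair_row m2 m3)%MS -> False.
  move=> us prop; have [c [Q [c0 hQ eF]]] := cycle_conic th_inj th_sum th_four us.
  have [m [m' [S [/sub_rVP [x ex] {}eF]]]] : exists m m' S,
      (pair_row m1 m2 <= pair_row m m')%MS /\ c%:MP * F = Q ^+ 2 - ell th m1 m2 * (ell th m m' * S).
    case: prop => h; [exists m3, m4 | exists m2, m3].
      by exists (4 * (ell th m2 m3 * ell th m4 m1)); split=> //; rewrite eF; ring.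
    by exists (4 * (ell th m3 m4 * ell th m4 m1)); split=> //; rewrite eF; ring.
  apply: (no_double_line sm (L := pair_row m m') (S := x%:MP * S) c0 hQ).
  rewrite eF /ell -!/(pair_row _ _) ex linformZ -mul_mpolyC; ring.
move=> ij kl e.
have pair_rowC i' j' : pair_row i' j' = pair_row j' i' by rewrite /pair_row addrC mulrC.
have third m1 m2 m3 : exists m4 : 'I_8, m4 \notin [:: m1; m2; m3].
  apply/existsP; apply: contraTT isT => /existsPn h.
  have := uniq_leq_size (enum_uniq 'I_8) (_ : {subset _ <= [:: m1; m2; m3]}).
  by rewrite size_enum_ord => /(_ (fun m _ => negbNE (h m))).
have share m1 m2 m3 : m1 != m2 -> m2 != m3 -> (pair_row m1 m2 <= pair_row m2 m3)%MS -> m1 = m3.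
  move=> n12 n23 h; apply/eqP/negPn/negP => n13.
  have [m4 n4] := third m1 m2 m3.
  apply: (noline m1 m2 m3 m4); last by right.
  move: n4; rewrite /= !inE !negb_or ![m4 == _]eq_sym n12 n13 n23 /=.
  by move=> /and3P [-> -> ->].
have [ik|ik] := eqVneq i k.
  rewrite pair_rowC ik in e; rewrite ik; congr [set _; _].
  by apply: (share _ _ _ _ _ e); rewrite // eq_sym // -ik.
have [il|il] := eqVneq i l.
  rewrite pair_rowC (pair_rowC k) il in e; rewrite il setUC; congr [set _; _].
  by apply: (share _ _ _ _ _ e); rewrite eq_sym // -il.
have [jk|jk] := eqVneq j k.
  rewrite jk in e; rewrite jk setUC; congr [set _; _].
  by apply: (share _ _ _ _ _ e); rewrite // -jk.
have [jl|jl] := eqVneq j l.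
  rewrite jl (pair_rowC k) in e; rewrite jl; congr [set _; _].
  by apply: (share _ _ _ _ _ e); rewrite -?jl // jl eq_sym.
case: (noline i j k l); last by left.
by rewrite /= !inE !negb_or ij ik il jk jl kl.
Qed.
End AllBitangents.

(** * Graphs with four edges on eight vertices *)

Ltac split_distinct H :=
  move: H; rewrite /= ?inE ?negb_or -?andbA; repeat (case/andP; move=> ?); try move=> ?.
Ltac distinct :=
  rewrite /= ?inE ?negb_or;
  repeat first [done | assumption | rewrite eq_sym; assumption | apply/andP; split].

Ltac boolean :=
  repeat match goal with |- context [?x == ?y] => case: (x == y) end; by [].

Section TetradCombinatorics.
Implicit Types (i j k l m : 'I_8) (A B : {set 'I_8}) (s : seq {set 'I_8}).
(** For the lines attached to the edges in a list, C says that the sum of their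
    half-divisors is trivial up to line sections.  Twice a half-divisor is a
    line section, so only parities matter. *)
Variable C : seq {set 'I_8} -> Prop.
Hypothesis C_cat : forall s s', C s -> C s' -> C (s ++ s').
Hypothesis C_parity : forall s s',
  (forall A, odd (count_mem A s) = odd (count_mem A s')) -> C s -> C s'.
Hypothesis C_cycle : forall i j k l, uniq [:: i; j; k; l] ->
  C [:: [set i; j]; [set j; k]; [set k; l]; [set l; i]].
Hypothesis C_matching : forall i j k l i' j' k' l',
  uniq [:: i; j; k; l; i'; j'; k'; l'] ->
  C [:: [set i; j]; [set k; l]; [set i'; j']; [set k'; l']].
Hypothesis C_two : forall i j k l, i != j -> k != l ->
  C [:: [set i; j]; [set k; l]] -> [set i; j] = [set k; l].

Lemma C_add s1 s2 s : C s1 -> C s2 ->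
  (forall A, odd (count_mem A s) = odd (count_mem A s1) (+) odd (count_mem A s2)) -> C s.
Proof.
move=> c1 c2 e; apply: C_parity (C_cat c1 c2) => A.
by rewrite count_cat oddD e.
Qed.

Ltac parity := let A := fresh "A" in
  move=> A; rewrite /= !oddD !oddb;
  repeat match goal with |- context [?x == A] => case: (x == A) end; by [].

Lemma pair_neq i j k l : i != k -> i != l -> [set i; j] <> [set k; l].
Proof.
move=> ik il e; have := set21 i j; rewrite e !inE.
by rewrite (negbTE ik) (negbTE il).
Qed.

Lemma C_two_neq i j k l : i != j -> k != l -> i != k -> i != l ->
  C [:: [set i; j]; [set k; l]] -> False.
Proof. by move=> ij kl ik il /(C_two ij kl); apply: pair_neq. Qed.

Lemma avoid (s : seq 'I_8) : (size s < 8)%N -> exists i, i \notin s.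
Proof.
move=> s8; apply/existsP; apply: contraTT s8 => /existsPn h.
have := uniq_leq_size (enum_uniq 'I_8) (fun m _ => negbNE (h m)).
by rewrite size_enum_ord -leqNgt.
Qed.

Lemma pairC i j : [set i; j] = [set j; i]. Proof. exact: setUC. Qed.

Lemma C_even s : (forall A, ~~ odd (count_mem A s)) -> C s.
Proof.
move=> ev; have [i _] := @avoid [::] isT.
have [j hj] := @avoid [:: i] isT; have [k hk] := @avoid [:: i; j] isT.
have [l hl] := @avoid [:: i; j; k] isT.
split_distinct hj; split_distinct hk; split_distinct hl.
have c : C [:: [set i; j]; [set j; k]; [set k; l]; [set l; i]].
  by apply: C_cycle; distinct.
by apply: (C_add c c) => A; rewrite addbb (negbTE (ev A)).
Qed.

Lemma C_path i j k j' : i != k -> j != i -> j != k -> j' != i -> j' != k ->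
  C [:: [set i; j]; [set j; k]; [set i; j']; [set j'; k]].
Proof.
move=> ik ji jk j'i j'k; have [<-|jj'] := eqVneq j j'.
  by apply: C_even; parity.
rewrite (pairC i j') (pairC j' k); apply: (C_parity _ (@C_cycle i j k j' _)).
  by parity.
by distinct.
Qed.

(** The middle vertex of a path of length two may be replaced: the two paths
    form a 4-cycle. *)
Lemma C_move s i j k j' : i != k -> j != i -> j != k -> j' != i -> j' != k ->
  C [:: [set i; j], [set j; k] & s] -> C [:: [set i; j'], [set j'; k] & s].
Proof.
move=> ik ji jk j'i j'k c; apply: (C_add c (C_path ik ji jk j'i j'k)).
move=> A /=; rewrite !oddD !oddb; move: (odd (count _ s)).
by repeat match goal with |- context [?x == A] => case: (x == A) end; case.
Qed.

(** Two triangles with a common vertex w are the sum of the 4-cycles i k w l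
    and i w m l. *)
Lemma C_bow i k l m w : uniq [:: i; k; l; m; w] ->
  C [:: [set i; w]; [set w; k]; [set l; w]; [set w; m]; [set i; k]; [set l; m]].
Proof.
move=> us; split_distinct us.
have c1 : C [:: [set i; k]; [set k; w]; [set w; l]; [set l; i]] by apply: C_cycle; distinct.
have c2 : C [:: [set i; w]; [set w; m]; [set m; l]; [set l; i]] by apply: C_cycle; distinct.
rewrite (pairC w k) (pairC l w) (pairC l m).
by apply: (C_add c1 c2); parity.
Qed.

(** These are the edges of the 4-cycle a b d c. *)
Lemma C_disjoint a b c d : uniq [:: a; b; c; d] ->
  C [:: [set a; b]; [set c; d]; [set a; c]; [set b; d]].
Proof.
move=> us; split_distinct us.
rewrite (pairC c d) (pairC a c).
apply: (C_parity _ (@C_cycle a b d c _)); first by parity.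
by distinct.
Qed.

Lemma C_rejoin1 i a b c d : i \in [:: a; b; c; d] ->
  exists l m n, perm_eq [:: i; l; m; n] [:: a; b; c; d] /\
    C [:: [set a; b]; [set c; d]; [set i; l]; [set m; n]].
Proof.
rewrite !inE => /or4P [] /eqP ->.
- by exists b, c, d; split=> //; apply: C_even; parity.
- exists a, c, d; split; first by apply/seq.permP => p /=; rewrite addnCA.
  by rewrite (pairC b a); apply: C_even; parity.
- exists d, a, b; split; first by rewrite (perm_catC [:: c; d] [:: a; b]).
  by apply: C_even; parity.
exists c, a, b; split; last by rewrite (pairC d c); apply: C_even; parity.
by rewrite (perm_catC [:: d; c] [:: a; b]); apply/seq.permP => p /=; rewrite !addn0 [(p d + _)%N]addnC.
Qed.

(** The four ends of two disjoint edges may be joined in any way. *)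
Lemma C_rejoin i k a b c d : uniq [:: a; b; c; d] -> i != k ->
    i \in [:: a; b; c; d] -> k \in [:: a; b; c; d] ->
  exists l m, perm_eq [:: i; k; l; m] [:: a; b; c; d] /\
    C [:: [set a; b]; [set c; d]; [set i; k]; [set l; m]].
Proof.
move=> us ik ia ka; have [l [m [n [pe c1]]]] := C_rejoin1 ia.
have us' : uniq [:: i; l; m; n] by rewrite (perm_uniq pe).
move: ka; rewrite -(perm_mem pe) !inE eq_sym (negbTE ik) /=.
case/or3P => /eqP ek; subst k.
- by exists m, n.
- exists l, n; split.
    by apply/seq.permP => p; rewrite -(seq.permP pe p) /= [(p m + (p l + _))%N]addnCA.
  by apply: (C_add c1 (C_disjoint us')); parity.
exists l, m; split.
  apply/seq.permP => q; rewrite -(seq.permP pe q) /= !addn0; congr addn.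
  by rewrite addnC -addnA.
have us'' : uniq [:: i; l; n; m] by split_distinct us'; distinct.
rewrite (pairC m n) in c1.
by apply: (C_add c1 (C_disjoint us'')); parity.
Qed.

(** Let i and k be the ends of the path.  If both, one or none of them are ends
    of the two disjoint edges, the relation reduces to an equality of two
    distinct edges, namely two edges at a vertex w that end at the other two
    ends, two edges with disjoint ends, or two edges at i. *)
Lemma path_matching i j k a b c d : i != k -> j != i -> j != k ->
    uniq [:: a; b; c; d] ->
  C [:: [set i; j]; [set j; k]; [set a; b]; [set c; d]] -> False.
Proof.
move=> ik ji jk us c0; have ki : k != i by rewrite eq_sym.
have one i' k' : i' != k' -> j != i' -> j != k' ->
    C [:: [set i'; j]; [set j; k']; [set a; b]; [set c; d]] ->
    i' \in [:: a; b; c; d] -> k' \notin [:: a; b; c; d] -> False.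
  move=> ik' ji' jk' c0' ia ka; have [l [m [n [pe c1]]]] := C_rejoin1 ia.
  have us' : uniq [:: i'; l; m; n] by rewrite (perm_uniq pe).
  rewrite -(perm_mem pe) in ka; split_distinct us'; split_distinct ka.
  have c2 : C [:: [set i'; l]; [set l; k']; [set a; b]; [set c; d]].
    by apply: C_move c0'; distinct.
  apply: (@C_two_neq l k' m n); [by distinct.. |].
  by apply: (C_add c1 c2); parity.
have [ia|ia] := boolP (i \in [:: a; b; c; d]);
    have [ka|ka] := boolP (k \in [:: a; b; c; d]).
- have [l [m [pe c1]]] := C_rejoin us ik ia ka.
  have us' : uniq [:: i; k; l; m] by rewrite (perm_uniq pe).
  have [w hw] := @avoid [:: i; k; l; m] isT.
  split_distinct us'; split_distinct hw.
  have c2 : C [:: [set i; w]; [set w; k]; [set a; b]; [set c; d]].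
    by apply: C_move c0; distinct.
  have c3 : C [:: [set i; w]; [set w; k]; [set l; w]; [set w; m]; [set i; k]; [set l; m]].
    by apply: C_bow; distinct.
  have c4 : C [:: [set i; w]; [set w; k]; [set i; k]; [set l; m]].
    by apply: (C_add c1 c2); parity.
  apply: (@C_two_neq l w m w); [by distinct.. |].
  by rewrite (pairC m w); apply: (C_add c3 c4); parity.
- exact: (one i k).
- apply: (one k i) => //.
  by rewrite (pairC k j) (pairC j i); apply: C_parity c0; parity.
have [u hu] := @avoid [:: i; k; a; b; c; d] isT.
have [v hv] := @avoid [:: u; i; k; a; b; c; d] isT.
split_distinct us; split_distinct ia; split_distinct ka; split_distinct hu; split_distinct hv.
have c1 : C [:: [set i; u]; [set u; k]; [set a; b]; [set c; d]].
  by apply: C_move c0; distinct.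
have c2 : C [:: [set u; k]; [set i; v]; [set a; b]; [set c; d]].
  by apply: C_matching; distinct.
apply: (@C_two_neq u i v i); [by distinct.. |].
by rewrite (pairC u) (pairC v); apply: (C_add c1 c2); parity.
Qed.

(** Both paths may be moved to a common middle vertex; what remains is a pair
    of distinct edges. *)
Lemma path_share i j k m n : i != k -> j != i -> j != k -> i != n -> m != i -> m != n ->
  k != n -> C [:: [set i; j]; [set j; k]; [set i; m]; [set m; n]] -> False.
Proof.
move=> ik ji jk in' mi mn kn c0.
have [w hw] := @avoid [:: i; k; n] isT; split_distinct hw.
have c1 : C [:: [set i; w]; [set w; k]; [set i; m]; [set m; n]].
  by apply: C_move c0; distinct.
have c2 : C [:: [set i; w]; [set w; n]; [set i; w]; [set w; k]].
  apply: (@C_move _ i m n w); [by distinct.. |].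
  by apply: C_parity c1; parity.
apply: (@C_two_neq k w n w); [by distinct.. |].
by rewrite (pairC k) (pairC n); apply: C_parity c2; parity.
Qed.

(** If the ends of the paths are not the same, one common end gives
    [path_share], and paths without a common end are moved to a common middle
    vertex and replaced by the edges that join their ends. *)
Lemma path_path i j k l m n : i != k -> j != i -> j != k -> l != n -> m != l -> m != n ->
  C [:: [set i; j]; [set j; k]; [set l; m]; [set m; n]] -> [set i; k] = [set l; n].
Proof.
move=> ik ji jk ln ml mn c0.
have nl : n != l by rewrite eq_sym.
have ki : k != i by rewrite eq_sym.
have c0l : C [:: [set k; j]; [set j; i]; [set l; m]; [set m; n]].
  by rewrite (pairC k) (pairC j i); apply: C_parity c0; parity.
have c0r : C [:: [set i; j]; [set j; k]; [set n; m]; [set m; l]].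
  by rewrite (pairC n) (pairC m l); apply: C_parity c0; parity.
have c0b : C [:: [set k; j]; [set j; i]; [set n; m]; [set m; l]].
  by rewrite (pairC k) (pairC j i); apply: C_parity c0r; parity.
have [e|il] := eqVneq i l.
  subst l; congr [set _; _]; apply/eqP/negPn/negP => kn.
  exact: (path_share ik ji jk ln ml mn kn c0).
have [e|in'] := eqVneq i n.
  subst n; rewrite (pairC l); congr [set _; _]; apply/eqP/negPn/negP => kn.
  exact: (path_share ik ji jk nl mn ml kn c0r).
have [e|kl] := eqVneq k l.
  by subst l; case: (path_share ki jk ji ln ml mn in' c0l).
have [e|kn] := eqVneq k n.
  by subst n; case: (path_share ki jk ji nl mn ml il c0b).
have [w hw] := @avoid [:: i; k; l; n] isT; split_distinct hw.
have c1 : C [:: [set i; w]; [set w; k]; [set l; m]; [set m; n]].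
  by apply: C_move c0; distinct.
have c2 : C [:: [set l; w]; [set w; n]; [set i; w]; [set w; k]].
  apply: (@C_move _ l m n w); [by distinct.. |].
  by apply: C_parity c1; parity.
have c3 : C [:: [set i; w]; [set w; k]; [set l; w]; [set w; n]; [set i; k]; [set l; n]].
  by apply: C_bow; distinct.
exfalso; apply: (@C_two_neq i k l n); [by distinct.. |].
by apply: (C_add c2 c3); parity.
Qed.

Lemma disjoint_edges A B : #|A| = 2%N -> #|B| = 2%N -> [disjoint A & B] ->
  exists a b c d, [/\ A = [set a; b], B = [set c; d] & uniq [:: a; b; c; d]].
Proof.
move=> /eqP/cards2P [a [b [ab ->]]] /eqP/cards2P [c [d [cd ->]]] dis.
exists a, b, c, d; split=> //.
have na : a \notin [set c; d] by rewrite (disjointFr dis) ?set21.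
have nb : b \notin [set c; d] by rewrite (disjointFr dis) ?set22.
by split_distinct na; split_distinct nb; distinct.
Qed.

Lemma adjacent_edges A B : #|A| = 2%N -> #|B| = 2%N -> A != B -> ~~ [disjoint A & B] ->
  exists i j k, [/\ A = [set i; j], B = [set j; k] & [/\ i != k, j != i & j != k]].
Proof.
have link (D : {set 'I_8}) j : #|D| = 2%N -> j \in D -> exists2 i, j != i & D = [set i; j].
  move=> /eqP/cards2P [a [b [ab ->]]]; rewrite !inE => /orP [] /eqP ->.
    by exists b => //; rewrite pairC.
  by exists a; rewrite // eq_sym.
move=> cA cB AB; rewrite -setI_eq0 => /set0Pn [j]; rewrite inE => /andP [jA jB].
have [i ji eA] := link _ _ cA jA; have [k jk eB] := link _ _ cB jB.
exists i, j, k; rewrite eA eB (pairC k); split=> //; split=> //.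
by apply: contraNneq AB => ik; rewrite eA eB ik.
Qed.

(** If two of the four edges are adjacent, so are the other two by
    [path_matching], and the two paths have the same ends by [path_path].
    Otherwise the edges are disjoint. *)
Theorem tetrad_of_C s : size s = 4%N -> uniq s -> (forall A, A \in s -> #|A| = 2%N) ->
  C s -> let E := [set A in s] in four_cycle E || partition E [set: 'I_8].
Proof.
move=> s4 us c2 cs; set E := [set A in s]; rewrite /=.
have [adj|nadj] := boolP [exists A in s, exists B in s, (A != B) && ~~ [disjoint A & B]].
  apply/orP; left; have [A As /exists_inP [B Bs /andP [AB dAB]]] := exists_inP adj.
  have BrA : B \in rem A s by rewrite (mem_rem_uniq A us) !inE eq_sym AB.
  have [A' [B' pe]] : exists A' B', perm_eq s [:: A; B; A'; B'].
    have := size_rem BrA; rewrite (size_rem As) s4 /=.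
    case e: (rem B (rem A s)) => [|A' [|B' []]] // _; exists A', B'.
    rewrite (perm_trans (perm_to_rem As)) // perm_cons -e; exact: perm_to_rem.
  have us' : uniq [:: A; B; A'; B'] by rewrite -(perm_uniq pe).
  have sub D : D \in [:: A; B; A'; B'] -> #|D| = 2%N by rewrite -(perm_mem pe); apply: c2.
  have cAB : C [:: A; B; A'; B'].
    by apply: C_parity cs => D; rewrite (seq.permP pe).
  have [i [j [k [eA eB [ik ji jk]]]]] := adjacent_edges (c2 _ As) (c2 _ Bs) AB dAB.
  have cA' : #|A'| = 2%N by apply: sub; rewrite !inE eqxx !orbT.
  have cB' : #|B'| = 2%N by apply: sub; rewrite !inE eqxx !orbT.
  have AB' : A' != B' by move: us'; rewrite /= !inE => /and4P [].
  have [dis|ndis] := boolP [disjoint A' & B'].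
    have [a [b [c [d [eA' eB' uabcd]]]]] := disjoint_edges cA' cB' dis.
    by case: (path_matching ik ji jk uabcd); rewrite -eA -eB -eA' -eB'.
  have [l [m [n [eA' eB' [ln ml mn]]]]] := adjacent_edges cA' cB' AB' ndis.
  rewrite eA eB eA' eB' in us' cAB.
  have e := path_path ik ji jk ln ml mn cAB.
  have jm : j != m.
    apply/eqP => jm; subst m; move: us'.
    have : i \in [set l; n] by rewrite -e set21.
    rewrite !inE => /orP [] /eqP il; rewrite /= !inE il ?eqxx ?orbT //.
    by rewrite (pairC n) eqxx ?orbT.
  have im : i != m.
    have : i \in [set l; n] by rewrite -e set21.
    by rewrite !inE => /orP [] /eqP ->; rewrite eq_sym.
  have km : k != m.
    have : k \in [set l; n] by rewrite -e set22.
    by rewrite !inE => /orP [] /eqP ->; rewrite eq_sym.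
  apply/existsP; exists i; apply/existsP; exists j; apply/existsP; exists k.
  apply/existsP; exists m; apply/andP; split; first by distinct.
  have eE : E = [set D in [:: A; B; A'; B']].
    by apply/setP => D; rewrite !inE (perm_mem pe) !inE.
  have [[il kn]|[in' kl]] : (i = l /\ k = n) \/ (i = n /\ k = l).
    have := set21 i k; have := set22 i k; rewrite e !inE.
    by move=> /orP [] /eqP ? /orP [] /eqP ?; subst; auto; rewrite eqxx in ik.
    rewrite eE eA eB eA' eB' -il -kn (pairC m) (pairC m) (pairC k m).
    by apply/eqP/setP => D; rewrite !inE; boolean.
  rewrite eE eA eB eA' eB' -in' -kl (pairC m).
  by apply/eqP/setP => D; rewrite !inE; boolean.
have triv : trivIset E.
  apply/trivIsetP => A B; rewrite !inE => As Bs AB.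
  move/exists_inPn: nadj => /(_ A As) /exists_inPn /(_ B Bs).
  by rewrite negb_and AB negbK.
apply/orP; right; apply/and3P; split=> //; last first.
  by rewrite inE; apply/negP => /c2; rewrite cards0.
rewrite eqEcard subsetT cardsT card_ord -(eqP triv).
rewrite (eq_bigr (fun=> 2%N)) => [|A]; last by rewrite inE; apply: c2.
have cE : #|E| = size s by rewrite -(card_uniqP us); apply: eq_card => A; rewrite inE.
by rewrite sum_nat_const cE s4.
Qed.
End TetradCombinatorics.

(** * Syzygetic tetrads *)

Lemma perfect_matching (s : seq {set 'I_8}) : uniq s ->
    (forall A, A \in s -> #|A| = 2%N) -> partition [set A in s] [set: 'I_8] ->
  exists j1 j2 j3 j4 j5 j6 j7 j8, uniq [:: j1; j2; j3; j4; j5; j6; j7; j8] /\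
    s = [:: [set j1; j2]; [set j3; j4]; [set j5; j6]; [set j7; j8]].
Proof.
move=> us c2 part; have cE : #|[set A in s]| = size s.
  by rewrite -(card_uniqP us); apply: eq_card => A; rewrite inE.
have s4 : size s = 4%N.
  have := card_uniform_partition (n := 2%N) _ part; rewrite cardsT card_ord cE => h.
  have {}h : 8%N = (size s * 2)%N by apply: h => A; rewrite inE; apply: c2.
  by have := congr1 half h; rewrite muln2 doubleK => <-.
have cov : cover [set A in s] = [set: 'I_8] by case/and3P: part => /eqP.
case: s s4 c2 us cov {part cE} => [|A1 [|A2 [|A3 [|A4 []]]]] // _ c2 us cov.
have pair A : A \in [:: A1; A2; A3; A4] -> exists i j, A = [set i; j].
  by move=> As; have /eqP/cards2P [i [j [_ ->]]] := c2 A As; exists i, j.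
have [|j1 [j2 e1]] := pair A1; first by rewrite !inE eqxx.
have [|j3 [j4 e2]] := pair A2; first by rewrite !inE eqxx ?orbT.
have [|j5 [j6 e3]] := pair A3; first by rewrite !inE eqxx ?orbT.
have [|j7 [j8 e4]] := pair A4; first by rewrite !inE eqxx ?orbT.
exists j1, j2, j3, j4, j5, j6, j7, j8; rewrite e1 e2 e3 e4; split=> //.
apply: (leq_size_uniq (enum_uniq 'I_8)); last by rewrite size_enum_ord.
move=> j _; have : j \in cover [set A in [:: A1; A2; A3; A4]] by rewrite cov inE.
case/bigcupP => A; rewrite !inE e1 e2 e3 e4 => /or4P [] /eqP ->; rewrite !inE;
  by case/orP => ->; rewrite ?orbT.
Qed.

Section Syzygetic.
Variable K : closedFieldType.
Hypothesis char2 : (2%:R : K) != 0.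
Variable th : 'I_8 -> K.
Hypothesis th_inj : injective th.
Hypothesis th_sum : \sum_j th j = 0.
Hypothesis th_four : forall i j k l, uniq [:: i; j; k; l] ->
  th i + th j + th k + th l != 0.
Local Notation a := (oct_coef th).
Local Notation F := (quarticm a).
Implicit Types (P L M : 'rV[K]_3) (A B : {set 'I_8}).

Let hF : F \is 4.-homog := quarticm_homog a.
Let sm : smooth_curve F := quarticm_smooth char2 th_inj th_sum th_four.
Let O : 'rV[K]_3 := delta_mx 0 ord_max.

Lemma ev_quarticm_O : ev F O != 0.
Proof.
have e0 : (inord 0 : 'I_3) != ord_max by rewrite -val_eqE /= inordK.
have e1 : (inord 1 : 'I_3) != ord_max by rewrite -val_eqE /= inordK.
have e2 : (inord 2 : 'I_3) = ord_max by apply/val_inj; rewrite /= inordK.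
rewrite ev_quarticm det_net /O !mxE e2 (negbTE e0) (negbTE e1) eqxx /quartic /=.
rewrite (_ : _ + _ = 2%:R * 2%:R); last by ring.
by rewrite mulf_neq0.
Qed.

(** The line of the pair A, as a symmetric function of its elements; this makes
    the Galois action on the lines evident. *)
Definition edge_row A : 'rV[K]_3 := bitan_row a (\sum_(x in A) th x) (\prod_(x in A) th x).

Lemma edge_row_pair i j : i != j -> edge_row [set i; j] = pair_row th i j.
Proof.
by move=> ij; rewrite /edge_row !(big_setU1, big_set1) ?inE.
Qed.

(** Complete the edge to a 4-cycle. *)
Lemma edge_contact i j : i != j ->
  forall P, on_curve F P -> exists n, ordP F P (linform (edge_row [set i; j])) n.*2.
Proof.
move=> ij; rewrite edge_row_pair //.
have [k hk] := @avoid [:: i; j] isT; have [l hl] := @avoid [:: i; j; k] isT.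
have us : uniq [:: i; j; k; l].
  by split_distinct hk; split_distinct hl; distinct.
have [c [Q [c0 hQ e]]] := cycle_conic th_inj th_sum th_four us.
exact: (contact_even hF sm c0 hQ e).
Qed.

(** Half of the order of L at P, when this order is even; it defines the
    contact divisor of a bitangent. *)
Definition half_ord L P : nat :=
  epsilon (inhabits 0%N) (fun n => ordP F P (linform L) n.*2).

Lemma half_ordP A P : #|A| = 2%N -> on_curve F P ->
  ordP F P (linform (edge_row A)) (half_ord (edge_row A) P).*2.
Proof.
move=> /eqP/cards2P [i [j [ij ->]]] PF.
exact: (epsilon_spec _ _ (edge_contact ij PF)).
Qed.

Lemma conic_half_ord A1 A2 A3 A4 c Q : #|A1| = 2%N -> #|A2| = 2%N -> #|A3| = 2%N -> #|A4| = 2%N ->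
    Q \is 2.-homog ->
    c%:MP * F = Q ^+ 2 - linform (edge_row A1) * (4 * linform (edge_row A2)
      * (linform (edge_row A3) * linform (edge_row A4))) ->
  forall P, on_curve F P ->
    ordP F P Q (\sum_(A <- [:: A1; A2; A3; A4]) half_ord (edge_row A) P).
Proof.
move=> c1 c2 c3 c4 hQ e P PF; apply: (ordP_sqrt hF sm PF hQ).
apply: (ordP_assoc_at (H := 4 * (linform (edge_row A1) * linform (edge_row A2)
      * (linform (edge_row A3) * linform (edge_row A4))))) => //.
  have e' : Q ^+ 2 = 4 * (linform (edge_row A1) * linform (edge_row A2)
      * (linform (edge_row A3) * linform (edge_row A4))) + c%:MP * F by rewrite e; ring.
  exact: (assoc_at_mod _ e').
rewrite !big_cons big_nil addn0 !doubleD -[(_ + _)%N]add0n.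
apply: ordP_mul => //.
  apply: ordP_unit => //; rewrite -[4]/(4%:R) -mpolyC_nat evC.
  by rewrite (_ : 4%:R = 2%:R * 2%:R) ?mulf_neq0 // -natrM.
rewrite addnA; apply: ordP_mul => //; apply: ordP_mul => //; exact: half_ordP.
Qed.

(** An arbitrary pair replaces the sets that are not pairs, in order that sums
    over all lists make sense. *)
Let edge A : {set 'I_8} := if #|A| == 2%N then A else [set ord0; ord_max].
Let half_div A P := half_ord (edge_row (edge A)) P.
(** The sum of the half-divisors of the listed lines is the divisor of G / H,
    where the difference of the degrees of G and H is half of the number of
    lines. *)
Definition half_sum_principal (s : seq {set 'I_8}) : Prop :=
  exists d e (G H : {mpoly K[3]}), [/\ G \is d.-homog, H \is e.-homog,
    d.*2 = (e.*2 + size s)%N & forall P, on_curve F P ->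
      exists2 h, ordP F P H h & ordP F P G (h + \sum_(A <- s) half_div A P)].
Local Notation C := half_sum_principal.

Let edge2 A : #|edge A| = 2%N.
Proof. by rewrite /edge; case: eqP => // _; rewrite cards2. Qed.

Let edgeE A : #|A| = 2%N -> edge A = A.
Proof. by rewrite /edge => ->. Qed.

Let C_cat s s' : C s -> C s' -> C (s ++ s').
Proof.
move=> [d [e [G [H [hG hH de o]]]]] [d' [e' [G' [H' [hG' hH' de' o']]]]].
exists (d + d')%N, (e + e')%N, (G * G'), (H * H'); split.
- exact: dhomogM.
- exact: dhomogM.
- by rewrite !doubleD de de' size_cat addnACA.
move=> P PF; have [h oH oG] := o P PF; have [h' oH' oG'] := o' P PF.
exists (h + h')%N; first exact: ordP_mul.
by rewrite big_cat addnACA; apply: ordP_mul.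
Qed.

Let prod_ord s : exists2 Z : {mpoly K[3]}, Z \is (size s).-homog &
  forall P, on_curve F P -> ordP F P Z (\sum_(A <- s) half_div A P).*2.
Proof.
elim: s => [|A s [Z hZ oZ]].
  exists 1; first by exact: (@homog_nat _ _ 1).
  by move=> P PF; rewrite big_nil; apply: ordP_unit => //; rewrite ev1 oner_neq0.
exists (linform (edge_row (edge A)) * Z).
  exact: (homogM (add1n _) (linform_homog _) hZ).
move=> P PF; rewrite big_cons doubleD; apply: ordP_mul => //; last exact: oZ.
exact: half_ordP.
Qed.

(** The lists s and s' together contain every edge an even number of times, so
    the sum of the half-divisors over both is the divisor of a product Z of
    lines. *)
Let C_parity s s' :
  (forall A, odd (count_mem A s) = odd (count_mem A s')) -> C s -> C s'.
Proof.
move=> par [d [e [G [H [hG hH de o]]]]].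
have [A|r pr] := @even_halves _ (s ++ s'); first by rewrite count_cat oddD par addbb.
have sz : (size s + size s' = (size r).*2)%N.
  by rewrite -size_cat (perm_size pr) size_cat addnn.
have [Z hZ oZ] := prod_ord r.
(* The sum over s' is the divisor of Z minus that of G / H, so G and H are
   exchanged. *)
exists (size r + e)%N, d, (Z * H), G; split=> //; first exact: dhomogM.
  by rewrite doubleD -sz de addnC addnA.
move=> P PF; have [h oH oG] := o P PF; eexists; first exact: oG.
have := oZ P PF; rewrite -addnn -big_cat /= -(perm_big _ pr) big_cat /= => oZ'.
by rewrite -addnA addnC; apply: ordP_mul.
Qed.

Let C_conic A1 A2 A3 A4 c Q : #|A1| = 2%N -> #|A2| = 2%N -> #|A3| = 2%N -> #|A4| = 2%N ->
    Q \is 2.-homog ->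
    c%:MP * F = Q ^+ 2 - linform (edge_row A1) * (4 * linform (edge_row A2)
      * (linform (edge_row A3) * linform (edge_row A4))) ->
  C [:: A1; A2; A3; A4].
Proof.
move=> c1 c2 c3 c4 hQ e; exists 2%N, 0%N, Q, 1; split=> //; first exact: (@homog_nat _ _ 1).
move=> P PF; exists 0%N; first by apply: ordP_unit => //; rewrite ev1 oner_neq0.
have := conic_half_ord c1 c2 c3 c4 hQ e PF.
by rewrite add0n !big_cons !big_nil /half_div !edgeE.
Qed.

Lemma pair_card (i j : 'I_8) : i != j -> #|[set i; j]| = 2%N.
Proof. by move=> ij; rewrite cards2 ij. Qed.

(** The conic cuts out the sum of the contact divisors.  In a 4-cycle, opposite
    edges are listed next to each other. *)
Definition contact_conic (s : seq {set 'I_8}) := exists A1 A2 A3 A4 c Q,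
  [/\ s = [:: A1; A2; A3; A4], Q \is 2.-homog & c%:MP * F = Q ^+ 2
    - linform (edge_row A1) * (4 * linform (edge_row A2) * (linform (edge_row A3) * linform (edge_row A4)))].

Lemma cycle_contact i j k l : uniq [:: i; j; k; l] ->
  contact_conic [:: [set i; j]; [set k; l]; [set j; k]; [set l; i]].
Proof.
move=> us; have [c [Q [_ hQ e]]] := cycle_conic th_inj th_sum th_four us.
split_distinct us; do 6!eexists; split; [by []|exact: hQ|].
rewrite !edge_row_pair; [exact: e|by distinct..].
Qed.

Lemma matching_contact i j k l i' j' k' l' :
    uniq [:: i; j; k; l; i'; j'; k'; l'] ->
  contact_conic [:: [set i; j]; [set k; l]; [set i'; j']; [set k'; l']].
Proof.
move=> us; have [c [Q [_ hQ e]]] := matching_conic th_sum th_four us.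
split_distinct us; do 6!eexists; split; [by []|exact: hQ|].
rewrite !edge_row_pair; [exact: e|by distinct..].
Qed.

Let C_cycle i j k l : uniq [:: i; j; k; l] ->
  C [:: [set i; j]; [set j; k]; [set k; l]; [set l; i]].
Proof.
move=> us; have [A1 [A2 [A3 [A4 [c [Q [[<- <- <- <-] hQ e]]]]]]] := cycle_contact us.
split_distinct us.
apply: (@C_parity [:: [set i; j]; [set k; l]; [set j; k]; [set l; i]]).
  by move=> A /=; rewrite !oddD; case: (odd _); case: (odd _); case: (odd _); case: (odd _).
by apply: (C_conic _ _ _ _ hQ e); apply: pair_card; distinct.
Qed.

Let C_matching i j k l i' j' k' l' : uniq [:: i; j; k; l; i'; j'; k'; l'] ->
  C [:: [set i; j]; [set k; l]; [set i'; j']; [set k'; l']].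
Proof.
move=> us; have [A1 [A2 [A3 [A4 [c [Q [[<- <- <- <-] hQ e]]]]]]] := matching_contact us.
split_distinct us.
by apply: (C_conic _ _ _ _ hQ e); apply: pair_card; distinct.
Qed.

(** This is [contact_inequiv], as two lines give G of degree one more than
    H. *)
Let C_two i j k l : i != j -> k != l -> C [:: [set i; j]; [set k; l]] ->
  [set i; j] = [set k; l].
Proof.
move=> ij kl [d [e [G [H [hG hH de o]]]]].
have ed : d = e.+1 by apply: double_inj; rewrite de doubleS addn2.
rewrite ed in hG.
have b0 A : edge_row A != 0 by exact: bitan_row_neq0.
apply: (pair_row_inj char2 th_inj th_sum th_four ij kl); rewrite -!edge_row_pair //.
apply: (contact_inequiv hF sm ev_quarticm_O (b0 _) (b0 _) hG hH) => P PF.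
have [h oH oG] := o P PF; exists h, (half_ord (edge_row [set i; j]) P), (half_ord (edge_row [set k; l]) P).
split=> //; try by apply: half_ordP => //; apply: pair_card.
by move: oG; rewrite !big_cons big_nil addn0 addnA /half_div !edgeE ?pair_card.
Qed.

Lemma bitangent_edge_row A : #|A| = 2%N -> bitangent F (edge_row A).
Proof.
move=> cA; split; first exact: bitan_row_neq0.
exists (fun P => (half_ord (edge_row A) P)%:Z) => P PF.
exists (half_ord (edge_row A) P).*2; last by rewrite -addnn PoszD mulr2n.
by apply: (ordP_ord_at hF sm PF (linform_homog _)); apply: half_ordP.
Qed.

Lemma edge_row_inj A B : #|A| = 2%N -> #|B| = 2%N -> (edge_row A == edge_row B)%MS -> A = B.
Proof.
move=> /eqP/cards2P [i [j [ij ->]]] /eqP/cards2P [k [l [kl ->]]].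
rewrite !edge_row_pair // => /eqmxP e; apply: (pair_row_inj char2 th_inj th_sum th_four ij kl).
by rewrite e.
Qed.

Lemma bitangent_is_edge_row L : bitangent F L ->
  exists2 A : {set 'I_8}, #|A| = 2%N & (edge_row A == L)%MS.
Proof.
move=> /(bitangent_pair_row char2 th_inj th_sum th_four) [i [j [ij e]]].
by exists [set i; j]; rewrite ?pair_card // edge_row_pair.
Qed.

(** Orders are unique, so a bitangent has only one contact divisor. *)
Lemma contact_divisor_half L D P : contact_divisor F L D -> on_curve F P ->
  ordP F P (linform L) (half_ord L P).*2 /\ D P = (half_ord L P)%:Z.
Proof.
move=> LD PF; have [n /ord_at_ordP on En] := LD P PF.
have ev : exists m, ordP F P (linform L) m.*2.
  have := congr1 absz En; rewrite -mulr_natr abszM /= => en.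
  by exists `|D P|%N; rewrite -muln2 en.
have o := epsilon_spec (inhabits 0%N) _ ev; split; first exact: o.
have en := ordP_uniq hF sm PF on o; rewrite en in En.
apply: (@mulIf _ (2 : int)) => //; rewrite !mulr_natr En.
by rewrite -/(half_ord L P) -addnn PoszD mulr2n.
Qed.

Lemma posz_sum (I : Type) (r : seq I) (f : I -> nat) :
  \sum_(x <- r) (f x)%:Z = (\sum_(x <- r) f x)%N%:Z.
Proof. by elim: r => [|x r IHr]; rewrite ?big_nil // !big_cons IHr PoszD. Qed.

(** The conic Q cuts out the sum of the four contact divisors, and twice the
    canonical divisor is the divisor of the square of the first line. *)
Lemma contact_conic_syzygetic s r : perm_eq s r -> contact_conic r ->
    uniq s -> (forall A, A \in s -> #|A| = 2%N) ->
  syzygetic F [seq edge_row A | A <- s].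
Proof.
move=> pr [A1 [A2 [A3 [A4 [c [Q [er hQ e]]]]]]] us c2.
have c2r A : A \in r -> #|A| = 2%N by rewrite -(perm_mem pr); apply: c2.
split.
- by rewrite size_map (perm_size pr) er.
- rewrite pairwise_map; move: us c2; elim: s {pr} => // A s IHs /= /andP [As us] c2.
  rewrite IHs //; last by move=> B Bs; apply: c2; rewrite inE Bs orbT.
  rewrite andbT; apply/allP => B Bs /=; apply: contra As => /edge_row_inj -> //.
    by apply: c2; rewrite inE eqxx.
  by apply: c2; rewrite inE Bs orbT.
- by move=> L /mapP [A As ->]; apply/bitangent_edge_row/c2.
have A1r : A1 \in r by rewrite er inE eqxx.
exists (fun L P => (half_ord L P)%:Z), (fun P => (half_ord (edge_row A1) P).*2%:Z).
have contact A : #|A| = 2%N -> contact_divisor F (edge_row A) (fun P => (half_ord (edge_row A) P)%:Z).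
  move=> cA P PF; exists (half_ord (edge_row A) P).*2; last by rewrite -addnn PoszD mulr2n.
  by apply: (ordP_ord_at hF sm PF (linform_homog _)); apply: half_ordP.
split.
- by move=> L /mapP [A As ->]; apply/contact/c2.
- exists (edge_row A1); first exact: bitan_row_neq0.
  move=> P PF; exists (half_ord (edge_row A1) P).*2 => //.
  by apply: (ordP_ord_at hF sm PF (linform_homog _)); apply: half_ordP => //; apply: c2r.
exists 2%N, Q, (linform (edge_row A1) ^+ 2).
exists (fun P => (\sum_(A <- r) half_ord (edge_row A) P)%:Z).
exists (fun P => ((half_ord (edge_row A1) P).*2 * 2)%:Z).
have h2 : linform (edge_row A1) ^+ 2 \is 2.-homog by apply/homogX1/linform_homog.
split=> //.
- move=> P PF; eexists; last by []. 
  apply: (ordP_ord_at hF sm PF hQ); rewrite er.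
  by apply: (conic_half_ord _ _ _ _ hQ e PF); apply: c2r; rewrite er !inE eqxx ?orbT.
- move=> P PF; eexists; last by [].
  apply: (ordP_ord_at hF sm PF h2); apply: ordP_exp => //.
  by apply: half_ordP => //; apply: c2r.
move=> P PF; rewrite big_map (perm_big _ pr) /= posz_sum.
by rewrite muln2 -[in RHS]addnn PoszD mulr2n.
Qed.

(** If the divisor of G / H is the difference of the sum and of twice the
    canonical divisor cut out by M, then the sum is the divisor of G M^2 /
    H. *)
Lemma syzygetic_principal s : uniq s -> (forall A, A \in s -> #|A| = 2%N) ->
  syzygetic F [seq edge_row A | A <- s] -> half_sum_principal s.
Proof.
move=> us c2 [sz _ _ [D [KC [LD [M M0 KM] [d [G [H [DG [DH [hG hH oG oH e]]]]]]]]]].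
exists (d + 2)%N, d, (G * linform M ^+ 2), H; split=> //.
- by apply: dhomogM => //; apply/homogX1/linform_homog.
- by rewrite size_map in sz; rewrite sz doubleD.
move=> P PF; have [g /ord_at_ordP og eg] := oG P PF.
have [h /ord_at_ordP oh eh] := oH P PF; have [m /ord_at_ordP om em] := KM P PF.
exists h => //.
suff -> : (h + \sum_(A <- s) half_div A P = g + m * 2)%N.
  by apply: ordP_mul => //; apply: ordP_exp.
have := e P PF; rewrite eg eh em big_map.
have -> : \sum_(A <- s) D (edge_row A) P = (\sum_(A <- s) half_div A P)%N%:Z.
  rewrite -posz_sum; apply: eq_big_seq => A As; rewrite /half_div edgeE ?c2 //.
  by have [] := contact_divisor_half (LD _ (map_f edge_row As)) PF.
move=> ee; apply/eqP; rewrite -eqz_nat; apply/eqP.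
rewrite !PoszD -[(\sum_(A <- s) half_div A P)%N%:Z](subrK (m%:Z *+ 2)) ee muln2 -addnn PoszD.
by ring.
Qed.

Theorem tetrads_syzygetic (t : {set pair8}) :
  t \in tetrads8 <-> syzygetic F [seq edge_row (val p) | p <- enum t].
Proof.
pose s : seq {set 'I_8} := [seq val p | p <- enum t].
have us : uniq s by rewrite map_inj_uniq ?enum_uniq //; apply: val_inj.
have c2 A : A \in s -> #|A| = 2%N by case/mapP => p _ ->; apply/eqP/(valP p).
have eE : [set val p | p in t] = [set A in s].
  apply/setP => A; rewrite inE; apply/imsetP/mapP => -[p pt ->]; exists p => //.
    by rewrite mem_enum.
  by move: pt; rewrite mem_enum.
rewrite (_ : [seq _ | p <- enum t] = [seq edge_row A | A <- s]); last by rewrite -map_comp.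
rewrite /tetrads8 inE /= eE; split; last first.
  move=> syz; have [sz _ _ _] := syz; rewrite size_map in sz.
  have Cs := syzygetic_principal us c2 syz.
  exact: (tetrad_of_C C_cat C_parity C_cycle C_matching C_two sz us c2 Cs).
case/orP => [|part].
  case/existsP => i /existsP [j /existsP [k /existsP [l /andP [uijkl /eqP e]]]].
  apply: (contact_conic_syzygetic _ (cycle_contact uijkl) us c2).
  apply: (uniq_perm us).
    split_distinct uijkl.
    do !(apply/andP; split) => //.
    + by apply/eqP/pair_neq; distinct.
    + by apply/eqP/pair_neq; distinct.
    + by rewrite (pairC i j); apply/eqP/pair_neq; distinct.
    + by rewrite (pairC k l); apply/eqP/pair_neq; distinct.
    + by apply/eqP/pair_neq; distinct.
    + by apply/eqP/pair_neq; distinct.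
  by move=> A; move/setP/(_ A): e; rewrite !inE => ->; boolean.
have [j1 [j2 [j3 [j4 [j5 [j6 [j7 [j8 [u8 es]]]]]]]]] := perfect_matching us c2 part.
apply: (contact_conic_syzygetic (perm_refl s) _ us c2).
by rewrite es; apply: matching_contact.
Qed.
End Syzygetic.

(** * Equivariant points in general position *)

(** The image of i is the common element of the images of two pairs {i, j} and
    {i, k}. *)
Lemma pair_perm_inj : injective pair_perm.
Proof.
move=> s t est; apply/permP => i.
have img (p : pair8) : s @: val p = t @: val p.
  by move/permP/(_ p)/(congr1 val): est; rewrite !permE.
have img2 j : i != j -> [set s i; s j] = [set t i; t j].
  move=> ij; have c : #|[set i; j]| == 2%N by rewrite cards2 ij.
  by have := img (exist _ [set i; j] c); rewrite /= !imsetU !imset_set1.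
have [j hj] := @avoid [:: i] isT; have [k hk] := @avoid [:: i; j] isT.
have kj : k != j by move: hk; rewrite !inE negb_or => /andP [].
split_distinct hj; split_distinct hk.
have : s i \in [set t i; t j] by rewrite -img2 ?set21 // eq_sym.
have : s i \in [set t i; t k] by rewrite -img2 ?set21 // eq_sym.
rewrite !inE => /orP [/eqP //|/eqP ->] /orP [/eqP //|].
by rewrite (inj_eq perm_inj) ?(negbTE kj) // eq_sym (negbTE kj).
Qed.

Lemma pair_permM s t : pair_perm (s * t) = (pair_perm s * pair_perm t)%g.
Proof.
apply/permP => p; rewrite permM !permE; apply/val_inj; rewrite /= -imset_comp.
by apply: eq_imset => x /=; rewrite permM.
Qed.

Section Avoidance.
Variables (k : fieldType) (k_infinite : infinite_type k) (l : fieldExtType k).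

(** Only finitely many elements of a finite subset of l come from k. *)
Lemma avoid_scalars (r : seq l) : exists t : k, t%:A \notin r.
Proof.
have [r' hr] : exists r' : seq k, forall t : k, t%:A \in r -> t \in r'.
  elim: r => [|y r [r' IHr]]; first by exists [::].
  have [/vlineP [z ez]|ny] := boolP (y \in 1%VS).
    exists (z :: r') => t; rewrite !inE ez (inj_eq (fmorph_inj (in_alg l))) /=.
    by move=> /orP [-> //|/IHr ->]; rewrite orbT.
  exists r' => t; rewrite inE => /orP [/eqP ty|/IHr //].
  by case/negP: ny; rewrite -ty; apply/vlineP; exists t.
by have [t tr] := k_infinite r'; exists t; apply: contra tr => /hr.
Qed.

(** Induction on the number of functionals: on a line v + t w each functional
    has at most one zero, unless it vanishes identically there. *)
Lemma avoid_hyperplanes (V : lmodType k) (T : eqType) (r : seq T) (phi : T -> V -> l) :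
    (forall x t v w, x \in r -> phi x (v + t *: w) = phi x v + t%:A * phi x w) ->
    (forall x, x \in r -> exists v, phi x v != 0) ->
  exists v, forall x, x \in r -> phi x v != 0.
Proof.
elim: r => [|x r IHr] lin nz; first by exists 0.
have [||v hv] := IHr; [by move=> y t v w yr; apply: lin; rewrite inE yr orbT| |].
  by move=> y yr; apply: nz; rewrite inE yr orbT.
have [w hw] := nz x (mem_head _ _).
have [t ht] := avoid_scalars [seq - (phi y v / phi y w) | y <- x :: r].
exists (v + t *: w) => y yr; rewrite lin //; apply/eqP => e0.
have [w0|w0] := eqVneq (phi y w) 0.
  move: e0 yr; rewrite w0 mulr0 addr0 inE => v0 /orP [/eqP yx|/hv].
    by rewrite -yx w0 eqxx in hw.
  by rewrite v0 eqxx.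
case/negP: ht; apply/mapP; exists y => //.
by apply: (mulIf w0); rewrite mulNr divfK //; apply/eqP; rewrite -addr_eq0 addrC e0.
Qed.
End Avoidance.

Section EquivariantPoints.
Variables (k : fieldType) (k_infinite : infinite_type k) (l : splittingFieldType k).
Hypothesis char2 : (2%:R : l) != 0.
Local Notation G := ('Gal({:l} / 1))%g.
Variable s : gal_of {:l} -> 'S_8.
Hypothesis sM : {in G &, forall x y, s (x * y)%g = (s x * s y)%g}.

Let s1 : s 1%g = 1%g.
Proof.
have := sM (group1 _) (group1 _); rewrite mul1g => e.
by apply: (mulgI (s 1%g)); rewrite mulg1 -e.
Qed.

(** The sum over the group turns any function v on the eight indices into an
    equivariant one. *)
Definition symmetrize (v : {ffun 'I_8 -> l}) (j : 'I_8) : l :=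
  \sum_(x in G) x (v ((s x)^-1%g j)).

Lemma symmetrize_equivariant v x j : x \in G ->
  x (symmetrize v j) = symmetrize v (s x j).
Proof.
move=> xG; rewrite /symmetrize rmorph_sum [RHS](reindex_inj (mulIg x)) /=.
apply: eq_big => y; first by rewrite groupMr.
move=> yG; rewrite galM ?memvf //; congr (x (y (v _))).
by rewrite sM // invMg permM permK.
Qed.

Lemma symmetrize_linear v w t j :
  symmetrize (v + t *: w) j = symmetrize v j + t%:A * symmetrize w j.
Proof.
rewrite /symmetrize mulr_sumr -big_split /=; apply: eq_bigr => x _.
by rewrite !ffunE linearD linearZ /= mulr_algl.
Qed.

(** By independence of characters: for v supported at m0, the functional is a
    combination of the automorphisms in which the identity has coefficient c
    m0. *)
Lemma symmetrize_functional (c : 'I_8 -> l) m0 : c m0 != 0 ->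
  exists v, \sum_m c m * symmetrize v m != 0.
Proof.
move=> c0; have [||a _ ha] := @gal_independent_contra _ _ {:l} [in G]
  (fun x => c (s x m0)) 1%g; [exact: group1 | by rewrite s1 perm1|].
exists [ffun j => if j == m0 then a else 0]; apply: contra_neq ha => e.
rewrite -[RHS]e; under [RHS]eq_bigr do rewrite mulr_sumr.
rewrite exchange_big /=; apply: eq_bigr => x xG.
rewrite (bigD1 (s x m0)) //= big1 => [|m mn]; first by rewrite ffunE permK eqxx addr0.
by rewrite ffunE -(inj_eq (@perm_inj _ (s x))) permKV (negbTE mn) rmorph0 mulr0.
Qed.

(** The conditions are finitely many linear ones on equivariant functions.
    Subtracting the mean makes the sum 0 and preserves the equivariance. *)
Theorem exists_equivariant_points : exists th : 'I_8 -> l,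
  [/\ forall x j, x \in G -> x (th j) = th (s x j), injective th, \sum_j th j = 0 &
      forall i j m n, uniq [:: i; j; m; n] -> th i + th j + th m + th n != 0].
Proof.
(* The coefficients of the conditions; a condition with a repeated index is
   replaced by an arbitrary nonzero one.  The second family is twice a sum of
   four coordinates, after the mean has been subtracted from each. *)
pose pairc (i j : 'I_8) (m : 'I_8) : l :=
  if i != j then (m == i)%:R - (m == j)%:R else 1.
pose fourc (r : seq 'I_8) (m : 'I_8) : l := if uniq r && (size r == 4%N) then 2 * (m \in r)%:R - 1 else 1.
pose c (x : ('I_8 * 'I_8) + 4.-tuple 'I_8) := match x with
  | inl ij => pairc ij.1 ij.2 | inr r => fourc r end.
have cnz x : exists m, c x m != 0.
  case: x => [[i j]|r] /=.
    exists i; rewrite /pairc; have [ij|ij] := boolP (i != j); last exact: oner_neq0.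
    by rewrite eqxx (negbTE ij) subr0 oner_neq0.
  exists ord0; rewrite /fourc; case: ifP => _; last exact: oner_neq0.
  case: (_ \in _); first by rewrite mulr1 (_ : 2 - 1 = 1) ?oner_neq0 //; ring.
  by rewrite mulr0 sub0r oppr_eq0 oner_neq0.
have [||v hv] := avoid_hyperplanes k_infinite
  (phi := fun x v => \sum_m c x m * symmetrize v m) (r := enum {: ('I_8 * 'I_8) + 4.-tuple 'I_8}).
- move=> x t v w _; rewrite mulr_sumr -big_split /=; apply: eq_bigr => m _.
  by rewrite symmetrize_linear; ring.
- by move=> x _; have [m cm] := cnz x; apply: symmetrize_functional cm.
pose th0 := symmetrize v; pose S := \sum_j th0 j.
have h8 : (8%:R : l) != 0 by rewrite (_ : 8 = 2 * 2 * 2 :> l) ?mulf_neq0 //; ring.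
exists (fun j => th0 j - S / 8%:R); split.
- move=> x j xG; rewrite rmorphB fmorph_div rmorph_nat /= symmetrize_equivariant //.
  congr (_ - _ / _); rewrite rmorph_sum [RHS](reindex_inj (@perm_inj _ (s x))) /=.
  by apply: eq_bigr => m _; apply: symmetrize_equivariant.
- move=> i j /addIr eij; apply/eqP/negPn/negP => ij.
  have /negP [] := hv (inl (i, j)) (mem_enum _ _).
  rewrite /= /pairc ij; under eq_bigr do rewrite mulrBl !mulr_natl !mulrb.
  by rewrite sumrB -!big_mkcond /= !big_pred1_eq -/(th0 i) eij subrr.
- by rewrite sumrB sumr_const card_ord -/S -[(_ / _) *+ _]mulr_natr divfK // subrr.
move=> i j m n us; have /negP := hv (inr [tuple i; j; m; n]) (mem_enum _ _).
rewrite /= /fourc us /=; under eq_bigr do rewrite mulrBl mul1r -mulrA (mulr_natl _ (nat_of_bool _)) mulrb.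
rewrite sumrB -mulr_sumr -big_mkcond -big_uniq //= -/S !big_cons big_nil addr0.
move=> h; apply/negP => /eqP e; apply: h; apply/eqP.
rewrite -/(th0 i) -/(th0 j) -/(th0 m) -/(th0 n).
have -> : th0 i + (th0 j + (th0 m + th0 n)) = S / 2.
  apply/eqP; rewrite -subr_eq0 -e; apply/eqP; field.
  by rewrite char2 h8.
by rewrite mulrC divfK // subrr.
Qed.
End EquivariantPoints.

(** * Galois descent and the field of definition *)

Lemma map_quarticm (R S : comNzRingType) (f : {rmorphism R -> S}) a b :
  (forall i, (i < 7)%N -> f (a i) = b i) -> map_mpoly f (quarticm a) = quarticm b.
Proof.
move=> ab; rewrite /quarticm rmorph_quartic /= rmorphD /= !map_mpolyX.
by apply: eq_quartic => i i7; rewrite /= map_mpolyC /= ab.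
Qed.

Lemma map_bitan_row (R S : comNzRingType) (f : {rmorphism R -> S}) a b u n :
  (forall i, (i < 7)%N -> f (a i) = b i) ->
  map_mx f (bitan_row a u n) = bitan_row b (f u) (f n).
Proof.
move=> ab; apply/rowP => j; rewrite !mxE.
case: j => [[|[|[|]]]] //= _; last 2 first.
- by rewrite rmorphN rmorphXn.
- by rewrite rmorphB rmorph1 rmorphXn.
by rewrite rmorph_bitan /= rmorph0 rmorph1; apply: eq_bitan => i i7; apply: ab.
Qed.

(** An element of M(x) is a polynomial in x with coefficients in M. *)
Lemma adjoin_closed (k : fieldType) (l : fieldExtType k) (E : l -> Prop)
    (M : {subfield l}) (r : seq l) :
    (forall y z, E y -> E z -> E (y - z)) -> (forall y z, E y -> E z -> E (y * z)) ->
    (forall y, y \in M -> E y) -> (forall y, y \in r -> E y) ->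
  forall y, y \in <<M & r>>%VS -> E y.
Proof.
move=> EB EM; elim: r M => [|x r IHr] M EMM Er y; first by rewrite Fadjoin_nil; apply: EMM.
have E0 : E 0 by apply: EMM; apply: mem0v.
have ED u v : E u -> E v -> E (u + v).
  by move=> Eu Ev; rewrite -[v]opprK; apply: (EB) => //; rewrite -sub0r; apply: EB.
rewrite adjoin_cons; apply: (IHr <<M; x>>%AS) => [z|z zr]; last first.
  by apply: Er; rewrite inE zr orbT.
case/Fadjoin_polyP => p /polyOverP pM ->; rewrite horner_coef.
apply: (big_ind E) => // j _; apply: (EM); first exact/EMM/pM.
elim: (j : nat) => [|n IHn]; first by apply: EMM; apply: mem1v.
by rewrite exprS; apply: (EM) => //; apply: Er; apply: mem_head.
Qed.

Lemma bitan_row_coord (R : comNzRingType) (a : nat -> R) u n :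
  bitan_row a u n 0 (inord 2) - bitan_row a u n 0 (inord 1) = 1.
Proof. by rewrite !mxE !inordK //=; ring. Qed.

Section Main.
Variables (k : fieldType) (k_infinite : infinite_type k).
Hypothesis k_char : 2%N \notin [pchar k].
Variables (l : splittingFieldType k) (l_galois : galois 1%AS {:l}%AS).
Variable i : {morphism 'Gal({:l} / 1)%g >-> {perm pair8}}.
Hypotheses (i_inj : ('injm i)%g) (i_U36 : (i @* 'Gal({:l} / 1))%g \subset U36).
Variables (kbar : closedFieldType) (e : {rmorphism l -> kbar}).
Local Notation G := ('Gal({:l} / 1))%g.
Let f : {rmorphism k -> kbar} := e \o in_alg l.

Lemma two_neq0 (R : nzRingType) (g : {rmorphism k -> R}) : (2%:R : R) != 0.
Proof.
rewrite -(rmorph_nat g) fmorph_eq0; apply: contra k_char => k2.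
by rewrite inE /= k2.
Qed.

(** The permutation of the eight indices that induces i x on the pairs. *)
Definition lift_perm8 (x : gal_of {:l}) : 'S_8 := odflt 1%g [pick t | i x == pair_perm t].

Lemma lift_perm8P x : x \in G -> i x = pair_perm (lift_perm8 x).
Proof.
move=> xG; have : i x \in U36 by apply: (subsetP i_U36); apply: mem_morphim.
case/imsetP => t _ it; rewrite /lift_perm8; case: pickP => [t' /eqP //|/(_ t)].
by rewrite it eqxx.
Qed.

Lemma lift_perm8M : {in G &, forall x y,
  lift_perm8 (x * y)%g = (lift_perm8 x * lift_perm8 y)%g}.
Proof.
move=> x y xG yG; apply: pair_perm_inj.
by rewrite pair_permM -!lift_perm8P ?groupM // morphM.
Qed.

Lemma separable_image x : separable_elt f (e x).
Proof.
have /and3P [_ /separableP sep _] := l_galois.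
have /polyOver1P [p ep] := minPolyOver 1 x.
exists p; first by have := sep x (memvf x); rewrite /separable_element ep separable_map.
rewrite map_poly_comp -ep; apply: rmorph_root; exact: root_minPoly.
Qed.

Lemma image_subextension : separable_subextension f (fun z => exists x : l, z = e x).
Proof.
split.
- by move=> x; exists x%:A.
- by move=> _ _ [x ->] [y ->]; exists (x - y); rewrite rmorphB.
- by move=> _ _ [x ->] [y ->]; exists (x * y); rewrite rmorphM.
- by move=> _ [x ->]; exists x^-1; rewrite fmorphV.
by move=> _ [x ->]; apply: separable_image.
Qed.

Section WithPoints.
Variable th : 'I_8 -> l.
Hypothesis th_equiv : forall x j, x \in G -> x (th j) = th (lift_perm8 x j).
Hypothesis th_inj : injective th.
Hypothesis th_sum : \sum_j th j = 0.
Hypothesis th_four : forall a j m n, uniq [:: a; j; m; n] ->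
  th a + th j + th m + th n != 0.

(** The coefficients of the octic are invariant under the Galois group. *)
Lemma octic_descent : exists q : {poly k}, forall n,
  oct_coef (e \o th) n = f q`_n.
Proof.
pose p := \prod_j ('X - (th j)%:P).
have p1 : p \is a polyOver 1%VS.
  apply/polyOverP => n; have /galois_fixedField <- := l_galois.
  apply/fixedFieldP => [|x xG]; first exact: memvf.
  suff ep : map_poly x p = p by rewrite -{2}ep coef_map.
  rewrite /p rmorph_prod [RHS](reindex_inj (@perm_inj _ (lift_perm8 x))) /=.
  by apply: eq_bigr => j _; rewrite rmorphB /= map_polyX map_polyC /= th_equiv.
have [q eq] := polyOver1P p1; exists q => n.
have -> : oct_coef (e \o th) n = (map_poly e p)`_n.
  rewrite /oct_coef /octic /p rmorph_prod; congr (nth 0 (polyseq _) _).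
  by apply: eq_bigr => j _; rewrite rmorphB /= map_polyX map_polyC.
by rewrite coef_map eq coef_map.
Qed.

Let e_inj : injective (e \o th) := inj_comp (fmorph_inj e) th_inj.
Let e_sum : \sum_j (e \o th) j = 0.
Proof. by rewrite -rmorph_sum th_sum rmorph0. Qed.
Let e_four a j m n : uniq [:: a; j; m; n] ->
  (e \o th) a + (e \o th) j + (e \o th) m + (e \o th) n != 0.
Proof. by move=> us; rewrite /= -!rmorphD fmorph_eq0 th_four. Qed.
Let e_two : (2%:R : kbar) != 0 := two_neq0 f.

(** The quartic of the descended octic.  If the lines are defined over a field,
    so are their coordinates, normalized by the difference 1 of the last two;
    an automorphism that fixes these coordinates fixes all lines, hence it is
    the identity. *)
Theorem curve_of_points : exists F : {mpoly k[3]},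
    [/\ nonsingular_quartic f F,
        field_of_def_bitangents f F (fun z => exists x : l, z = e x) &
        exists beta : pair8 -> 'rV[l]_3,
          bitangent_marking f e F beta /\
          forall sigma, sigma \in G ->
            forall p : pair8,
              (map_mx sigma (beta p) == beta (i sigma p))%MS].
Proof.
have [q hq] := octic_descent; pose F : {mpoly k[3]} := quarticm (fun n => q`_n).
have eF : map_mpoly f F = quarticm (oct_coef (e \o th)).
  by apply: map_quarticm => n _; rewrite hq.
pose row (A : {set 'I_8}) : 'rV[l]_3 :=
  bitan_row (fun n => (q`_n)%:A) (\sum_(x in A) th x) (\prod_(x in A) th x).
pose beta (p : pair8) := row (val p).
have map_beta p : map_mx e (beta p) = edge_row (e \o th) (val p).
  rewrite /beta /row (@map_bitan_row _ _ e _ (oct_coef (e \o th))).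
    by rewrite rmorph_sum rmorph_prod.
  by move=> n _; rewrite hq.
have card2 (p : pair8) : #|val p| = 2%N by apply/eqP/(valP p).
have defined p : line_defined_over (fun z => exists x : l, z = e x) (map_mx e (beta p)).
  exists (map_mx e (beta p)) => [|j]; first by rewrite submx_refl.
  by exists (beta p 0 j); rewrite mxE.
have sep_beta p : sep_bitangent f F (map_mx e (beta p)).
  split; first by rewrite eF map_beta; apply: bitangent_edge_row.
  have [M eM hM] := defined p; exists M => // j.
  by have [x ->] := hM j; apply: separable_image.
have beta_inj p p' : (beta p == beta p')%MS -> p = p'.
  move=> epp; apply/val_inj.
  apply: (edge_row_inj e_two e_inj e_sum e_four) => //.
  by rewrite -!map_beta !map_submx.
have beta_all L : sep_bitangent f F L -> exists p, (map_mx e (beta p) == L)%MS.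
  move=> [bL _]; rewrite eF in bL.
  have [A cA eA] := bitangent_is_edge_row e_two e_inj e_sum e_four bL.
  by exists (exist _ A (introT eqP cA)); rewrite map_beta.
have galois_beta x p : x \in G -> map_mx x (beta p) = beta (i x p).
  move=> xG; rewrite (lift_perm8P xG) permE /beta /row /=.
  rewrite (@map_bitan_row _ _ x _ (fun n => (q`_n)%:A)) => [|n _]; last first.
    by rewrite /= rmorph_alg.
  rewrite rmorph_sum rmorph_prod /=.
  rewrite !big_imset /=; try by move=> ? ? _ _; apply: perm_inj.
  by congr bitan_row; apply: eq_bigr => j _; apply: th_equiv.
exists F; split.
- split; first exact: quarticm_homog.
  by rewrite eF; apply: quarticm_smooth.
- split.
  + exact: image_subextension.
  + move=> L /beta_all [p ep]; have [M eM hM] := defined p.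
    by exists M => //; apply/eqmxP; apply: eqmx_trans (eqmxP eM) (eqmxP ep).
  move=> E [Ek EB EM EV _] hE _ [y ->].
  have coordE p j : E (e (beta p 0 j)).
    have [M /eqmxP eM ME] := hE _ (sep_beta p).
    have /sub_rVP [c ec] : (M <= map_mx e (beta p))%MS by rewrite eM.
    have Mc j' : M 0 j' = c * e (beta p 0 j') by rewrite ec !mxE.
    have c0 : c != 0.
      apply/eqP => c0; have : (map_mx e (beta p) <= M)%MS by rewrite eM.
      have -> : M = 0 by rewrite ec c0 scale0r.
      by move/submx0null/eqP; rewrite map_beta (negbTE (bitan_row_neq0 _ _ _)).
    have ecoord j' : e (beta p 0 j') = M 0 j' * c^-1.
      by rewrite Mc mulrAC divff // mul1r.
    (* The last two coordinates of beta p differ by 1. *)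
    have Ec : E c.
      have <- : M 0 (inord 2) - M 0 (inord 1) = c.
        by rewrite !Mc -mulrBr -rmorphB bitan_row_coord rmorph1 mulr1.
      exact: EB.
    by rewrite ecoord; apply: EM => //; apply: EV.
  (* The field generated by the coordinates of all lines. *)
  pose r := [seq beta p 0 j | p <- enum {: pair8}, j <- enum 'I_3].
  pose M := <<1 & r>>%AS.
  have MT : (M = {:l} :> {vspace l})%VS.
    have galM : galois M {:l} by apply: galoisS l_galois; rewrite sub1v subvf.
    have /galois_fixedField <- := galM; apply/eqP; rewrite eqEsubv subvf /=.
    apply/subvP => z _; apply/fixedFieldP => [|x xM]; first exact: memvf.
    have xG : x \in G by apply: subsetP xM; apply: galS; apply: sub1v.
    suff -> : x = 1%g by rewrite gal_id.
    apply: (injmP i_inj) => //; rewrite morph1; apply/permP => p; rewrite perm1.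
    apply: beta_inj; rewrite -galois_beta //.
    suff -> : map_mx x (beta p) = beta p by rewrite submx_refl.
    apply/matrixP => a j; rewrite ord1 mxE.
    apply: (fixed_gal _ xM); first exact: subvf.
    apply: seqv_sub_adjoin; apply/allpairsP; exists (p, j).
    by split; rewrite ?mem_enum.
  have := memvf y; rewrite -MT; apply: (adjoin_closed (E := E \o e)).
  + by move=> u v Eu Ev; rewrite /= rmorphB; apply: EB.
  + by move=> u v Eu Ev; rewrite /= rmorphM; apply: EM.
  + by move=> _ /vlineP [c ->]; apply: (Ek c).
  by move=> _ /allpairsP [[p j] [_ _ ->]]; apply: coordE.
exists beta; split; last by move=> x xG p; rewrite galois_beta // submx_refl.
split=> // t; rewrite eF.
rewrite (eq_map map_beta); exact: tetrads_syzygetic.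
Qed.
End WithPoints.
End Main.

Theorem theorem1p2 (k : fieldType) (k_infinite : infinite_type k)
    (k_char : 2%N \notin [pchar k])
    (l : splittingFieldType k) (l_galois : galois 1%AS {:l}%AS)
    (i : {morphism 'Gal({:l} / 1)%g >-> {perm pair8}})
    (i_inj : ('injm i)%g) (i_U36 : (i @* 'Gal({:l} / 1))%g \subset U36)
    (kbar : closedFieldType) (e : {rmorphism l -> kbar})
    (kbar_algebraic : integralRange e) :
  let f : {rmorphism k -> kbar} := e \o in_alg l in
  exists F : {mpoly k[3]},
    [/\ nonsingular_quartic f F,
        field_of_def_bitangents f F (fun z => exists x : l, z = e x) &
        exists beta : pair8 -> 'rV[l]_3,
          bitangent_marking f e F beta /\
          forall sigma, sigma \in 'Gal({:l} / 1)%g ->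
            forall p : pair8,
              (map_mx sigma (beta p) == beta (i sigma p))%MS].
Proof.
have char2 := two_neq0 k_char (in_alg l).
have [th [th_equiv th_inj th_sum th_four]] :=
  exists_equivariant_points k_infinite char2 (lift_perm8M i_U36).
exact: (curve_of_points k_char l_galois i_inj i_U36 e th_equiv th_inj th_sum th_four).
Qed.
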